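(* For every $0\le i\le n$, $e_i^cR=Re_i^c$ as rational maps on the variables $(x,y)$ of $\mathcal B\times\mathcal B$, where $R$ is the tropical $R$.
   Context: Let $n\ge 4$. Variables are real; all maps and identities are rational (identities hold wherever both sides are defined); $c$ is a parameter; $\delta_{ij}$ is the Kronecker delta; empty products are $1$. **The geometric $D^{(1)}_n$-crystal $\mathcal B$.** Variables $x=(x_1,\dots,x_n,\bar x_{n-1},\dots,\bar x_1)$. Functions: $\varepsilon_0(x)=x_1(\frac{x_2}{\bar x_2}+1)$, $\varphi_0(x)=\bar x_1(\frac{\bar x_2}{x_2}+1)$; $\varepsilon_i(x)=\bar x_i(\frac{x_{i+1}}{\bar x_{i+1}}+1)$, $\varphi_i(x)=x_i(\frac{\bar x_{i+1}}{x_{i+1}}+1)$ for $1\le i\le n-2$; $\varepsilon_{n-1}(x)=x_n\bar x_{n-1}$, $\varphi_{n-1}(x)=x_{n-1}$; $\varepsilon_n(x)=\bar x_{n-1}$, $\varphi_n(x)=x_{n-1}x_n$. With $\xi_i=\frac{x_i+c\bar x_i}{x_i+\bar x_i}$, the map $e_i^c$ changes only the listed coordinates: $e_0^c$: $x_1\mapsto\xi_2^{-1}x_1$, $x_2\mapsto c^{-1}\xi_2x_2$, $\bar x_2\mapsto\xi_2\bar x_2$, $\bar x_1\mapsto c\xi_2^{-1}\bar x_1$; $e_i^c$ ($1\le i\le n-2$): $x_i\mapsto c\xi_{i+1}^{-1}x_i$, $x_{i+1}\mapsto c^{-1}\xi_{i+1}x_{i+1}$, $\bar x_{i+1}\mapsto\xi_{i+1}\bar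 x_{i+1}$, $\bar x_i\mapsto\xi_{i+1}^{-1}\bar x_i$; $e_{n-1}^c$: $x_{n-1}\mapsto cx_{n-1}$, $x_n\mapsto c^{-1}x_n$; $e_n^c$: $x_n\mapsto cx_n$, $\bar x_{n-1}\mapsto c^{-1}\bar x_{n-1}$. The level is $\ell(x)=x_1\cdots x_n\bar x_{n-1}\cdots\bar x_1$. **Product $\mathcal B\times\mathcal B$.** On $(x,y)$, $e_i^c(x,y)=(e_i^{c_1}(x),e_i^{c_2}(y))$ with $c_1=\frac{c\varphi_i(x)+\varepsilon_i(y)}{\varphi_i(x)+\varepsilon_i(y)}$, $c_2=\frac{\varphi_i(x)+\varepsilon_i(y)}{\varphi_i(x)+c^{-1}\varepsilon_i(y)}$. **The $2n\times 2n$ matrix $M(x,z)$.** Write $M_{i,j}=M(x,z)_{i,j}$, $\ell=\ell(x)$, $\bar X_i=1+\bar x_i/x_i$. First column: $M_{1,1}=x_1/\bar x_1$; $M_{i,1}=x_1\cdots x_{i-1}(1+x_i/\bar x_i)$ for $2\le i\le n-1$; $M_{n,1}=x_1\cdots x_n$; $M_{n+1,1}=x_1\cdots x_{n-1}$; $M_{i,1}=\ell/(\bar x_1\cdots\bar x_{2n-i})$ for $n+2\le i\le 2n$. Other columns ($1\le i\le 2n$): $M_{i,j+1}=\frac{M_{i,j}}{x_j}+(\ell z-1)\big(\frac{\delta_{i,j}}{\bar x_j}+\delta_{i,j+1}\big)$ for $1\le j\le n-2$; $M_{i,n}=\frac{M_{i,n-1}}{x_{n-1}}+(\ell z-1)\big(\frac{\delta_{i,n-1}}{\bar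 x_{n-1}}+\delta_{i,n+1}\big)$; $M_{i,n+1}=\frac{M_{i,n-1}}{x_{n-1}x_n}+(\ell z-1)\big(\frac{\delta_{i,n-1}}{\bar x_{n-1}x_n}+\delta_{i,n}\big)$; $M_{i,2n}=z\frac{\bar x_1}{x_1}M_{i,1}+\delta_{i,2n}\frac{\bar x_1}{x_1}(1-\ell z)+\delta_{i,1}z(\ell z-1)$; $M_{i,2n-1}=z\bar x_1\bar X_2M_{i,1}+(1-\ell z)\big(\delta_{i,2n}\bar x_1\bar X_2+\delta_{i,2n-1}\frac{\bar x_2}{x_2}\big)$; $M_{i,2n-j}=\bar x_j\frac{\bar X_{j+1}}{\bar X_j}M_{i,2n+1-j}+(1-\ell z)\big(\delta_{i,2n+1-j}\bar x_j\frac{\bar X_{j+1}}{\bar X_j}+\delta_{i,2n-j}\frac{\bar x_{j+1}}{x_{j+1}}\big)$ for $2\le j\le n-2$. **The tropical $R$.** For generic $(x,y)$ there is a unique $(x',y')$ with $M(x,z)M(y,z)=M(x',z)M(y',z)$ identically in $z$ and $\ell(x)=\ell(y')\ne\ell(y)=\ell(x')$; the resulting birational map $(x,y)\mapsto(x',y')$ is denoted $R$. *)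

(* Defs.v *)
From mathcomp Require Import all_boot all_order all_algebra.
From mathcomp Require Import fraction reals.
From mathcomp Require Import mpoly.

Set Implicit Arguments.
Unset Strict Implicit.
Unset Printing Implicit Defensive.

Import Order.TTheory GRing.Theory Num.Theory.

Local Open Scope ring_scope.

(** * Rational maps of affine spaces *)

(* A rational map from affine m-space to affine k-space over R is a k-tuple of
   elements of the function field; equality of rational maps is equality of
   these tuples. *)
Notation funfield R m := {fraction {mpoly R[m]}}.
Notation ratmap R m k := (k.-tuple {fraction {mpoly R[m]}}).

(* [fun_value h f u a]: for a field L over R with structure map h : R -> L, the
   rational function f is regular at the L-point u, with value a.  Any
   presentation p / q whose denominator does not vanish at u may be used, so
   that the domain of f is the largest possible one. *)
Definition fun_value (R : fieldType) (m : nat) (L : fieldType) (h : R -> L)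
    (f : funfield R m) (u : m.-tuple L) (a : L) : Prop :=
  exists p q : {mpoly R[m]},
    [/\ f = tofrac p / tofrac q, mmap h (tnth u) q != 0
      & a = mmap h (tnth u) p / mmap h (tnth u) q].

Definition rat_value (R : fieldType) (m k : nat) (L : fieldType) (h : R -> L)
    (f : ratmap R m k) (u : m.-tuple L) (v : k.-tuple L) : Prop :=
  forall j : 'I_k, fun_value h (tnth f j) u (tnth v j).

Definition const (R : fieldType) (m : nat) (a : R) : funfield R m :=
  tofrac (a%:MP : {mpoly R[m]}).

(* The generic point of affine m-space is also its identity rational map. *)
Definition generic_point (R : fieldType) (m : nat) : ratmap R m m :=
  [tuple tofrac ('X_i : {mpoly R[m]}) | i < m].

(* [is_comp g f h]: the composite of g and f is defined as a rational map, and
   equals h; that is, g is regular at the funfield-valued point f. *)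
Definition is_comp (R : fieldType) (m k l : nat)
    (g : ratmap R k l) (f : ratmap R m k) (h : ratmap R m l) : Prop :=
  rat_value (@const R m) g f h.

Definition birational (R : fieldType) (m : nat) (f : ratmap R m m) : Prop :=
  exists g : ratmap R m m,
    is_comp g f (generic_point R m) /\ is_comp f g (generic_point R m).

Definition same_comp (R : fieldType) (m k k' l : nat)
    (g : ratmap R k l) (f : ratmap R m k)
    (g' : ratmap R k' l) (f' : ratmap R m k') : Prop :=
  exists h : ratmap R m l, is_comp g f h /\ is_comp g' f' h.

(* P holds on a nonempty Zariski open set of R-points. *)
Definition generically (R : fieldType) (m : nat) (P : m.-tuple R -> Prop) : Prop :=
  exists2 q : {mpoly R[m]}, q != 0
    & forall u : m.-tuple R, q.@[tnth u] != 0 -> P u.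

(** * The geometric crystal B *)

(* The entries of a point are x_1, ..., x_n, xbar_(n-1), ..., xbar_1. *)
Notation dimB n := (2 * n - 1)%N.
Notation point F n := ((2 * n - 1).-tuple F).

(* x_i, for 1 <= i <= n *)
Definition xc (F : fieldType) (n : nat) (x : point F n) (i : nat) : F :=
  nth 0 x i.-1.

(* xbar_i, for 1 <= i <= n - 1 *)
Definition bc (F : fieldType) (n : nat) (x : point F n) (i : nat) : F :=
  nth 0 x (dimB n - i).

(* The point with x_i = f i and xbar_i = g i. *)
Definition mkpoint (F : fieldType) (n : nat) (f g : nat -> F) : point F n :=
  [tuple if (k < n)%N then f k.+1 else g (dimB n - k)%N | k < dimB n].

Definition level (F : fieldType) (n : nat) (x : point F n) : F :=
  (\prod_(1 <= i < n.+1) xc x i) * (\prod_(1 <= i < n) bc x i).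

Definition eps (F : fieldType) (n i : nat) (x : point F n) : F :=
  if i == 0%N then xc x 1 * (xc x 2 / bc x 2 + 1)
  else if (i <= n - 2)%N then bc x i * (xc x i.+1 / bc x i.+1 + 1)
  else if i == n.-1 then xc x n * bc x n.-1
  else bc x n.-1.

Definition phi (F : fieldType) (n i : nat) (x : point F n) : F :=
  if i == 0%N then bc x 1 * (bc x 2 / xc x 2 + 1)
  else if (i <= n - 2)%N then xc x i * (bc x i.+1 / xc x i.+1 + 1)
  else if i == n.-1 then xc x n.-1
  else xc x n.-1 * xc x n.

Definition xi (F : fieldType) (n : nat) (c : F) (x : point F n) (i : nat) : F :=
  (xc x i + c * bc x i) / (xc x i + bc x i).

Definition crystal_e (F : fieldType) (n i : nat) (c : F) (x : point F n) :
    point F n :=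
  if i == 0%N then
    mkpoint n
      (fun k => if k == 1%N then (xi c x 2)^-1 * xc x 1
                else if k == 2%N then c^-1 * xi c x 2 * xc x 2
                else xc x k)
      (fun k => if k == 1%N then c * (xi c x 2)^-1 * bc x 1
                else if k == 2%N then xi c x 2 * bc x 2
                else bc x k)
  else if (i <= n - 2)%N then
    mkpoint n
      (fun k => if k == i then c * (xi c x i.+1)^-1 * xc x i
                else if k == i.+1 then c^-1 * xi c x i.+1 * xc x i.+1
                else xc x k)
      (fun k => if k == i then (xi c x i.+1)^-1 * bc x i
                else if k == i.+1 then xi c x i.+1 * bc x i.+1
                else bc x k)
  else if i == n.-1 then
    mkpoint n
      (fun k => if k == n.-1 then c * xc x n.-1
                else if k == n then c^-1 * xc x n
                else xc x k)
      (bc x)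
  else
    mkpoint n
      (fun k => if k == n then c * xc x n else xc x k)
      (fun k => if k == n.-1 then c^-1 * bc x n.-1 else bc x k).

(** * The product B x B *)

Definition crystal_e2 (F : fieldType) (n i : nat) (c : F)
    (xy : point F n * point F n) : point F n * point F n :=
  let: (x, y) := xy in
  let c1 := (c * phi i x + eps i y) / (phi i x + eps i y) in
  let c2 := (phi i x + eps i y) / (phi i x + c^-1 * eps i y) in
  (crystal_e i c1 x, crystal_e i c2 y).

Notation dimBB n := (dimB n + dimB n)%N.

(* Identification of B x B with affine space of dimension 2 (2 n - 1) *)
Definition join (F : fieldType) (n : nat) (xy : point F n * point F n) :
    (dimBB n).-tuple F :=
  [tuple of xy.1 ++ xy.2].

Definition unjoin (F : fieldType) (n : nat) (u : (dimBB n).-tuple F) :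
    point F n * point F n :=
  ([tuple tnth u (lshift (dimB n) k) | k < dimB n],
   [tuple tnth u (rshift (dimB n) k) | k < dimB n]).

(* e_i^c on B x B as a rational map: its formula at the generic point, where
   none of its denominators vanishes when c != 0. *)
Definition rat_e (R : fieldType) (n i : nat) (c : R) :
    ratmap R (dimBB n) (dimBB n) :=
  join (crystal_e2 i (const (dimBB n) c) (unjoin (generic_point R (dimBB n)))).

(** * The matrix M(x, z) *)

Definition Xbar (F : fieldType) (n : nat) (x : point F n) (i : nat) : F :=
  1 + bc x i / xc x i.

(* Rows and columns are numbered from 1 in [Mcol1], [Mleft] and [Mright]. *)
Definition delta (F : fieldType) (i j : nat) : F := (i == j)%:R.

Definition Mcol1 (F : fieldType) (n : nat) (x : point F n) (i : nat) : F :=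
  if i == 1%N then xc x 1 / bc x 1
  else if (i <= n.-1)%N then
    (\prod_(1 <= k < i) xc x k) * (1 + xc x i / bc x i)
  else if i == n then \prod_(1 <= k < n.+1) xc x k
  else if i == n.+1 then \prod_(1 <= k < n) xc x k
  else level x / \prod_(1 <= k < (2 * n - i).+1) bc x k.

(* Entry (i, j) for 1 <= j <= n - 1; the value at j = 0 is not used. *)
Fixpoint Mleft (F : fieldType) (n : nat) (x : point F n) (z : F) (i j : nat) : F :=
  match j with
  | 0 | 1 => Mcol1 x i
  | (_.+1 as j').+1 =>
      Mleft x z i j' / xc x j'
      + (level x * z - 1) * (delta F i j' / bc x j' + delta F i j'.+1)
  end.

(* Entry (i, 2n - j) for 0 <= j <= n - 2 *)
Fixpoint Mright (F : fieldType) (n : nat) (x : point F n) (z : F) (i j : nat) : F :=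
  match j with
  | 0 =>
      z * (bc x 1 / xc x 1) * Mcol1 x i
      + delta F i (2 * n) * (bc x 1 / xc x 1) * (1 - level x * z)
      + delta F i 1 * z * (level x * z - 1)
  | 1 =>
      z * bc x 1 * Xbar x 2 * Mcol1 x i
      + (1 - level x * z)
        * (delta F i (2 * n) * bc x 1 * Xbar x 2
           + delta F i (2 * n - 1) * (bc x 2 / xc x 2))
  | (_.+1 as j').+1 =>
      bc x j * (Xbar x j.+1 / Xbar x j) * Mright x z i j'
      + (1 - level x * z)
        * (delta F i (2 * n + 1 - j) * bc x j * (Xbar x j.+1 / Xbar x j)
           + delta F i (2 * n - j) * (bc x j.+1 / xc x j.+1))
  end.

Definition Mentry (F : fieldType) (n : nat) (x : point F n) (z : F) (i j : nat) : F :=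
  if (j <= n.-1)%N then Mleft x z i j
  else if j == n then
    Mleft x z i n.-1 / xc x n.-1
    + (level x * z - 1) * (delta F i n.-1 / bc x n.-1 + delta F i n.+1)
  else if j == n.+1 then
    Mleft x z i n.-1 / (xc x n.-1 * xc x n)
    + (level x * z - 1) * (delta F i n.-1 / (bc x n.-1 * xc x n) + delta F i n)
  else Mright x z i (2 * n - j).

Definition Mmx (F : fieldType) (n : nat) (x : point F n) (z : F) : 'M[F]_(2 * n) :=
  \matrix_(i, j) Mentry x z i.+1 j.+1.

(* No denominator occurring in M(x, z) vanishes. *)
Definition Mdefined (F : fieldType) (n : nat) (x : point F n) : Prop :=
  [/\ forall i, (1 <= i <= n)%N -> xc x i != 0,
      forall i, (1 <= i <= n.-1)%N -> bc x i != 0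
    & forall j, (2 <= j <= n - 2)%N -> Xbar x j != 0].

(** * The tropical R *)

Definition R_related (F : fieldType) (n : nat)
    (xy xy' : point F n * point F n) : Prop :=
  let: (x, y) := xy in
  let: (x', y') := xy' in
  [/\ Mdefined x /\ Mdefined y, Mdefined x' /\ Mdefined y',
      forall z : F, Mmx x z *m Mmx y z = Mmx x' z *m Mmx y' z,
      level x = level y' /\ level y = level x'
    & level x != level y].

Definition is_tropical_R (R : realType) (n : nat)
    (T : ratmap R (dimBB n) (dimBB n)) : Prop :=
  birational T /\
  generically (fun u : (dimBB n).-tuple R =>
    exists v : (dimBB n).-tuple R,
      rat_value idfun T u v /\ unique (R_related (unjoin u)) (unjoin v)).

(* Main.v *)
From HB Require Import structures.
Require Import Defs.
From mathcomp Require Import all_boot all_order all_algebra.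
From mathcomp Require Import fraction reals.
From mathcomp Require Import mpoly generic_quotient perm.
From mathcomp Require Import ring zify.

(** Each crystal operator acts on M(x, z) by unipotent matrices.  For a node i with
1 <= i <= n - 1 let E be the matrix with ones in the places (i, i + 1) and
(2n - i, 2n - i + 1), and U(a) = 1 + a E.  Then

    M(e_i^c x, z) = U((c - 1) / eps_i(x)) M(x, z) U((1/c - 1) / phi_i(x)).

In M(e_i^c1 x, z) M(e_i^c2 y, z) the two inner unipotent factors cancel: this is
what the formulas for c1 and c2 say.  Hence P(z) = M(x, z) M(y, z) is transformed
into U(a) P(z) U(b).  The matrix M(x, 0) is lower triangular in its first n
rows and eps_i, phi_i are quotients of its entries in rows and columns i and
i + 1.  It follows that a and b can be read off from P(0) alone:
a = (c - 1) P_ii / P_(i+1,i) and b = (1/c - 1) P_(i+1,i+1) / P_(i+1,i).  So if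
(x, y) and (x', y') have the same product P, then so have their images under
e_i^c.  The levels are not changed.  Therefore the relation which defines the
tropical R is preserved by e_i^c ([R_related_crystal_e2]), and its uniqueness gives
e_i^c R = R e_i^c at every point where all maps involved are defined.

The unipotent formula is proved column by column: the columns of M(x, z) satisfy
two-term recursions, in which e_i^c changes only the steps next to i and 2n - i, so
that only identities in a few variables remain ([bulk_unip] for i <= n - 2 and
[spin_unip] for i = n - 1).  The nodes 0 and n are reduced to 1 and n - 1 by the two
symmetries of the Dynkin diagram.  These act on points by x_1 <-> xbar_1,
respectively x_n -> 1/x_n with x_(n-1) and xbar_(n-1) multiplied by x_n; on M(x, z)
they act by exchanging the indices 1 and 2n (with weights z and 1/z), respectively
n and n + 1 ([flip1_conj], [flipn_conj]).

It remains to pass from points to rational maps.  The map R is dominant because it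
is birational, and e_i^c is dominant because e_i^(1/c) inverts it
([rat_e_dominant]); so both composites exist.  They agree at all real points outside
a proper Zariski closed set, by the above; as the reals are infinite, such points exist in
every nonempty open set, hence the composites are equal ([ratmap_eq]). *)

Set Implicit Arguments.
Unset Strict Implicit.
Unset Printing Implicit Defensive.

Import Order.TTheory GRing.Theory Num.Theory.
Local Open Scope ring_scope.

(** * Index arithmetic and nonvanishing side conditions *)

Lemma delta_eq (F : fieldType) (r s : nat) : r = s -> delta F r s = 1.
Proof. by move=> ->; rewrite /delta eqxx. Qed.

Lemma delta_neq (F : fieldType) (r s : nat) : r <> s -> delta F r s = 0.
Proof. by rewrite /delta => /eqP/negPf ->. Qed.

Ltac nz := repeat (apply/andP; split); try exact: oner_neq0; try done.
Ltac fld := field; nz.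

(** Clears the hypotheses about field elements first: they only slow down the
    decision procedure for index arithmetic. *)
Ltac nlia :=
  repeat match goal with H := _ |- _ => clear dependent H end;
  repeat match goal with H : ?P |- _ => lazymatch P with
  | nat => fail | is_true (leq _ _) => fail | is_true (andb _ _) => fail
  | @eq nat _ _ => fail | not (@eq nat _ _) => fail | or _ _ => fail | and _ _ => fail
  | _ => clear H end end; lia.

Ltac side := try lazymatch goal with
  | |- @eq nat _ _ => nlia | |- not (@eq nat _ _) => nlia | |- is_true (leq _ _) => nlia
  | |- is_true (eq_op _ _) => nlia
  | |- @eq bool _ _ => nlia | |- is_true (andb (leq _ _) _) => nlia | |- Mdefined _ => assumption end.

(** Evaluates the Kronecker deltas whose value follows from the context; the
    others stay as opaque variables of the ring and field identities. *)
Ltac dlt := repeat match goal with |- context[delta ?F ?r ?s] =>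
  first [rewrite (@delta_neq F r s ltac:(nlia)) | rewrite (@delta_eq F r s ltac:(nlia))] end;
  rewrite ?(mulr0, mul0r, addr0, add0r, mulr1, mul1r).

(** * Values of rational functions and dominant rational maps *)

(** Uniqueness of base N expansions: distinct exponent vectors with entries
    below N give distinct numbers. *)
Lemma digits_inj (N n : nat) (a b : 'I_n -> nat) :
  (forall i, a i < N)%N -> (forall i, b i < N)%N ->
  (\sum_(i < n) a i * N ^ i = \sum_(i < n) b i * N ^ i)%N -> a =1 b.
Proof.
elim: n a b => [|n IHn] a b ha hb; first by move=> _ [].
have N0 : (0 < N)%N by exact: leq_ltn_trans (ha ord0).
have horner f : (\sum_(i < n.+1) f i * N ^ i =
    f ord0 + N * \sum_(i < n) f (lift ord0 i) * N ^ i)%N.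
  rewrite big_ord_recl expn0 muln1 big_distrr /=; congr addn.
  by apply: eq_bigr => i _; rewrite /bump /= expnS mulnCA.
rewrite !horner => e.
have e0 : a ord0 = b ord0.
  by have := congr1 (modn^~ N) e; rewrite !(addnC (_ ord0)) !(mulnC N) !modnMDl !modn_small.
have eS : (fun i => a (lift ord0 i)) =1 (fun i => b (lift ord0 i)).
  apply: IHn => [i|i|]; [exact: ha|exact: hb|].
  by move/eqP: e; rewrite e0 eqn_add2l eqn_pmul2l // => /eqP.
by move=> i; case: (unliftP ord0 i) => [j ->|->].
Qed.

(** Kronecker substitution: with X_i replaced by t^(N^i) and N larger than all
    exponents, distinct monomials become distinct powers of t, so a nonzero
    polynomial in one variable results; it has finitely many roots. *)
Lemma nonzero_mpoly_nonroot (R : numDomainType) (m : nat) (p : {mpoly R[m]}) :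
  p != 0 -> exists u : m.-tuple R, p.@[tnth u] != 0.
Proof.
move=> p0; pose N := msize p.
(* The exponent of t that the monomial a becomes. *)
pose k (a : 'X_{1..m}) := (\sum_(i < m) a i * N ^ i)%N.
pose q : {poly R} := \sum_(a <- msupp p) p@_a *: 'X^(k a).
have digit a : a \in msupp p -> forall i, (a i < N)%N.
  move=> /msize_mdeg_lt ha i; apply: leq_ltn_trans ha.
  by rewrite mdegE (bigD1 i) //= leq_addr.
have q0 : q != 0.
  have hl : mlead p \in msupp p by exact: mlead_supp.
  apply: contraTneq hl => /(congr1 (fun r : {poly R} => r`_(k (mlead p)))).
  rewrite coef0 coef_sum (bigD1_seq (mlead p)) ?mlead_supp ?msupp_uniq //=.
  rewrite big_seq_cond big1 => [|a /andP[ha ne]].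
    by rewrite coefZ coefXn eqxx mulr1 addr0 => /eqP; rewrite mcoeff_eq0 mlead_supp.
  rewrite coefZ coefXn; case: eqP => [e|_]; last by rewrite mulr0.
  case/eqP: ne; apply/mnmP; apply: (digits_inj (N := N)) => //.
  - exact: digit.
  - exact/digit/mlead_supp.
have [t qt] : exists t, ~~ root q t.
  have := @max_poly_roots _ q [seq i%:R | i <- iota 0 (size q)] q0.
  rewrite size_map size_iota ltnn => H.
  case: (altP (@allP _ (root q) [seq i%:R | i <- iota 0 (size q)])) => [|/allPn[t _ ht]].
    move/allP/H => F; exfalso.
    suff /F : uniq [seq i%:R : R | i <- iota 0 (size q)] by [].
    by rewrite map_inj_uniq ?iota_uniq // => i j /eqP; rewrite eqr_nat => /eqP.
  by exists t.
exists [tuple t ^+ (N ^ i) | i < m]; apply: contraNneq qt.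
rewrite mevalE /root horner_sum => e; apply/eqP; rewrite -[RHS]e.
apply: eq_bigr => a _; rewrite hornerZ hornerXn /k -prodrXr; congr (_ * _).
by apply: eq_bigr => i _; rewrite tnth_mktuple mulnC exprM.
Qed.

Lemma const_is_additive (R : fieldType) (m : nat) : zmod_morphism (@const R m).
Proof. by move=> a b; rewrite /const mpolyCB tofracB. Qed.

Lemma const_is_multiplicative (R : fieldType) (m : nat) : monoid_morphism (@const R m).
Proof. by split=> [|a b]; rewrite /const ?mpolyC1 ?mpolyCM ?tofrac1 ?tofracM. Qed.

HB.instance Definition _ (R : fieldType) (m : nat) :=
  GRing.isZmodMorphism.Build R (funfield R m) (@const R m) (@const_is_additive R m).
HB.instance Definition _ (R : fieldType) (m : nat) :=
  GRing.isMonoidMorphism.Build R (funfield R m) (@const R m) (@const_is_multiplicative R m).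

Lemma frac_repr (R : fieldType) (m : nat) (f : funfield R m) :
  exists p q : {mpoly R[m]}, q != 0 /\ f = tofrac p / tofrac q.
Proof.
exists (repr f : ratio _).1, (repr f : ratio _).2; split; first exact: denom_ratioP.
rewrite -[LHS]reprK; unlock tofrac.
rewrite -[X in _ = _ * X]FracField.pi_inv -[RHS]FracField.pi_mul.
rewrite /FracField.mulf /FracField.invf /= !numden_Ratio ?oner_neq0 ?denom_ratioP //.
by rewrite mulr1 mul1r FracField.Ratio_numden.
Qed.

Section FunValue.
Variables (R : fieldType) (m : nat) (L : fieldType) (h : {rmorphism R -> L}) (u : m.-tuple L).
Local Notation ev := (mmap h (tnth u)).
Local Notation fv := (fun_value h).
Implicit Types (f g : funfield R m) (a b : L) (p q : {mpoly R[m]}).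

(** The value does not depend on the presentation p / q chosen: two
    presentations agree after cross multiplication, and both denominators are
    nonzero at u. *)
Lemma fun_value_unique f a b : fv f u a -> fv f u b -> a = b.
Proof.
move=> [p [q [-> q0 ->]]] [p' [q' [e q0' ->]]].
have nz r : ev r != 0 -> tofrac r != 0 :> funfield R m.
  by apply: contraNneq => /eqP; rewrite tofrac_eq0 => /eqP->; rewrite rmorph0.
move/eqP: e; rewrite eqr_div ?nz // -!tofracM tofrac_eq => /eqP e.
by apply/eqP; rewrite eqr_div // -!rmorphM e.
Qed.

Lemma fun_value_frac p q : ev q != 0 -> fv (tofrac p / tofrac q) u (ev p / ev q).
Proof. by exists p, q. Qed.

Lemma fun_value_poly p : fv (tofrac p) u (ev p).
Proof. by exists p, 1; rewrite tofrac1 rmorph1 !divr1 oner_neq0. Qed.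

Lemma fun_value_const c : fv (const m c) u (h c).
Proof. by have := fun_value_poly c%:MP; rewrite mmapC. Qed.

Lemma fun_value_coord i : fv (tofrac 'X_i) u (tnth u i).
Proof. by have := fun_value_poly 'X_i; rewrite mmapX mmap1U. Qed.

Lemma fun_valueD f g a b : fv f u a -> fv g u b -> fv (f + g) u (a + b).
Proof.
move=> [p [q [-> q0 ->]]] [p' [q' [-> q0' ->]]].
have nz r : ev r != 0 -> tofrac r != 0 :> funfield R m.
  by apply: contraNneq => /eqP; rewrite tofrac_eq0 => /eqP->; rewrite rmorph0.
exists (p * q' + p' * q), (q * q'); split; rewrite ?(tofracD, tofracM, rmorphD, rmorphM) /=.
- by rewrite addf_div ?nz.
- exact: mulf_neq0.
- by rewrite addf_div.
Qed.

Lemma fun_valueM f g a b : fv f u a -> fv g u b -> fv (f * g) u (a * b).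
Proof.
move=> [p [q [-> q0 ->]]] [p' [q' [-> q0' ->]]].
exists (p * p'), (q * q'); split; rewrite ?(tofracM, rmorphM) /=.
- by rewrite mulf_div.
- exact: mulf_neq0.
- by rewrite mulf_div.
Qed.

Lemma fun_valueV f a : a != 0 -> fv f u a -> fv f^-1 u a^-1.
Proof.
move=> a0 [p [q [-> q0 e]]]; exists q, p; rewrite !invf_div e invf_div; split=> //.
by apply: contraNneq a0 => p0; rewrite e p0 mul0r.
Qed.

End FunValue.

Section FunValueBig.
Variables (R : fieldType) (m : nat) (L : fieldType) (h : {rmorphism R -> L}) (u : m.-tuple L).
Local Notation fv := (fun_value h).

Lemma fun_value0 : fv 0 u 0.
Proof. by have := fun_value_poly h u 0; rewrite tofrac0 rmorph0. Qed.

Lemma fun_value1 : fv 1 u 1.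
Proof. by have := fun_value_poly h u 1; rewrite tofrac1 rmorph1. Qed.

Lemma fun_valueN (f : funfield R m) a : fv f u a -> fv (- f) u (- a).
Proof.
move=> H; rewrite -mulN1r -[- a]mulN1r; apply: fun_valueM => //.
by have := fun_value_poly h u (- 1); rewrite !rmorphN1.
Qed.

Lemma fun_valueB (f g : funfield R m) a b : fv f u a -> fv g u b -> fv (f - g) u (a - b).
Proof. by move=> Hf Hg; apply: fun_valueD => //; apply: fun_valueN. Qed.

Lemma fun_value_sum (I : Type) (s : seq I) (f : I -> funfield R m) (a : I -> L) :
  (forall i, fv (f i) u (a i)) -> fv (\sum_(i <- s) f i) u (\sum_(i <- s) a i).
Proof.
move=> H; apply: (big_rec2 (fun x y => fv x u y)); first exact: fun_value0.
by move=> i x y _; apply: fun_valueD.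
Qed.

Lemma fun_value_prod (I : Type) (s : seq I) (f : I -> funfield R m) (a : I -> L) :
  (forall i, fv (f i) u (a i)) -> fv (\prod_(i <- s) f i) u (\prod_(i <- s) a i).
Proof.
move=> H; apply: (big_rec2 (fun x y => fv x u y)); first exact: fun_value1.
by move=> i x y _; apply: fun_valueM.
Qed.

Lemma fun_valueX (f : funfield R m) a k : fv f u a -> fv (f ^+ k) u (a ^+ k).
Proof.
move=> H; elim: k => [|k IH]; first exact: fun_value1.
by rewrite !exprS; apply: fun_valueM.
Qed.

Lemma fun_value_neq0 (f : funfield R m) a : fv f u a -> a != 0 -> f != 0.
Proof.
move=> H; apply: contraNneq => f0; move: H; rewrite f0 => H.
by apply/eqP; apply: fun_value_unique H fun_value0.
Qed.

Lemma fun_value_mmap k (f : ratmap R m k) (v : k.-tuple L) (q : {mpoly R[k]}) :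
  rat_value h f u v -> fv (mmap (@const R m) (tnth f) q) u (mmap h (tnth v) q).
Proof.
move=> H; rewrite /mmap; apply: fun_value_sum => a; apply: fun_valueM; first exact: fun_value_const.
by rewrite /mmap1; apply: fun_value_prod => i; apply: fun_valueX.
Qed.

(** The domains match at every point: a presentation of g whose denominator does
    not vanish at the value of f also has a denominator which does not vanish
    identically along f, hence it computes the composite. *)
Lemma is_comp_value k l (g : ratmap R k l) (f : ratmap R m k) (gf : ratmap R m l) v w :
  is_comp g f gf -> rat_value h f u v -> rat_value h g v w -> rat_value h gf u w.
Proof.
move=> Hgf Hf Hg j; have [p [q [e q0 ->]]] := Hg j.
have Hp := fun_value_mmap p Hf; have Hq := fun_value_mmap q Hf.
have q0' := fun_value_neq0 Hq q0.
have -> : tnth gf j = mmap (@const R m) (tnth f) p / mmap (@const R m) (tnth f) q.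
  apply: (fun_value_unique (h := @const R m) (Hgf j)); rewrite e.
  exact: fun_value_frac.
by apply: fun_valueM => //; apply: fun_valueV.
Qed.

End FunValueBig.

(** Dominance of f, in the form that no nonzero polynomial vanishes identically
    on its image; such an f can be composed with every rational map. *)
Definition dominant (R : fieldType) (m k : nat) (f : ratmap R m k) : Prop :=
  forall q : {mpoly R[k]}, q != 0 -> mmap (@const R m) (tnth f) q != 0.

Lemma dominant_comp (R : fieldType) (m k l : nat) (g : ratmap R k l) (f : ratmap R m k) :
  dominant f -> exists gf, is_comp g f gf.
Proof.
move=> domf.
have reg j : exists a, fun_value (@const R m) (tnth g j) f a.
  have [p [q [q0 ->]]] := frac_repr (tnth g j).
  by eexists; apply: fun_value_frac; apply: domf.
have [a Ha] := fin_all_exists reg.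
by exists [tuple a j | j < l] => j; rewrite tnth_mktuple.
Qed.

Lemma mmap_generic_point (R : fieldType) (m : nat) (q : {mpoly R[m]}) :
  mmap (@const R m) (tnth (generic_point R m)) q = tofrac q.
Proof.
rewrite -[q in RHS]comp_mpoly_id /comp_mpoly /mmap raddf_sum /=; apply: eq_bigr => a _.
rewrite tofracM; congr (_ * _); rewrite /mmap1 rmorph_prod; apply: eq_bigr => i _.
by rewrite rmorphXn /= /generic_point !tnth_mktuple.
Qed.

(** A polynomial which vanishes along f also vanishes along f composed with its
    inverse, which is the generic point. *)
Lemma birational_dominant (R : fieldType) (m : nat) (f : ratmap R m m) :
  birational f -> dominant f.
Proof.
move=> [g [_ fg]] q q0; apply: (fun_value_neq0 (fun_value_mmap (h := @const R m) q fg)).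
by rewrite mmap_generic_point tofrac_eq0.
Qed.

Lemma generically_and (R : fieldType) m (P Q : m.-tuple R -> Prop) :
  generically P -> generically Q -> generically (fun u => P u /\ Q u).
Proof.
move=> [p p0 HP] [q q0 HQ]; exists (p * q); first exact: mulf_neq0.
by move=> u; rewrite mevalM mulf_eq0 negb_or => /andP[/HP ? /HQ ?].
Qed.

Lemma generically_sub (R : fieldType) m (P Q : m.-tuple R -> Prop) :
  (forall u, P u -> Q u) -> generically P -> generically Q.
Proof. by move=> PQ [q q0 HP]; exists q => // u /HP /PQ. Qed.

(** Off the zero set of a suitable polynomial every rational function is
    defined, and a nonzero one takes a nonzero value there. *)
Lemma generically_regular (R : fieldType) m (f : funfield R m) :
  generically (fun u => exists a, fun_value idfun f u a /\ (f != 0 -> a != 0)).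
Proof.
have [p [q [q0 e]]] := frac_repr f.
have [f0|f0] := boolP (f == 0).
  exists 1; first exact: oner_neq0.
  by move=> u _; exists 0; split=> //; rewrite (eqP f0); apply: (fun_value0 idfun).
have p0 : p != 0 by apply: contraNneq f0 => p0; rewrite e p0 tofrac0 mul0r.
exists (p * q); first exact: mulf_neq0.
move=> u; rewrite mevalM mulf_eq0 negb_or => /andP[p0' q0'].
exists (p.@[tnth u] / q.@[tnth u]); split; first by rewrite e; apply: (fun_value_frac (h := idfun)).
by move=> _; rewrite mulf_neq0 ?invr_eq0.
Qed.

Lemma generically_pullback (R : fieldType) m k (f : ratmap R m k) (P : k.-tuple R -> Prop) :
  dominant f -> generically P ->
  generically (fun u => forall v, rat_value idfun f u v -> P v).
Proof.
move=> domf [q q0 HP].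
apply: generically_sub (generically_regular (mmap (@const R m) (tnth f) q)) => u [a [Ha a0]] v Hv.
apply: HP; rewrite -[_.@[_]](fun_value_unique (h := idfun) Ha (fun_value_mmap (h := idfun) q Hv)).
exact/a0/domf.
Qed.

(** The difference of two unequal components is a nonzero rational function,
    which is nonzero at some real point of any given nonempty open set. *)
Lemma ratmap_eq (R : realType) m k (f g : ratmap R m k) :
  generically (fun u => exists v, rat_value idfun f u v /\ rat_value idfun g u v) -> f = g.
Proof.
move=> H; apply: eq_from_tnth => j; apply/eqP; rewrite -subr_eq0; apply/negPn/negP => d0.
have [q q0 Hq] := generically_and H (generically_regular (tnth f j - tnth g j)).
have [u /Hq[[v [Hf Hg]] [a [Ha a0]]]] := nonzero_mpoly_nonroot q0.
have := a0 d0; rewrite (fun_value_unique (h := idfun) Ha (b := tnth v j - tnth v j)) ?subrr ?eqxx //.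
rewrite -(subrr (tnth v j)); apply: (@fun_valueB R m R idfun u _ _ _ _ (Hf j) (Hg j)).
Qed.

(** * Coordinates of points and the column recursion of M(x, z) *)

Section Matrix.
Variables (F : fieldType) (n : nat).
Hypothesis hn : (4 <= n)%N.
Implicit Types (x y : point F n) (z a b c : F) (r s i j k : nat).

Lemma xc_mkpoint f g i : (1 <= i <= n)%N -> xc (mkpoint n f g) i = f i :> F.
Proof.
move=> hi; have hk : (i.-1 < dimB n)%N by lia.
rewrite /xc /mkpoint (nth_map (Ordinal hk)) ?size_enum_ord // nth_enum_ord //.
by rewrite ifT; [congr f|]; lia.
Qed.

Lemma bc_mkpoint f g i : (1 <= i <= n.-1)%N -> bc (mkpoint n f g) i = g i :> F.
Proof.
move=> hi; have hk : (dimB n - i < dimB n)%N by lia.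
rewrite /bc /mkpoint (nth_map (Ordinal hk)) ?size_enum_ord // nth_enum_ord //.
by rewrite ifF; [congr g|]; lia.
Qed.

Lemma point_ext x y :
  (forall i, (1 <= i <= n)%N -> xc x i = xc y i) ->
  (forall i, (1 <= i <= n.-1)%N -> bc x i = bc y i) -> x = y.
Proof.
move=> hx hb; apply/val_inj/(@eq_from_nth _ 0) => [|k]; rewrite !size_tuple // => hk.
have [kn|kn] := ltnP k n; first by apply: (hx k.+1).
have := hb (dimB n - k)%N; rewrite /bc.
have -> : (dimB n - (dimB n - k) = k)%N by lia.
by apply; lia.
Qed.

Lemma col_left x z r s : (1 <= s <= n - 2)%N ->
  Mentry x z r s.+1 = Mentry x z r s / xc x s
    + (level x * z - 1) * (delta F r s / bc x s + delta F r s.+1).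
Proof.
case: s => // s hs; rewrite /Mentry !ifT //; lia.
Qed.

Lemma col_n x z r : Mentry x z r n = Mentry x z r n.-1 / xc x n.-1
    + (level x * z - 1) * (delta F r n.-1 / bc x n.-1 + delta F r n.+1).
Proof. by rewrite /Mentry leqnn eqxx ifF //; lia. Qed.

Lemma col_n1 x z r : Mentry x z r n.+1 = Mentry x z r n.-1 / (xc x n.-1 * xc x n)
    + (level x * z - 1) * (delta F r n.-1 / (bc x n.-1 * xc x n) + delta F r n).
Proof. by rewrite /Mentry leqnn eqxx ifF 1?ifF //; lia. Qed.

Lemma col_right0 x z r : Mentry x z r (2 * n) =
  z * (bc x 1 / xc x 1) * Mentry x z r 1
      + delta F r (2 * n) * (bc x 1 / xc x 1) * (1 - level x * z)
      + delta F r 1 * z * (level x * z - 1).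
Proof.
rewrite [LHS]/Mentry !ifF ?subnn; try lia.
by rewrite /= /Mentry ifT //; lia.
Qed.

Lemma col_right1 x z r : Mentry x z r (2 * n - 1) =
  z * bc x 1 * Xbar x 2 * Mentry x z r 1
      + (1 - level x * z)
        * (delta F r (2 * n) * bc x 1 * Xbar x 2
           + delta F r (2 * n - 1) * (bc x 2 / xc x 2)).
Proof.
rewrite [LHS]/Mentry !ifF; try lia.
have -> : (2 * n - (2 * n - 1) = 1)%N by lia.
by rewrite /= /Mentry ifT //; lia.
Qed.

Lemma col_right x z r j : (2 <= j <= n - 2)%N -> Mentry x z r (2 * n - j) =
      bc x j * (Xbar x j.+1 / Xbar x j) * Mentry x z r (2 * n + 1 - j)
      + (1 - level x * z)
        * (delta F r (2 * n + 1 - j) * bc x j * (Xbar x j.+1 / Xbar x j)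
           + delta F r (2 * n - j) * (bc x j.+1 / xc x j.+1)).
Proof.
case: j => [|[|j]] // hj.
rewrite [LHS]/Mentry !ifF; try lia.
rewrite [Mentry _ _ _ (2 * n + 1 - j.+2)]/Mentry !ifF; try lia.
have -> : (2 * n - (2 * n - j.+2) = j.+2)%N by lia.
by have -> : (2 * n - (2 * n + 1 - j.+2) = j.+1)%N by lia.
Qed.

End Matrix.

(** * Closed forms for the entries of M(x, z) *)

(** x_1 ... x_(j-1), the factor by which the j-th column of M differs from the
    first one; note the shift by one against [bprod]. *)
Definition xprod (F : fieldType) (n : nat) (x : point F n) (j : nat) : F :=
  \prod_(1 <= k < j) xc x k.
Definition bprod (F : fieldType) (n : nat) (x : point F n) (j : nat) : F :=
  \prod_(1 <= k < j.+1) bc x k.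

Section Closed.
Variables (F : fieldType) (n : nat).
Hypothesis hn : (4 <= n)%N.
Implicit Types (x y : point F n) (z a b c : F) (r s i j k : nat).

Lemma xprodS x j : (1 <= j)%N -> xprod x j.+1 = xprod x j * xc x j.
Proof. by move=> hj; rewrite /xprod big_nat_recr. Qed.

Lemma bprodS x j : bprod x j.+1 = bprod x j * bc x j.+1.
Proof. by rewrite /bprod big_nat_recr. Qed.

Lemma levelE x : level x = xprod x n.+1 * bprod x n.-1.
Proof. by rewrite /level /xprod /bprod prednK //; lia. Qed.

Lemma xprod_neq0 x j : Mdefined x -> (j <= n.+1)%N -> xprod x j != 0.
Proof.
move=> [hx _ _] hj; rewrite /xprod prodf_seq_neq0; apply/allP => k.
by rewrite mem_index_iota => hk; apply: hx; lia.
Qed.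

Lemma bprod_neq0 x j : Mdefined x -> (j <= n.-1)%N -> bprod x j != 0.
Proof.
move=> [_ hb _] hj; rewrite /bprod prodf_seq_neq0; apply/allP => k.
by rewrite mem_index_iota => hk; apply: hb; lia.
Qed.

Lemma col1E x z r : Mentry x z r 1 = Mcol1 x r.
Proof. by rewrite /Mentry ifT //; lia. Qed.

Lemma col1_first x : Mcol1 x 1 = xc x 1 / bc x 1.
Proof. by []. Qed.

Lemma col1_x x r : (2 <= r <= n.-1)%N -> Mcol1 x r = xprod x r * (1 + xc x r / bc x r).
Proof. by move=> hr; rewrite /Mcol1 ifF 1?ifT //; lia. Qed.

Lemma col1_n x : Mcol1 x n = xprod x n.+1.
Proof. by rewrite /Mcol1 ifF 1?ifF 1?ifT //; lia. Qed.

Lemma col1_n1 x : Mcol1 x n.+1 = xprod x n.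
Proof. by rewrite /Mcol1 ifF 1?ifF 1?ifF 1?ifT //; lia. Qed.

Lemma col1_b x j : (j <= n - 2)%N -> Mcol1 x (2 * n - j) = level x / bprod x j.
Proof.
move=> hj; rewrite /Mcol1 ifF 1?ifF 1?ifF 1?ifF //; try lia.
by have -> : (2 * n - (2 * n - j) = j)%N by lia.
Qed.

Section Fixed.
Variables (x : point F n) (z : F).
Hypothesis Mx : Mdefined x.
Let w := level x * z - 1.

Lemma left_below r j : (1 <= j <= n.-1)%N -> (j < r)%N -> Mentry x z r j = Mcol1 x r / xprod x j.
Proof.
elim: j => [|[|j] IH] // hj hr; first by rewrite col1E /xprod big_geq ?divr1.
rewrite col_left // ?IH ?[xprod x j.+2]xprodS ?delta_neq //; try lia.
rewrite mul0r addr0 mulr0 addr0 invfM mulrA //.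
Qed.

Lemma left_diag j : (2 <= j <= n.-1)%N -> Mentry x z j j = xc x j / bc x j + level x * z.
Proof.
case: j => [|[|j]] // hj; have := xprod_neq0 Mx (j := j.+2); move=> /(_ ltac:(lia)) q0.
rewrite col_left; try lia.
rewrite left_below ?col1_x ?(delta_neq F (s := j.+1)) ?delta_eq //; try lia.
have := xprodS x (j := j.+1) isT => e; move: q0; rewrite e mulf_eq0 negb_or => /andP[q1 q2].
have b0 : bc x j.+2 != 0 by case: Mx => _ + _; apply; lia.
have b1 : bc x j.+1 != 0 by case: Mx => _ + _; apply; lia.
by fld.
Qed.

(** Above the diagonal the contributions of the two delta terms add up to (level
    x z - 1) times the first column, which turns the factor 1 into level x z.
    In particular these entries vanish at z = 0. *)
Lemma left_above r j : (1 <= r < j)%N -> (j <= n.-1)%N ->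
  Mentry x z r j = level x * z * Mcol1 x r / xprod x j.
Proof.
elim: j => [|[|j] IH] hr hj; try lia.
have q0 := xprod_neq0 Mx (j := j.+2) ltac:(lia).
move: q0; rewrite xprodS // mulf_eq0 negb_or => /andP[q1 q2].
have b0 : bc x j.+1 != 0 by case: Mx => _ + _; apply; lia.
rewrite col_left ?[delta F r j.+2]delta_neq; try lia.
have [rj|rj] := ltnP r j.+1; first by rewrite IH ?delta_neq; try lia; fld.
have {rj hr} -> : r = j.+1 by lia.
rewrite delta_eq //; case: j {IH} hj q1 q2 b0 => [|j] hj q1 q2 b0.
  have xp1 : xprod x 1 = 1 by rewrite /xprod big_geq.
  by rewrite xp1 col1E col1_first; fld; rewrite xp1 oner_eq0.
rewrite left_diag ?col1_x //; try lia.
by fld.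
Qed.

Lemma right_above r j : (1 <= j <= n - 2)%N -> (r < 2 * n - j)%N ->
  Mentry x z r (2 * n - j) = bprod x j * Xbar x j.+1 * z * Mcol1 x r.
Proof.
elim: j => [|[|j] IH] // hj hr.
  rewrite col_right1 // col1E !delta_neq; try lia.
  by rewrite /bprod big_nat1; ring.
have X0 : Xbar x j.+2 != 0 by case: Mx => _ _; apply; lia.
rewrite col_right; try lia.
have -> : (2 * n + 1 - j.+2 = 2 * n - j.+1)%N by lia.
rewrite IH ?delta_neq; try lia.
by rewrite !mul0r [bprod x j.+2]bprodS; fld.
Qed.

Lemma right_diag j : (1 <= j <= n - 2)%N ->
  Mentry x z (2 * n - j) (2 * n - j) = Xbar x j.+1 * (level x * z) - w * (bc x j.+1 / xc x j.+1).
Proof.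
case: j => [|j] // hj.
have := bprod_neq0 Mx (j := j.+1) ltac:(lia); rewrite bprodS mulf_eq0 negb_or => /andP[b0 b1].
have x0 : xc x j.+2 != 0 by case: Mx => + _ _; apply; lia.
case: j hj b0 b1 x0 => [|j] hj b0 b1 x0.
  rewrite col_right1 // col1E (delta_neq F (r := (2 * n - 1)%N) (s := (2 * n)%N)) ?delta_eq //; try lia.
  rewrite col1_b; last lia.
  by rewrite /bprod big_nat1 /w; fld.
have X0 : Xbar x j.+2 != 0 by case: Mx => _ _; apply; lia.
rewrite col_right; try lia.
have -> : (2 * n + 1 - j.+2 = 2 * n - j.+1)%N by lia.
rewrite right_above ?(delta_neq F (s := (2 * n - j.+1)%N)) ?delta_eq //; try lia.
rewrite col1_b; last lia.
by rewrite ?mul0r [bprod x j.+2]bprodS /w; fld.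
Qed.

Lemma right_below k j : (k < j <= n - 2)%N ->
  Mentry x z (2 * n - k) (2 * n - j) = bprod x j * Xbar x j.+1 / bprod x k.
Proof.
elim: j => [|[|j] IH] // hj.
  have -> : k = 0%N by lia.
  rewrite subn0 col_right1 // col1E (delta_neq F (s := (2 * n - 1)%N)) ?delta_eq //; try lia.
  have := col1_b x (j := 0%N); rewrite subn0 => ->; last lia.
  by rewrite mul0r /bprod big_nat1 big_geq //; fld; apply: oner_neq0.
have X0 : Xbar x j.+2 != 0 by case: Mx => _ _; apply; lia.
have b0 := bprod_neq0 Mx (j := k) ltac:(lia).
have x0 : xc x j.+2 != 0 by case: Mx => + _ _; apply; lia.
have b1 : bc x j.+2 != 0 by case: Mx => _ + _; apply; lia.
rewrite col_right; try lia.
have -> : (2 * n + 1 - j.+2 = 2 * n - j.+1)%N by lia.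
rewrite (delta_neq F (s := (2 * n - j.+2)%N)); last lia.
have [kj|kj] := ltnP k j.+1.
  rewrite IH ?delta_neq //; try lia.
  by rewrite !mul0r [bprod x j.+2]bprodS; fld.
have {IH kj} ek : k = j.+1 by lia.
rewrite ek in hj b0 *; rewrite right_diag ?delta_eq //; try lia.
have -> : bc x j.+2 / xc x j.+2 = Xbar x j.+2 - 1 by rewrite /Xbar; ring.
by rewrite ?mul0r [bprod x j.+2]bprodS /w; fld.
Qed.

End Fixed.
End Closed.

(** * The last column relation, and lower triangularity at z = 0 *)

Section Closing.
Variables (F : fieldType) (n : nat).
Hypothesis hn : (4 <= n)%N.
Implicit Types (x y : point F n) (z a b c : F) (r s i j k : nat).

Lemma xprod_n x : xprod x n = xprod x n.-1 * xc x n.-1.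
Proof. by have := xprodS x (j := n.-1); rewrite prednK; [apply|]; lia. Qed.

Lemma bprod_n x : bprod x n.-1 = bprod x (n - 2) * bc x n.-1.
Proof. by have := bprodS x (n - 2); have -> : (n - 2).+1 = n.-1 by lia. Qed.

Lemma level_split x :
  level x = xprod x n.-1 * xc x n.-1 * xc x n * bprod x (n - 2) * bc x n.-1.
Proof. by rewrite levelE // bprod_n xprodS ?xprod_n ?mulrA //; lia. Qed.

(** The defining recursion reaches columns n and n + 1 from the left and column
    n + 2 from the right.  This relation closes the gap between n + 1 and n + 2;
    not being a step of the recursion, it is verified on closed forms of the
    entries. *)
Lemma col_close x z r : Mdefined x -> (1 <= r <= 2 * n)%N ->
  Mentry x z r n.+2 =
    Xbar x n.-1 / bc x n.-1 *
      (Mentry x z r n.+1 + (level x * z - 1) * (delta F r n.+1 / xc x n))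
    + (level x * z - 1) * delta F r n.+2.
Proof.
move=> Mx hr.
have q0 : xprod x n.-1 != 0 by apply: xprod_neq0 => //; lia.
have v0 : bprod x (n - 2) != 0 by apply: bprod_neq0 => //; lia.
have x0 : xc x n != 0 by case: Mx => + _ _; apply; lia.
have x1 : xc x n.-1 != 0 by case: Mx => + _ _; apply; lia.
have b1 : bc x n.-1 != 0 by case: Mx => _ + _; apply; lia.
have en : (n.+2 = 2 * n - (n - 2))%N by lia.
have en1 : ((n - 2).+1 = n.-1)%N by lia.
rewrite col_n1 //; have [rn|rn] := ltnP r n.+2.
  rewrite [in LHS]en right_above ?en1 //; side.
  rewrite (@delta_neq _ _ n.+2); side.
  have [r1|r1] := ltnP r n.-1.
    rewrite left_above ?(delta_neq F (s := n.-1)) ?(delta_neq F (s := n)) ?(delta_neq F (s := n.+1)); side.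
    by rewrite !mul0r level_split; fld.
  have : r = n.-1 \/ r = n \/ r = n.+1 by lia.
  case=> [->|[->|->]].
  - rewrite left_diag ?col1_x ?(delta_eq F (s := n.-1)) ?(delta_neq F (s := n)) ?(delta_neq F (s := n.+1)); side.
    by rewrite !mul0r level_split; fld.
  - rewrite left_below ?col1_n ?(delta_eq F (s := n)) ?(delta_neq F (s := n.-1)) ?(delta_neq F (s := n.+1)); side.
    by rewrite !mul0r level_split xprodS ?xprod_n //; [fld|lia].
  - rewrite left_below ?col1_n1 ?(delta_eq F (s := n.+1)) ?(delta_neq F (s := n.-1)) ?(delta_neq F (s := n)); side.
    by rewrite !mul0r level_split ?xprod_n //; fld.
have er : r = (2 * n - (2 * n - r))%N by lia.
have bn : bprod x (2 * n - r) != 0 by apply: bprod_neq0 => //; lia.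
rewrite (@left_below F n hn x z r n.-1) ?(delta_neq F (s := n.+1)) ?(delta_neq F (s := n.-1)) ?(delta_neq F (s := n)); side.
rewrite [in Mcol1 x r]er col1_b; side.
have [r2|r2] := ltnP n.+2 r.
  have -> : Mentry x z r n.+2 = Mentry x z (2 * n - (2 * n - r)) (2 * n - (n - 2)) by congr Mentry; lia.
  rewrite right_below ?delta_neq ?en1; side.
  by rewrite !mul0r level_split; fld.
have {rn r2} er2 : r = n.+2 by lia.
rewrite er2 delta_eq // en right_diag ?en1; side.
have -> : (2 * n - (2 * n - (n - 2)) = n - 2)%N by lia.
have -> : bc x n.-1 / xc x n.-1 = Xbar x n.-1 - 1 by rewrite /Xbar; ring.
by rewrite !mul0r level_split; fld.
Qed.

(** Above the diagonal the closed forms carry a factor z, and in columns n and n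
    + 1 the delta terms cancel the rest at z = 0.  The rows up to n are those in
    which eps_i and phi_i with i <= n - 1 are found. *)
Lemma upper_zero x r s : Mdefined x -> (1 <= r <= n)%N -> (r < s <= 2 * n)%N ->
  Mentry x 0 r s = 0.
Proof.
move=> Mx hr hs.
have x0 : xc x n != 0 by case: Mx => + _ _; apply; lia.
have x1 : xc x n.-1 != 0 by case: Mx => + _ _; apply; lia.
have b1 : bc x n.-1 != 0 by case: Mx => _ + _; apply; lia.
have q0 : xprod x n.-1 != 0 by apply: xprod_neq0 => //; lia.
have [s1|s1] := ltnP s n; first by rewrite left_above ?mulr0 ?mul0r //; lia.
have [s2|s2] := ltnP s n.+2; last first.
  have [->|s3] := eqVneq s (2 * n)%N.
    by rewrite col_right0 // delta_neq; [ring|lia].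
  have -> : s = (2 * n - (2 * n - s))%N by lia.
  by rewrite right_above ?mulr0 ?mul0r //; lia.
have [r1|r1] := ltnP r n.-1.
  have -> : Mentry x 0 r s = 0; last by [].
  have [->|s3] := eqVneq s n.
    by rewrite col_n // left_above ?delta_neq ?mulr0 ?mul0r ?addr0 ?mulr0 ?mul0r ?addr0 //; lia.
  have -> : s = n.+1 by lia.
  by rewrite col_n1 // left_above ?delta_neq ?mulr0 ?mul0r ?addr0 ?mulr0 ?mul0r ?addr0 //; lia.
have [er|er] : r = n.-1 \/ r = n by lia.
  have [->|s3] := eqVneq s n.
    rewrite col_n // er left_diag ?(delta_eq F (s := n.-1)) ?delta_neq //; side.
    by field; nz.
  have -> : s = n.+1 by lia.
  rewrite col_n1 // er left_diag ?(delta_eq F (s := n.-1)) ?delta_neq //; side.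
  by field; nz.
have -> : s = n.+1 by lia.
rewrite col_n1 // er left_below ?(delta_eq F (s := n)) ?delta_neq ?col1_n //; side.
rewrite xprodS ?xprod_n; side. by fld.
Qed.

End Closing.

(** * The crystal operators 1, ..., n - 2 as unipotent row and column operations *)

Section Action.
Variables (F : fieldType) (n : nat).
Hypothesis hn : (4 <= n)%N.
Implicit Types (x y : point F n) (z a b c : F) (r s i j k : nat).

(** M(x, z) U(b), entry by entry and with natural number indices, so that
    recursions in the indices can be used. *)
Definition coladd x z i b r s : F := Mentry x z r s
  + b * (delta F s i.+1 * Mentry x z r i + delta F s (2 * n - i).+1 * Mentry x z r (2 * n - i)).

(** U(a) M(x, z) U(b), entry by entry. *)
Definition unip x z i a b r s : F := coladd x z i b r s
  + a * (delta F r i * coladd x z i b i.+1 s + delta F r (2 * n - i) * coladd x z i b (2 * n - i).+1 s).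

Section Bulk.
Variables (x x' : point F n) (z : F) (i : nat) (c : F).
Hypotheses (hi : (1 <= i <= n - 2)%N) (Mx : Mdefined x) (Mx' : Mdefined x').
Hypotheses (c0 : c != 0) (s0 : xc x i.+1 + bc x i.+1 != 0) (t0 : xc x i.+1 + c * bc x i.+1 != 0).
Hypothesis (ex' : x' = crystal_e i c x).

Lemma xc_same k : (1 <= k <= n)%N -> k <> i -> k <> i.+1 -> xc x' k = xc x k.
Proof.
move=> hk ki ki'; rewrite ex' /crystal_e ifF 1?ifT ?xc_mkpoint; side.
by rewrite !ifF //; nlia.
Qed.

Lemma bc_same k : (1 <= k <= n.-1)%N -> k <> i -> k <> i.+1 -> bc x' k = bc x k.
Proof.
move=> hk ki ki'; rewrite ex' /crystal_e ifF 1?ifT ?bc_mkpoint; side.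
by rewrite !ifF //; nlia.
Qed.

Lemma xc_i : xc x' i = c * (xi c x i.+1)^-1 * xc x i.
Proof.
rewrite ex' /crystal_e ifF 1?ifT ?xc_mkpoint; side.
by rewrite eqxx.
Qed.

Lemma bc_i : bc x' i = (xi c x i.+1)^-1 * bc x i.
Proof.
rewrite ex' /crystal_e ifF 1?ifT ?bc_mkpoint; side.
by rewrite eqxx.
Qed.

Lemma xc_i1 : xc x' i.+1 = c^-1 * xi c x i.+1 * xc x i.+1.
Proof.
rewrite ex' /crystal_e ifF 1?ifT ?xc_mkpoint; side.
by rewrite ifF ?eqxx //; nlia.
Qed.

Lemma bc_i1 : bc x' i.+1 = xi c x i.+1 * bc x i.+1.
Proof.
rewrite ex' /crystal_e ifF 1?ifT ?bc_mkpoint; side.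
by rewrite ifF ?eqxx //; nlia.
Qed.

Let X := xc x i.
Let B := bc x i.
Let X1 := xc x i.+1.
Let B1 := bc x i.+1.
Let X_neq0 : X != 0. Proof. by case: Mx => + _ _; apply; nlia. Qed.
Let B_neq0 : B != 0. Proof. by case: Mx => _ + _; apply; nlia. Qed.
Let X1_neq0 : X1 != 0. Proof. by case: Mx => + _ _; apply; nlia. Qed.
Let B1_neq0 : B1 != 0. Proof. by case: Mx => _ + _; apply; nlia. Qed.
Let s1 : X1 + B1 != 0. Proof. exact: s0. Qed.
Let s2 : B1 + X1 != 0. Proof. by rewrite addrC. Qed.
Let t1 : X1 + c * B1 != 0. Proof. exact: t0. Qed.

Let xi0 : xi c x i.+1 != 0.
Proof. by rewrite /xi mulf_neq0 // invr_eq0. Qed.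

Lemma xprod_low j : (j <= i)%N -> xprod x' j = xprod x j.
Proof.
by move=> hj; apply: eq_big_nat => k hk; apply: xc_same; nlia.
Qed.

Lemma xprod_mid : xprod x' i.+1 = c * (xi c x i.+1)^-1 * xprod x i.+1.
Proof.
rewrite !xprodS; [|nlia|nlia].
by rewrite xprod_low // xc_i; ring.
Qed.

Lemma xprod_high j : (i.+2 <= j <= n.+1)%N -> xprod x' j = xprod x j.
Proof.
elim: j => [|j IH] hj; first by nlia.
have [ij|ij] := ltnP i.+1 j; first by rewrite !xprodS ?IH ?xc_same //; nlia.
have -> : j = i.+1 by nlia.
rewrite [LHS]xprodS // xprod_mid xc_i1 [xprod x i.+2]xprodS //; fld.
Qed.

Lemma bprod_low j : (j < i)%N -> bprod x' j = bprod x j.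
Proof.
by move=> hj; apply: eq_big_nat => k hk; apply: bc_same; nlia.
Qed.

Lemma bprod_mid : bprod x' i = (xi c x i.+1)^-1 * bprod x i.
Proof.
have := bprod_low (j := i.-1); have := bc_i; have := bprodS x i.-1; have := bprodS x' i.-1.
have -> : i.-1.+1 = i by nlia.
by move=> -> -> -> ->; [ring|nlia].
Qed.

Lemma bprod_high j : (i < j <= n.-1)%N -> bprod x' j = bprod x j.
Proof.
elim: j => [|j IH] hj; first by nlia.
have [ij|ij] := ltnP i j; first by rewrite !bprodS ?IH ?bc_same //; nlia.
have -> : j = i by nlia.
rewrite [LHS]bprodS // bprod_mid bc_i1 [bprod x i.+1]bprodS //; fld.
Qed.

(** The factors c / xi, xi / c, xi, 1 / xi of the four changed coordinates have
    product 1. *)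
Lemma level_e : level x' = level x.
Proof. by rewrite !levelE // xprod_high ?bprod_high //; nlia. Qed.

Let a := (c - 1) / eps i x.
Let b := (c^-1 - 1) / phi i x.

Let epsE : eps i x = B * (X1 / B1 + 1).
Proof. by rewrite /eps ifF 1?ifT //; nlia. Qed.

Let phiE : phi i x = X * (B1 / X1 + 1).
Proof. by rewrite /phi ifF 1?ifT //; nlia. Qed.

Let aE : a = (c - 1) * B1 / (B * (X1 + B1)).
Proof. by rewrite /a epsE; fld. Qed.

Let bE : b = (c^-1 - 1) * X1 / (X * (X1 + B1)).
Proof. by rewrite /b phiE; fld. Qed.

Let xiE : xi c x i.+1 = (X1 + c * B1) / (X1 + B1).
Proof. by []. Qed.

Variable r : nat.
Hypothesis hr : (1 <= r <= 2 * n)%N.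
Local Notation PR s := (Mentry x' z r s = unip x z i a b r s).

#[local] Opaque crystal_e xc bc xi eps phi level Mentry Mcol1 xprod bprod.

(** Column 1 is not changed by U(b) as i >= 1.  Only the rows i and 2n - i of
    the first column change, by the multiples of the next row that U(a) adds. *)
Lemma bulk_col1 : PR 1.
Proof.
rewrite /unip /coladd !col1E //; dlt; rewrite ?col1E //.
have d1 k : k <> i -> (1 <= k <= n.-1)%N -> k <> i.+1 -> Mcol1 x' k = Mcol1 x k.
  move=> ki hk ki1.
  have [e1|r1] : k = 1%N \/ k <> 1%N by nlia.
    by rewrite e1 !col1_first -e1 xc_same ?bc_same; side.
  rewrite !col1_x ?xc_same ?bc_same; side.
  have [lt|ge] := ltnP k i; first by rewrite xprod_low //; nlia.
  by rewrite xprod_high //; nlia.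
have [er|[er|[er|er]]] : r = i \/ r = i.+1 \/ r = (2 * n - i)%N \/
  r <> i /\ r <> i.+1 /\ r <> (2 * n - i)%N by nlia.
- rewrite er; dlt; rewrite aE [Mcol1 x i.+1]col1_x ?xprodS; side.
  have [e1|e1] : i = 1%N \/ i <> 1%N by nlia.
    have xp1 : xprod x i = 1 by rewrite e1; exact: big_geq.
    have -> : Mcol1 x' i = xc x' i / bc x' i by rewrite e1 col1_first.
    have -> : Mcol1 x i = xc x i / bc x i by rewrite e1 col1_first.
    by rewrite xp1 xc_i bc_i xiE -!/X -!/B -!/X1 -!/B1; fld.
  rewrite !col1_x ?xprod_low ?xc_i ?bc_i ?xiE; side.
  by rewrite -!/X -!/B -!/X1 -!/B1; fld.
- rewrite er; dlt; rewrite !col1_x ?xprod_mid ?xc_i1 ?bc_i1 ?xiE; side.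
  by rewrite -!/X1 -!/B1; fld.
- rewrite er; dlt; rewrite aE.
  have e : ((2 * n - i).+1 = 2 * n - i.-1)%N by nlia.
  rewrite e !col1_b ?level_e; side.
  have := bprodS x i.-1; have -> : i.-1.+1 = i by nlia.
  rewrite bprod_mid => ->.
  have v0 : bprod x i.-1 != 0 by apply: bprod_neq0; side.
  by rewrite xiE -!/B -!/X1 -!/B1; fld.
have [er1 [er2 er3]] := er; dlt.
have [r1|r1] := ltnP r n; first by apply: d1; nlia.
have [->|r2] : r = n \/ r <> n by nlia.
  by rewrite !col1_n ?xprod_high; side.
have [->|r3] : r = n.+1 \/ r <> n.+1 by nlia.
  by rewrite !col1_n1 ?xprod_high; side.
have -> : r = (2 * n - (2 * n - r))%N by nlia.
rewrite !col1_b ?level_e; side.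
have [lt|ge] := ltnP (2 * n - r) i; first by rewrite bprod_low.
by rewrite bprod_high; side.
Qed.

(** Here e_i^c changes neither the coefficients of the recursion step nor,
    through U(b), one of its two columns, and U(a) fixes the basis vectors that
    occur. *)
Lemma bulk_left_far s : (1 <= s <= n - 2)%N -> s <> i -> s <> i.+1 -> PR s -> PR s.+1.
Proof.
move=> hs si si1; rewrite /unip /coladd => PS.
rewrite (col_left hn x' z r hs) PS !(fun k => col_left hn x z k hs).
by rewrite level_e xc_same ?bc_same; side; dlt; ring.
Qed.

Lemma bulk_left_i : PR i -> PR i.+1.
Proof.
rewrite /unip /coladd => PS.
have hs : (1 <= i <= n - 2)%N by nlia.
rewrite (col_left hn x' z r hs) PS !(fun k => col_left hn x z k hs).
rewrite level_e; dlt; rewrite ?aE ?bE xc_i bc_i xiE -!/X -!/B -!/X1 -!/B1; fld.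
Qed.

(** This step skips column i + 1, which U(b) changes, and goes directly from
    column i to column i + 2. *)
Lemma bulk_left_i1 : (i.+1 <= n - 2)%N -> PR i -> PR i.+2.
Proof.
move=> hi1; rewrite /unip /coladd => PS.
have hs : (1 <= i <= n - 2)%N by nlia.
have hs1 : (1 <= i.+1 <= n - 2)%N by nlia.
rewrite (col_left hn x' z r hs1) (col_left hn x' z r hs) PS.
rewrite !(fun k => col_left hn x z k hs1) !(fun k => col_left hn x z k hs).
rewrite level_e; dlt; rewrite ?aE ?bE xc_i bc_i xc_i1 bc_i1 xiE -!/X -!/B -!/X1 -!/B1; fld.
Qed.

Lemma bulk_left_n : (i.+1 <= n - 2)%N -> PR n.-1 -> PR n /\ PR n.+1.
Proof.
move=> hi1; rewrite /unip /coladd => PS.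
rewrite !col_n // !col_n1 // PS.
by rewrite level_e !xc_same ?bc_same; side; dlt; split; ring.
Qed.

(** For i = n - 2 the step past the changed column i + 1 = n - 1 ends in both
    columns n and n + 1. *)
Lemma bulk_left_n' : i.+1 = n.-1 -> PR i -> PR n /\ PR n.+1.
Proof.
move=> hi1; rewrite /unip /coladd => PS.
have hs : (1 <= i <= n - 2)%N by nlia.
have xn0 : xc x n != 0 by case: Mx => + _ _; apply; nlia.
rewrite !col_n // !col_n1 // -hi1.
rewrite (col_left hn x' z r hs) PS !(fun k => col_left hn x z k hs).
rewrite level_e (xc_same (k := n)); side.
rewrite xc_i1 bc_i1 xc_i bc_i xiE; dlt; rewrite ?aE ?bE -!/X -!/B -!/X1 -!/B1; split; fld.
Qed.

Lemma bulk_2n : (2 <= i)%N -> PR 1 -> PR (2 * n).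
Proof.
move=> i2; rewrite /unip /coladd => PS.
rewrite !col_right0 // PS level_e xc_same ?bc_same; side.
by dlt; ring.
Qed.

Lemma bulk_2n1 : (3 <= i)%N -> PR 1 -> PR (2 * n - 1).
Proof.
move=> i2; rewrite /unip /coladd => PS.
rewrite !col_right1 // PS /Xbar level_e !xc_same ?bc_same; side.
by dlt; ring.
Qed.

Let toatoms := (level_e, xc_i, bc_i, xc_i1, bc_i1, xiE).
Local Ltac atoms := rewrite ?toatoms /Xbar ?toatoms ?aE ?bE -!/X -!/B -!/X1 -!/B1.

(** For i = 1 column 2n is the one changed by U(b), and the changed coordinates
    x_2, xbar_2 enter column 2n - 1. *)
Lemma bulk_2n_1 : i = 1%N -> PR 1 -> PR (2 * n) /\ PR (2 * n - 1).
Proof.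
move=> i1.
have R0 y k : Mentry y z k (2 * n) = z * (bc y i / xc y i) * Mentry y z k i
    + delta F k (2 * n) * (bc y i / xc y i) * (1 - level y * z)
    + delta F k i * z * (level y * z - 1) by rewrite i1 col_right0.
have R1 y k : Mentry y z k (2 * n - i) = z * bc y i * Xbar y i.+1 * Mentry y z k i
    + (1 - level y * z) * (delta F k (2 * n) * bc y i * Xbar y i.+1
      + delta F k (2 * n - i) * (bc y i.+1 / xc y i.+1)) by rewrite i1 col_right1.
have d : ((2 * n - i).+1 = 2 * n)%N by nlia.
have -> : (2 * n - 1 = 2 * n - i)%N by rewrite i1.
move=> /(fun PS => eq_ind_r (fun s => PR s) PS i1).
rewrite /unip /coladd d => PS; rewrite !R1 !R0 PS.
by split; dlt; atoms; fld.
Qed.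

Let XB : (2 <= i)%N -> X + B != 0 /\ c * X + B != 0.
Proof.
move=> i2; have [_ _ /(_ i ltac:(nlia))] := Mx; have [_ _ /(_ i ltac:(nlia))] := Mx'.
rewrite /Xbar xc_i bc_i xiE -!/X -!/B -!/X1 -!/B1 => h2 h1; split.
  have -> : X + B = X * (1 + B / X) by fld.
  exact: mulf_neq0.
set q := 1 + _ in h2; have -> : c * X + B = c * X * q by rewrite /q; fld.
by rewrite !mulf_neq0.
Qed.

Lemma bulk_right_far j : (2 <= j <= n - 2)%N -> j <> i.-1 -> j <> i -> j <> i.+1 ->
  PR (2 * n + 1 - j) -> PR (2 * n - j).
Proof.
move=> hj j1 j2 j3; rewrite /unip /coladd => PS.
rewrite (col_right hn x' z r hj) PS !(fun k => col_right hn x z k hj) /Xbar level_e.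
by rewrite !xc_same ?bc_same; side; dlt; ring.
Qed.

(** Step out of the column 2n - i + 1 changed by U(b). *)
Lemma bulk_right_i : (2 <= i)%N -> PR (2 * n - i).+1 -> PR (2 * n - i).
Proof.
move=> i2; have [u1 u2] := XB i2.
have R1 y k : Mentry y z k (2 * n - i) = bc y i * (Xbar y i.+1 / Xbar y i) * Mentry y z k (2 * n - i).+1
      + (1 - level y * z)
        * (delta F k (2 * n - i).+1 * bc y i * (Xbar y i.+1 / Xbar y i)
           + delta F k (2 * n - i) * (bc y i.+1 / xc y i.+1)).
  by have := @col_right F n hn y z k i ltac:(nlia); have -> : (2 * n + 1 - i = (2 * n - i).+1)%N by nlia.
rewrite /unip /coladd => PS; rewrite (R1 x') PS !R1.
by dlt; atoms; fld.
Qed.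

(** The coefficient of this step is xbar_(i+1) / Xbar_(i+1) up to unchanged
    factors, and this quotient is invariant under e_i^c. *)
Lemma bulk_right_i1 : (i.+1 <= n - 2)%N -> PR (2 * n - i) -> PR (2 * n - i.+1).
Proof.
move=> i2.
have R1 y k : Mentry y z k (2 * n - i.+1) = bc y i.+1 * (Xbar y i.+2 / Xbar y i.+1) * Mentry y z k (2 * n - i)
      + (1 - level y * z)
        * (delta F k (2 * n - i) * bc y i.+1 * (Xbar y i.+2 / Xbar y i.+1)
           + delta F k (2 * n - i.+1) * (bc y i.+2 / xc y i.+2)).
  by have := @col_right F n hn y z k i.+1 ltac:(nlia); have -> : (2 * n + 1 - i.+1 = 2 * n - i)%N by nlia.
have e : Xbar x' i.+2 = Xbar x i.+2 by rewrite /Xbar xc_same ?bc_same; side.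
rewrite /unip /coladd => PS; rewrite (R1 x') PS !R1 e !(xc_same (k := i.+2)) ?(bc_same (k := i.+2)); side.
move: (Xbar x i.+2) (bc x i.+2 / xc x i.+2) => V W.
by dlt; atoms; fld.
Qed.

(** Step into the column 2n - i + 1, which U(b) changes by a multiple of column
    2n - i. *)
Lemma bulk_right_pred : (3 <= i)%N -> PR (2 * n - i).+2 -> PR (2 * n - i).+1.
Proof.
move=> i2; have [u1 u2] := XB (ltnW i2).
have v0 : Xbar x i.-1 != 0 by case: Mx => _ _; apply; nlia.
have R1 y k : Mentry y z k (2 * n - i) = bc y i * (Xbar y i.+1 / Xbar y i) * Mentry y z k (2 * n - i).+1
      + (1 - level y * z)
        * (delta F k (2 * n - i).+1 * bc y i * (Xbar y i.+1 / Xbar y i)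
           + delta F k (2 * n - i) * (bc y i.+1 / xc y i.+1)).
  by have := @col_right F n hn y z k i ltac:(nlia); have -> : (2 * n + 1 - i = (2 * n - i).+1)%N by nlia.
have R2 y k : Mentry y z k (2 * n - i).+1 = bc y i.-1 * (Xbar y i / Xbar y i.-1) * Mentry y z k (2 * n - i).+2
      + (1 - level y * z)
        * (delta F k (2 * n - i).+2 * bc y i.-1 * (Xbar y i / Xbar y i.-1)
           + delta F k (2 * n - i).+1 * (bc y i / xc y i)).
  have := @col_right F n hn y z k i.-1 ltac:(nlia).
  have -> : i.-1.+1 = i by nlia.
  have -> : (2 * n - i.-1 = (2 * n - i).+1)%N by nlia.
  by have -> : (2 * n + 1 - i.-1 = (2 * n - i).+2)%N by nlia.
have e : Xbar x' i.-1 = Xbar x i.-1 by rewrite /Xbar xc_same ?bc_same; side.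
rewrite /unip /coladd => PS; rewrite (R2 x') PS !R1 !R2 e (bc_same (k := i.-1)); side.
move: (Xbar x i.-1) v0 => V v0.
by dlt; atoms; fld.
Qed.

(** For i = 2 the column changed by U(b) is 2n - 1, the one whose recursion
    starts from the first column. *)
Lemma bulk_2n1_2 : i = 2 -> PR 1 -> PR (2 * n - i).+1.
Proof.
move=> i2; have [u1 u2] := XB ltac:(nlia).
have R1 y k : Mentry y z k (2 * n - i) = bc y i * (Xbar y i.+1 / Xbar y i) * Mentry y z k (2 * n - i).+1
      + (1 - level y * z)
        * (delta F k (2 * n - i).+1 * bc y i * (Xbar y i.+1 / Xbar y i)
           + delta F k (2 * n - i) * (bc y i.+1 / xc y i.+1)).
  by have := @col_right F n hn y z k i ltac:(nlia); have -> : (2 * n + 1 - i = (2 * n - i).+1)%N by nlia.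
have d : ((2 * n - i).+1 = 2 * n - 1)%N by nlia.
have R2 y k : Mentry y z k (2 * n - i).+1 = z * bc y 1 * Xbar y i * Mentry y z k 1
      + (1 - level y * z)
        * (delta F k (2 * n) * bc y 1 * Xbar y i
           + delta F k (2 * n - i).+1 * (bc y i / xc y i)) by rewrite d i2 col_right1.
rewrite /unip /coladd => PS; rewrite (R2 x') PS !R1 !R2 (bc_same (k := 1%N)); side.
by dlt; atoms; fld.
Qed.

Lemma bulk_left s : (1 <= s <= n.+1)%N -> PR s.
Proof.
have small : forall s, (1 <= s <= i)%N -> PR s.
  elim=> [|[|t] IH] ht; [by []|exact: bulk_col1|].
  by apply: bulk_left_far; [| | |apply: IH]; nlia.
have low : forall s, (1 <= s <= n.-1)%N -> PR s.
  elim=> [|t IH] ht; first by [].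
  have [?|[e|[e|?]]] : (t.+1 <= i)%N \/ t = i \/ t = i.+1 \/ (i.+2 <= t)%N by nlia.
  - by apply: small; nlia.
  - by rewrite e; apply/bulk_left_i/small; nlia.
  - by rewrite e; apply: bulk_left_i1; [|apply: small]; nlia.
  - by apply: bulk_left_far; [| | |apply: IH]; nlia.
move=> hs; have [h|h] := ltnP s n; first by apply: low; nlia.
have [Pn Pn1] : PR n /\ PR n.+1.
  have [e|e] : i.+1 = n.-1 \/ (i.+1 <= n - 2)%N by nlia.
    by apply: bulk_left_n' => //; apply: small; nlia.
  by apply: bulk_left_n => //; apply: low; nlia.
by have [->|->] : s = n \/ s = n.+1 by nlia.
Qed.

Lemma bulk_right j : (j <= n - 2)%N -> PR (2 * n - j).
Proof.
have P1 := bulk_col1.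
have P0 : PR (2 * n).
  have [e|e] : i = 1%N \/ (2 <= i)%N by nlia.
    by case: (bulk_2n_1 e P1).
  exact: bulk_2n.
have shift k : (k <= i)%N -> (2 * n - i + k = 2 * n - (i - k))%N by nlia.
elim: j => [|[|j] IH] hj; first by rewrite subn0.
  have [e|[e|e]] : i = 1%N \/ i = 2 \/ (3 <= i)%N by nlia.
  - by case: (bulk_2n_1 e P1).
  - by have -> : (2 * n - 1 = (2 * n - i).+1)%N by [nlia]; apply: bulk_2n1_2.
  - exact: bulk_2n1.
have {}IH : PR (2 * n + 1 - j.+2) by have -> : (2 * n + 1 - j.+2 = 2 * n - j.+1)%N by [nlia]; apply: IH; nlia.
have [e|[e|[e|e]]] : i = j.+3 \/ i = j.+2 \/ i = j.+1 \/ (j.+2 <> i.-1 /\ j.+2 <> i /\ j.+2 <> i.+1) by nlia.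
- have -> : (2 * n - j.+2 = (2 * n - i).+1)%N by nlia.
  apply: bulk_right_pred; first by nlia.
  by move: IH; have -> : (2 * n + 1 - j.+2 = (2 * n - i).+2)%N by nlia.
- have -> : (2 * n - j.+2 = 2 * n - i)%N by nlia.
  apply: bulk_right_i; first by nlia.
  by move: IH; have -> : (2 * n + 1 - j.+2 = (2 * n - i).+1)%N by nlia.
- have -> : (2 * n - j.+2 = 2 * n - i.+1)%N by nlia.
  apply: bulk_right_i1; first by nlia.
  by move: IH; have -> : (2 * n + 1 - j.+2 = 2 * n - i)%N by nlia.
have [e1 [e2 e3]] := e; apply: bulk_right_far => //; nlia.
Qed.

Lemma bulk_unip s : (1 <= s <= 2 * n)%N -> PR s.
Proof.
move=> hs; have [h|h] := leqP s n.+1; first by apply: bulk_left; nlia.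
have -> : (s = 2 * n - (2 * n - s))%N by nlia.
by apply: bulk_right; nlia.
Qed.

End Bulk.
End Action.

(** * The crystal operator n - 1 *)

Section Spin.
Variables (F : fieldType) (n : nat).
Hypothesis hn : (4 <= n)%N.
Variables (x x' : point F n) (z : F) (i : nat) (c : F).
Hypotheses (ei : i.+1 = n) (Mx : Mdefined x) (Mx' : Mdefined x') (c0 : c != 0).
Hypothesis (ex' : x' = crystal_e i c x).

Lemma spin_xc k : (1 <= k < i)%N -> xc x' k = xc x k.
Proof.
move=> hk; rewrite ex' /crystal_e ifF 1?ifF 1?ifT ?xc_mkpoint; side.
by rewrite !ifF; side.
Qed.

Lemma spin_bc k : (1 <= k <= i)%N -> bc x' k = bc x k.
Proof. by move=> hk; rewrite ex' /crystal_e ifF 1?ifF 1?ifT ?bc_mkpoint; side. Qed.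

Lemma spin_x_i : xc x' i = c * xc x i.
Proof.
rewrite ex' /crystal_e ifF 1?ifF 1?ifT ?xc_mkpoint; side.
by rewrite ifT; side; have -> : n.-1 = i by nlia.
Qed.

Lemma spin_x_n : xc x' n = c^-1 * xc x n.
Proof.
rewrite ex' /crystal_e ifF 1?ifF 1?ifT ?xc_mkpoint; side.
by rewrite ifF 1?ifT; side.
Qed.

Let X := xc x i.
Let B := bc x i.
Let Y := xc x n.
Let X_neq0 : X != 0. Proof. by case: Mx => + _ _; apply; nlia. Qed.
Let B_neq0 : B != 0. Proof. by case: Mx => _ + _; apply; nlia. Qed.
Let Y_neq0 : Y != 0. Proof. by case: Mx => + _ _; apply; nlia. Qed.

Lemma spin_xprod j : (j <= i)%N -> xprod x' j = xprod x j.
Proof. by move=> hj; apply: eq_big_nat => k hk; apply: spin_xc; nlia. Qed.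

Lemma spin_bprod j : (j <= i)%N -> bprod x' j = bprod x j.
Proof. by move=> hj; apply: eq_big_nat => k hk; apply: spin_bc; nlia. Qed.

Lemma spin_xprod_n : xprod x' n = c * xprod x n.
Proof.
have e (y : point F n) : xprod y n = xprod y i * xc y i.
  by have := xprodS y (j := i) ltac:(nlia); rewrite ei.
by rewrite !e spin_xprod ?spin_x_i //; ring.
Qed.

Lemma spin_xprod_n1 : xprod x' n.+1 = xprod x n.+1.
Proof. by rewrite [LHS]xprodS 1?[RHS]xprodS ?spin_xprod_n ?spin_x_n; side; fld. Qed.

Lemma spin_level : level x' = level x.
Proof. by rewrite !levelE // spin_xprod_n1 spin_bprod; side. Qed.

Let a := (c - 1) / eps i x.
Let b := (c^-1 - 1) / phi i x.

Let aE : a = (c - 1) / (Y * B).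
Proof.
rewrite /a /eps ifF 1?ifF 1?ifT; side.
by have -> : n.-1 = i by nlia.
Qed.

Let bE : b = (c^-1 - 1) / X.
Proof.
rewrite /b /phi ifF 1?ifF 1?ifT; side.
by have -> : n.-1 = i by nlia.
Qed.

Variable r : nat.
Hypothesis hr : (1 <= r <= 2 * n)%N.
Local Notation PR s := (Mentry x' z r s = unip x z i a b r s).

#[local] Opaque crystal_e xc bc xi eps phi level Mentry Mcol1 xprod bprod.

Let toatoms := (spin_level, spin_x_i, spin_x_n).
Local Ltac atoms := rewrite ?toatoms /Xbar ?toatoms ?(spin_bc (k := i)); side; rewrite ?aE ?bE -?/X -?/B -?/Y.

Lemma spin_col1 : PR 1.
Proof.
rewrite /unip /coladd !col1E //; dlt; rewrite ?col1E //.
have d : (2 * n - i = n.+1)%N by nlia.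
have en : i = n.-1 by nlia.
have [er|[er|[er|[er|er]]]] : r = i \/ r = n \/ r = n.+1 \/ (r < i)%N \/ (n.+2 <= r)%N by nlia.
- rewrite er; dlt; rewrite ei col1_n // !col1_x ?spin_xprod; side.
  have := xprodS x (j := n) ltac:(nlia); have := xprodS x (j := i) ltac:(nlia).
  rewrite ei => -> ->; atoms; fld.
- by rewrite er; dlt; rewrite !col1_n // spin_xprod_n1.
- rewrite er; dlt; rewrite !col1_n1 // spin_xprod_n d.
  have -> : (n.+2 = 2 * n - (n - 2))%N by nlia.
  have v0 : bprod x (n - 2) != 0 by apply: bprod_neq0; side.
  rewrite col1_b // level_split // -en xprod_n // -en; atoms; fld.
- dlt; have [->|r1] : r = 1%N \/ r <> 1%N by nlia.
    by rewrite !col1_first spin_xc ?spin_bc; side.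
  by rewrite !col1_x ?spin_xc ?spin_bc ?spin_xprod; side.
dlt; have -> : r = (2 * n - (2 * n - r))%N by nlia.
by rewrite !col1_b ?spin_level ?spin_bprod; side.
Qed.

Lemma spin_left s : (1 <= s < i)%N -> PR s -> PR s.+1.
Proof.
move=> hs; rewrite /unip /coladd => PS.
have hs' : (1 <= s <= n - 2)%N by nlia.
rewrite (col_left hn x' z r hs') PS !(fun k => col_left hn x z k hs').
by rewrite spin_level spin_xc ?spin_bc; side; dlt; ring.
Qed.

Lemma spin_n : PR i -> PR n.
Proof.
have en : n.-1 = i by nlia.
rewrite /unip /coladd => PS; rewrite !col_n // en PS; dlt; atoms; fld.
Qed.

Lemma spin_n1 : PR i -> PR n.+1.
Proof.
have en : n.-1 = i by nlia.
rewrite /unip /coladd => PS; rewrite !col_n1 // en PS; dlt; atoms; fld.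
Qed.

(** Column n + 2 is changed by U(b) by a multiple of column n + 1, so that the
    relation between these two columns is needed. *)
Lemma spin_n2 : PR n.+1 -> PR n.+2.
Proof.
have en : n.-1 = i by nlia.
have d : (2 * n - i = n.+1)%N by nlia.
have R1 k : (1 <= k <= 2 * n)%N -> Mentry x z k n.+2 = Xbar x i / bc x i *
    (Mentry x z k n.+1 + (level x * z - 1) * (delta F k n.+1 / xc x n))
    + (level x * z - 1) * delta F k n.+2 by move=> hk; rewrite col_close ?en.
rewrite /unip /coladd ei d => PS.
rewrite col_close // PS en !R1; side.
by dlt; atoms; fld.
Qed.

Lemma spin_2n : PR 1 -> PR (2 * n).
Proof.
rewrite /unip /coladd => PS; rewrite !col_right0 // PS spin_level spin_xc ?spin_bc; side.
by dlt; ring.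
Qed.

Lemma spin_2n1 : PR 1 -> PR (2 * n - 1).
Proof.
rewrite /unip /coladd => PS; rewrite !col_right1 // PS /Xbar spin_level !spin_xc ?spin_bc; side.
by dlt; ring.
Qed.

Lemma spin_right j : (2 <= j <= n - 3)%N -> PR (2 * n + 1 - j) -> PR (2 * n - j).
Proof.
move=> hj; rewrite /unip /coladd => PS.
have hj' : (2 <= j <= n - 2)%N by nlia.
rewrite (col_right hn x' z r hj') PS !(fun k => col_right hn x z k hj') /Xbar spin_level.
by rewrite !spin_xc ?spin_bc; side; dlt; ring.
Qed.

Lemma spin_unip s : (1 <= s <= 2 * n)%N -> PR s.
Proof.
have low : forall s, (1 <= s <= i)%N -> PR s.
  elim=> [|[|t] IH] ht; [by []|exact: spin_col1|].
  by apply: spin_left; [|apply: IH]; nlia.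
have Pi : PR i by apply: low; nlia.
have high : forall j, (j <= n - 3)%N -> PR (2 * n - j).
  elim=> [|[|j] IH] hj; first by rewrite subn0; apply/spin_2n/low; nlia.
    by apply/spin_2n1/low; nlia.
  apply: spin_right => //.
  by have -> : (2 * n + 1 - j.+2 = 2 * n - j.+1)%N by [nlia]; apply: IH; nlia.
move=> hs; have [e|[e|[e|[e|e]]]] : (s <= i)%N \/ s = n \/ s = n.+1 \/ s = n.+2 \/ (n.+3 <= s)%N by nlia.
- by apply: low; nlia.
- by rewrite e; apply: spin_n.
- by rewrite e; apply: spin_n1.
- by rewrite e; apply/spin_n2/spin_n1.
have -> : (s = 2 * n - (2 * n - s))%N by nlia.
by apply: high; nlia.
Qed.

End Spin.

(** * One-parameter unipotent matrices *)

Section Unipotent.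
Variables (F : fieldType) (n : nat).
Hypothesis hn : (4 <= n)%N.
Variable (i : nat).
Hypothesis hi : (1 <= i <= n.-1)%N.

Definition Eentry (r s : nat) : F := ((s == r.+1) && ((r == i) || (r == 2 * n - i)%N))%:R.
Definition Emx : 'M[F]_(2 * n) := \matrix_(r, s) Eentry r.+1 s.+1.
Definition Umx (a : F) : 'M[F]_(2 * n) := 1%:M + a *: Emx.

Lemma Emx_mul (f : nat -> nat -> F) (r s : 'I_(2 * n)) :
  (Emx *m \matrix_(r, s) f r.+1 s.+1) r s =
  delta F r.+1 i * f i.+1 s.+1 + delta F r.+1 (2 * n - i) * f (2 * n - i).+1 s.+1.
Proof.
rewrite !mxE; have [h|h] := boolP ((r.+1 == i) || (r.+1 == 2 * n - i)%N); last first.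
  move: h; rewrite negb_or => /andP[/negPf h1 /negPf h2].
  rewrite /delta h1 h2 !mul0r addr0 big1 // => k _.
  by rewrite !mxE /Eentry h1 h2 andbF mul0r.
have hr : (r.+1 < 2 * n)%N by case/orP: (h) => /eqP; nlia.
rewrite (bigD1 (Ordinal hr)) //= big1 => [|k hk]; last first.
  rewrite !mxE /Eentry eqSS; suff -> : (k == r.+1 :> nat) = false by rewrite mul0r.
  by apply/negbTE; apply: contra hk => /eqP e; apply/eqP/val_inj.
rewrite !mxE /Eentry eqxx h mul1r addr0.
have {h} [h|h] : r.+1 = i \/ r.+1 = (2 * n - i)%N by case/orP: h => /eqP; [left|right].
  by rewrite -h; dlt.
by rewrite -h; dlt.
Qed.

Lemma mul_Emx (f : nat -> nat -> F) (r s : 'I_(2 * n)) :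
  (\matrix_(r, s) f r.+1 s.+1 *m Emx) r s =
  delta F s.+1 i.+1 * f r.+1 i + delta F s.+1 (2 * n - i).+1 * f r.+1 (2 * n - i)%N.
Proof.
rewrite !mxE; have [h|h] := boolP ((s == i :> nat) || (s == 2 * n - i :> nat)%N); last first.
  move: h; rewrite negb_or => /andP[/negPf h1 /negPf h2].
  rewrite /delta !eqSS h1 h2 !mul0r addr0 big1 // => k _.
  rewrite !mxE /Eentry eqSS; have [e|//] := eqVneq (s : nat) k.+1.
    by rewrite -e h1 h2 mulr0.
  by rewrite mulr0.
have hs : (s.-1 < 2 * n)%N by have := ltn_ord s; nlia.
have s0 : s.-1.+1 = s by case/orP: (h) => /eqP; nlia.
rewrite (bigD1 (Ordinal hs)) //= big1 => [|k hk]; last first.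
  rewrite !mxE /Eentry eqSS; suff -> : (s == k.+1 :> nat) = false by rewrite mulr0.
  by apply/negbTE; apply: contra hk => /eqP e; apply/eqP/val_inj; rewrite /= e.
rewrite !mxE /Eentry /= s0 eqxx h mulr1 addr0.
have {h} [h|h] : s = i :> nat \/ s = (2 * n - i)%N :> nat by case/orP: h => /eqP; [left|right].
  by rewrite h; dlt.
by rewrite h; dlt.
Qed.

(** The row indices i and 2n - i and the column indices i + 1 and 2n - i + 1 are
    disjoint since i <= n - 1. *)
Lemma Emx_sq : Emx *m Emx = 0.
Proof.
apply/matrixP => r s; rewrite Emx_mul /Eentry mxE.
have -> : (i.+1 == i) || (i.+1 == 2 * n - i)%N = false by nlia.
have -> : ((2 * n - i).+1 == i) || ((2 * n - i).+1 == 2 * n - i)%N = false by nlia.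
by rewrite !andbF !mulr0 addr0.
Qed.

Lemma UmxM a b : Umx a *m Umx b = Umx (a + b).
Proof.
rewrite /Umx mulmxDl mul1mx mulmxDr mulmx1 -scalemxAr -!scalemxAl Emx_sq !scaler0 addr0.
by rewrite scalerDl -addrA (addrC (b *: _)).
Qed.

Lemma Umx0 : Umx 0 = 1%:M.
Proof. by rewrite /Umx scale0r addr0. Qed.

Lemma unipE (x x' : point F n) z a b :
  (forall r s, (1 <= r <= 2 * n)%N -> (1 <= s <= 2 * n)%N ->
    Mentry x' z r s = unip x z i a b r s) ->
  Mmx x' z = Umx a *m Mmx x z *m Umx b.
Proof.
move=> H; rewrite /Umx mulmxDr mulmx1 -scalemxAr.
pose f r s := Mentry x z r s + a *
    (delta F r i * Mentry x z i.+1 s + delta F r (2 * n - i) * Mentry x z (2 * n - i).+1 s).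
have e : Umx a *m Mmx x z = \matrix_(r, s) f r.+1 s.+1.
  apply/matrixP => r s; rewrite /Umx mulmxDl mul1mx -scalemxAl.
  by rewrite [LHS]mxE [X in _ + X = _]mxE (Emx_mul (Mentry x z)) !mxE.
rewrite -/(Umx a) e; apply/matrixP => r s; rewrite [RHS]mxE [X in _ = _ + X]mxE (mul_Emx f) !mxE.
by rewrite H ?ltn_ord // /unip /coladd /f; ring.
Qed.

End Unipotent.

(** * The product of two matrices under a crystal operator *)

(** The index j such that eps_i and phi_i involve x_j and xbar_j only through
    their quotient, for i <= n - 2. *)
Definition pivot (i : nat) : nat := if i == 0%N then 2 else i.+1.

(** The condition that xi_j with parameter t, for j the pivot of i, is defined
    and nonzero at x; nothing is required for i = n - 1 and i = n, where xi does
    not occur. *)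
Definition xi_ok (F : fieldType) (n i : nat) (t : F) (x : point F n) : Prop :=
  (i <= n - 2)%N -> xc x (pivot i) + bc x (pivot i) != 0 /\ xc x (pivot i) + t * bc x (pivot i) != 0.

(** A set of inequalities under which all denominators in the formula for e_i^c
    on pairs are nonzero. *)
Definition e2_ok (F : fieldType) (n i : nat) (c : F) (xy : point F n * point F n) : Prop :=
  let: (x, y) := xy in
  let c1 := (c * phi i x + eps i y) / (phi i x + eps i y) in
  let c2 := (phi i x + eps i y) / (phi i x + c^-1 * eps i y) in
  [/\ Mdefined x /\ Mdefined y, phi i x + eps i y != 0, c * phi i x + eps i y != 0,
      xi_ok i c1 x & xi_ok i c2 y].

Definition Mdefined2 (F : fieldType) (n : nat) (xy : point F n * point F n) : Prop :=
  Mdefined xy.1 /\ Mdefined xy.2.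

Section Scalars.
Variables (F : fieldType) (n : nat).

Lemma e2_denominator_neq0 i (c : F) (x y : point F n) : c != 0 -> e2_ok i c (x, y) ->
  phi i x + c^-1 * eps i y != 0.
Proof.
move=> c0 [_ _ t0 _ _].
have -> : phi i x + c^-1 * eps i y = c^-1 * (c * phi i x + eps i y) by fld.
by rewrite mulf_neq0 ?invr_eq0.
Qed.

Lemma e2_scalars_neq0 i (c : F) (x y : point F n) : c != 0 -> e2_ok i c (x, y) ->
  (c * phi i x + eps i y) / (phi i x + eps i y) != 0 /\
  (phi i x + eps i y) / (phi i x + c^-1 * eps i y) != 0.
Proof.
move=> c0 ok; have d0 := e2_denominator_neq0 c0 ok; case: ok => [_ s0 t0 _ _].
by rewrite !mulf_neq0 ?invr_eq0.
Qed.

End Scalars.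

Section Product.
Variables (F : fieldType) (n : nat).
Hypothesis hn : (4 <= n)%N.
Variable (i : nat).
Hypothesis hi : (1 <= i <= n.-1)%N.
Implicit Types (x y : point F n) (c t : F).

Lemma crystal_e_Mmx t x z : t != 0 -> Mdefined x -> Mdefined (crystal_e i t x) -> xi_ok i t x ->
  Mmx (crystal_e i t x) z =
  Umx n i ((t - 1) / eps i x) *m Mmx x z *m Umx n i ((t^-1 - 1) / phi i x).
Proof.
move=> t0 Mx Mx' ok; apply: unipE => // r s hr hs.
have [h|h] := leqP i (n - 2).
  have [s0 t1] := ok h; rewrite /pivot in s0 t1; case: ifP s0 t1 => [|_ s0 t1]; first by nlia.
  by apply: bulk_unip => //; nlia.
by apply: spin_unip => //; nlia.
Qed.

Lemma crystal_e_level t x : t != 0 -> xi_ok i t x ->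
  level (crystal_e i t x) = level x.
Proof.
move=> t0 ok; have [h|h] := leqP i (n - 2).
  have [s0 t1] := ok h; rewrite /pivot in s0 t1; case: ifP s0 t1 => [|_ s0 t1]; first by nlia.
  by apply: (level_e hn _ t0 s0 t1 erefl) => //; nlia.
by apply: (spin_level hn _ t0 erefl) => //; nlia.
Qed.

(** The functions eps_i and phi_i are the quotients of the subdiagonal entry (i
    + 1, i) of M(x, 0) by the two adjacent diagonal entries. *)
Lemma lowest_terms x t : Mdefined x -> xi_ok i t x ->
  [/\ Mentry x 0 i i != 0, Mentry x 0 i.+1 i.+1 != 0, Mentry x 0 i.+1 i != 0,
      eps i x = Mentry x 0 i.+1 i / Mentry x 0 i i &
      phi i x = Mentry x 0 i.+1 i / Mentry x 0 i.+1 i.+1].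
Proof.
move=> Mx ok.
have q0 : xprod x i != 0 by apply: xprod_neq0 => //; nlia.
have x0 : xc x i != 0 by case: Mx => + _ _; apply; nlia.
have b0 : bc x i != 0 by case: Mx => _ + _; apply; nlia.
have x1 : xc x i.+1 != 0 by case: Mx => + _ _; apply; nlia.
have eii : Mentry x 0 i i = xc x i / bc x i.
  have [e|e] : i = 1%N \/ i <> 1%N by nlia.
    by rewrite e col1E // col1_first.
  by rewrite left_diag ?mulr0 ?addr0; side.
have [h|h] := leqP i (n - 2).
  have b1 : bc x i.+1 != 0 by case: Mx => _ + _; apply; nlia.
  have [s0 t1] := ok h; rewrite /pivot in s0 t1; case: ifP s0 t1 => [|_ s0 t1]; first by nlia.
  have ejj : Mentry x 0 i.+1 i.+1 = xc x i.+1 / bc x i.+1.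
    by rewrite left_diag ?mulr0 ?addr0; side.
  have eji : Mentry x 0 i.+1 i = xc x i * (xc x i.+1 + bc x i.+1) / bc x i.+1.
    rewrite left_below ?col1_x ?xprodS; side.
    by fld.
  rewrite eii ejj eji /eps /phi ifF 1?ifT 1?ifF 1?ifT; side.
  split; rewrite ?mulf_neq0 ?invr_eq0 //; [fld|].
  by have s1 : bc x i.+1 + xc x i.+1 != 0 by [rewrite addrC]; fld.
have en : i = n.-1 by nlia.
have en1 : i.+1 = n by nlia.
have eji : Mentry x 0 i.+1 i = xc x i * xc x i.+1.
  have e : xprod x n.+1 = xprod x i * xc x i * xc x i.+1.
    by have := xprodS x (j := i.+1) ltac:(nlia); rewrite [in LHS]en1 => ->; rewrite xprodS; side.
  rewrite left_below; side.
  by rewrite [in Mcol1 _ _]en1 col1_n // e; fld.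
have ejj : Mentry x 0 i.+1 i.+1 = xc x i.+1.
  rewrite en1 col_n // -en; move: eji; rewrite en1 => ->; dlt.
  by fld.
rewrite eii ejj eji /eps /phi ifF 1?ifF 1?ifT 1?ifF 1?ifF 1?ifT; side.
rewrite -en en1; rewrite en1 in x1; split; rewrite ?mulf_neq0 ?invr_eq0 //; fld.
Qed.

Let hoi : (i.-1 < 2 * n)%N. Proof. by nlia. Qed.
Let hoj : (i < 2 * n)%N. Proof. by nlia. Qed.
Let oi := Ordinal hoi.
Let oj := Ordinal hoj.
Let oiE : oi.+1 = i. Proof. by rewrite /=; nlia. Qed.

Lemma product_entries x y : Mdefined x -> Mdefined y ->
  let P := Mmx x 0 *m Mmx y 0 in
  [/\ P oi oi = Mentry x 0 i i * Mentry y 0 i i,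
      P oj oj = Mentry x 0 i.+1 i.+1 * Mentry y 0 i.+1 i.+1 &
      P oj oi = Mentry x 0 i.+1 i * Mentry y 0 i i + Mentry x 0 i.+1 i.+1 * Mentry y 0 i.+1 i].
Proof.
move=> Mx My P; split; rewrite /P mxE.
- rewrite (bigD1 oi) //= big1 ?addr0 => [|k hk]; first by rewrite !mxE oiE.
  have ne : k.+1 <> i by move=> e; case/eqP: hk; apply/val_inj; rewrite /=; nlia.
  have kn := ltn_ord k.
  rewrite !mxE oiE; have [lt|ge] := ltnP k.+1 i.
    by rewrite [X in _ * X]upper_zero ?mulr0; side.
  by rewrite [X in X * _]upper_zero ?mul0r; side.
- rewrite (bigD1 oj) //= big1 ?addr0 => [|k hk]; first by rewrite !mxE.
  have ne : k <> i :> nat by move=> e; case/eqP: hk; apply/val_inj.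
  have kn := ltn_ord k.
  rewrite !mxE /=; have [lt|ge] := ltnP k i.
    by rewrite [X in _ * X]upper_zero ?mulr0; side.
  by rewrite [X in X * _]upper_zero ?mul0r; side.
rewrite (bigD1 oi) //= (bigD1 oj) /=; last by apply/eqP => /(congr1 val) /=; nlia.
rewrite big1 ?addr0 => [|k /andP[hk hk']]; first by rewrite !mxE oiE.
have ne : k <> i :> nat by move=> e; case/eqP: hk'; apply/val_inj.
have ne' : k.+1 <> i :> nat by move=> e; case/eqP: hk; apply/val_inj; rewrite /=; nlia.
have kn := ltn_ord k.
rewrite !mxE oiE /=; have [lt|ge] := ltnP k i.
  by rewrite [X in _ * X]upper_zero ?mulr0; side.
by rewrite [X in X * _]upper_zero ?mul0r; side.
Qed.

(** The inner factors U((1/c1 - 1) / phi_i(x)) and U((c2 - 1) / eps_i(y)) are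
    inverse to each other by the choice of c1 and c2.  The outer ones depend on
    the product matrix at z = 0 only, which is what makes the result useful for
    two different factorizations of the same matrix. *)
Lemma crystal_e2_Mmx c x y z : c != 0 -> e2_ok i c (x, y) ->
  let xy' := crystal_e2 i c (x, y) in Mdefined2 xy' ->
  let P := Mmx x 0 *m Mmx y 0 in
  Mmx xy'.1 z *m Mmx xy'.2 z =
  Umx n i ((c - 1) * P oi oi / P oj oi) *m (Mmx x z *m Mmx y z)
    *m Umx n i ((c^-1 - 1) * P oj oj / P oj oi).
Proof.
move=> c0 ok xy' [Mx' My'] P; have d0 := e2_denominator_neq0 c0 ok.
have [c10 c20] := e2_scalars_neq0 c0 ok; case: ok => [[Mx My] s0 t0 okx oky].
rewrite /xy' /= in Mx' My' *.
set c1 := (c * phi i x + eps i y) / _ in c10 okx Mx' *; set c2 := _ / (phi i x + c^-1 * eps i y) in c20 oky My' *.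
have [ax bx gx ex px] := lowest_terms Mx okx.
have [ay dy gy ey py] := lowest_terms My oky.
have [Pii Pjj Pji] := product_entries Mx My; rewrite -/P in Pii Pjj Pji.
rewrite !crystal_e_Mmx // !mulmxA -[_ *m Umx n i _ *m Umx n i _]mulmxA UmxM //.
have px0 : phi i x != 0 by rewrite px mulf_neq0 ?invr_eq0.
have ey0 : eps i y != 0 by rewrite ey mulf_neq0 ?invr_eq0.
have -> : (c1^-1 - 1) / phi i x + (c2 - 1) / eps i y = 0.
  have d1 : c * phi i x + eps i y != 0 by [].
  have d2 : phi i x * c + eps i y != 0 by rewrite mulrC.
  by rewrite /c1 /c2; fld.
have {Pii} -> : (c1 - 1) / eps i x = (c - 1) * P oi oi / P oj oi.
  rewrite /c1 Pii Pji ex ey px.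
  move: s0 t0; rewrite ey px; move: (Mentry x 0 i i) (Mentry y 0 i i) (Mentry x 0 i.+1 i) (Mentry y 0 i.+1 i) (Mentry x 0 i.+1 i.+1) (Mentry y 0 i.+1 i.+1) ax ay gx gy bx dy => A A' G G' B B' ? ? ? ? ? ? s0 t0.
  have s1 : G * A' + B * G' != 0.
    have -> : G * A' + B * G' = (G / B + G' / A') * (B * A') by fld.
    by rewrite !mulf_neq0.
  have t1 : c * G * A' + B * G' != 0.
    have -> : c * G * A' + B * G' = (c * (G / B) + G' / A') * (B * A') by fld.
    by rewrite !mulf_neq0.
  by fld.
have {Pjj} -> : (c2^-1 - 1) / phi i y = (c^-1 - 1) * P oj oj / P oj oi.
  rewrite /c2 Pjj Pji py ey px.
  move: s0 t0; rewrite ey px; move: (Mentry x 0 i i) (Mentry y 0 i i) (Mentry x 0 i.+1 i) (Mentry y 0 i.+1 i) (Mentry x 0 i.+1 i.+1) (Mentry y 0 i.+1 i.+1) ax ay gx gy bx dy => A A' G G' B B' ? ? ? ? ? ? s0 t0.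
  have s1 : G * A' + B * G' != 0.
    have -> : G * A' + B * G' = (G / B + G' / A') * (B * A') by fld.
    by rewrite !mulf_neq0.
  have t1 : c * G * A' + B * G' != 0.
    have -> : c * G * A' + B * G' = (c * (G / B) + G' / A') * (B * A') by fld.
    by rewrite !mulf_neq0.
  have t2 : G * (c * A') + G' * B != 0 by rewrite mulrCA mulrA [G' * B]mulrC.
  by fld.
by rewrite (@Umx0 F n i) mulmx1.
Qed.

(** Both pairs have the same product matrix, so it is multiplied by the same two
    unipotent matrices. *)
Lemma R_related_e2 c (u v : point F n * point F n) : c != 0 -> e2_ok i c u -> e2_ok i c v ->
  Mdefined2 (crystal_e2 i c u) -> Mdefined2 (crystal_e2 i c v) ->
  R_related u v -> R_related (crystal_e2 i c u) (crystal_e2 i c v).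
Proof.
case: u v => [x y] [x' y'] c0 ok ok' Me Me' [Muv Muv' eqM [l1 l2] l3].
split => //.
- by move=> z; rewrite (crystal_e2_Mmx z c0 ok Me) (crystal_e2_Mmx z c0 ok' Me') !eqM.
- have [a1 a2] := e2_scalars_neq0 c0 ok; have [a1' a2'] := e2_scalars_neq0 c0 ok'.
  case: ok ok' => [_ _ _ o1 o2] [_ _ _ o1' o2'].
  by rewrite !crystal_e_level.
have [a1 a2] := e2_scalars_neq0 c0 ok; case: ok => [_ _ _ o1 o2].
by rewrite !crystal_e_level.
Qed.

End Product.

(** * The Dynkin diagram symmetry exchanging n - 1 and n *)

Definition swp (p q k : nat) : nat := if k == p then q else if k == q then p else k.

(** The diagonal weights z at 1 and 1/z at 2n that accompany the exchange of
    these two indices. *)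
Definition wgt (F : fieldType) (n : nat) (z : F) (k : nat) : F :=
  if k == 1%N then z else if k == (2 * n)%N then z^-1 else 1.

Definition flip1 (F : fieldType) (n : nat) (x : point F n) : point F n :=
  mkpoint n (fun k => if k == 1%N then bc x 1 else xc x k)
            (fun k => if k == 1%N then xc x 1 else bc x k).

Definition flipn (F : fieldType) (n : nat) (x : point F n) : point F n :=
  mkpoint n (fun k => if k == n then (xc x n)^-1
                      else if k == n.-1 then xc x n.-1 * xc x n else xc x k)
            (fun k => if k == n.-1 then bc x n.-1 * xc x n else bc x k).

Section Conjugation.
Variables (F : fieldType) (n p q : nat) (w : nat -> F).
Hypotheses (hp : (1 <= p <= 2 * n)%N) (hq : (1 <= q <= 2 * n)%N) (w0 : forall k, w k != 0).

Let conj (f g : nat -> nat -> F) := forall r s, (1 <= r <= 2 * n)%N -> (1 <= s <= 2 * n)%N ->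
  g r s = w r * f (swp p q r) (swp p q s) / w s.

Local Notation mx f := (\matrix_(r < 2 * n, s < 2 * n) f r.+1 s.+1 : 'M[F]_(2 * n)).

(** Conjugation by a weighted transposition of the indices is compatible with
    products, as the weights of the summation index cancel. *)
Lemma swp_mul (f1 f2 g1 g2 : nat -> nat -> F) (r s : 'I_(2 * n)) :
  conj f1 g1 -> conj f2 g2 ->
  (mx g1 *m mx g2 : 'M[F]_(2 * n)) r s =
  w r.+1 / w s.+1 * \sum_(k < 2 * n) f1 (swp p q r.+1) k.+1 * f2 k.+1 (swp p q s.+1).
Proof.
move=> c1 c2; rewrite mxE.
have hp' : (p.-1 < 2 * n)%N by lia.
have hq' : (q.-1 < 2 * n)%N by lia.
(* The transposition as a permutation of the matrix indices, which start from 0.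
   *)
pose t := tperm (Ordinal hp') (Ordinal hq').
have tE (k : 'I_(2 * n)) : (t k).+1 = swp p q k.+1.
  have ordE j (hj : (j.-1 < 2 * n)%N) : (1 <= j)%N -> (k.+1 == j) = (k == Ordinal hj).
    by move=> j1; rewrite -val_eqE /=; lia.
  rewrite /swp (ordE _ hp') ?(ordE _ hq'); try lia.
  case: eqP => [->|/eqP k1]; first by rewrite tpermL /=; lia.
  case: eqP => [->|/eqP k2]; first by rewrite tpermR /=; lia.
  by rewrite tpermD // eq_sym.
rewrite (reindex_inj (@perm_inj _ t)) /= mulr_sumr; apply: eq_bigr => k _.
have inv : swp p q (t k).+1 = k.+1 by rewrite -tE tpermK.
rewrite !mxE c1 ?c2 ?ltn_ord // inv; field.
by rewrite !w0.
Qed.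

Lemma swp_mul_eq (f1 f2 g1 g2 f1' f2' g1' g2' : nat -> nat -> F) :
  conj f1 g1 -> conj f2 g2 -> conj f1' g1' -> conj f2' g2' ->
  mx f1 *m mx f2 =
    mx f1' *m mx f2' ->
  mx g1 *m mx g2 =
    mx g1' *m mx g2'.
Proof.
move=> c1 c2 c1' c2' e; apply/matrixP => r s.
rewrite (swp_mul _ _ c1 c2) (swp_mul _ _ c1' c2'); congr (_ * _).
have swp_ord (k : 'I_(2 * n)) : (0 < swp p q k.+1 <= 2 * n)%N.
  by have := ltn_ord k; rewrite /swp; case: ifP => // _; case: ifP => //; lia.
have hr : ((swp p q r.+1).-1 < 2 * n)%N by have := swp_ord r; lia.
have hs : ((swp p q s.+1).-1 < 2 * n)%N by have := swp_ord s; lia.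
have /matrixP /(_ (Ordinal hr) (Ordinal hs)) := e; rewrite !mxE.
under eq_bigr do rewrite !mxE /=.
under [in X in _ = X -> _]eq_bigr do rewrite !mxE /=.
by rewrite !prednK; [| have := swp_ord s; lia | have := swp_ord r; lia].
Qed.

End Conjugation.

Section FlipSpin.
Variables (F : fieldType) (n : nat).
Hypothesis hn : (4 <= n)%N.
Variables (x : point F n) (z : F).
Hypothesis Mx : Mdefined x.
Let x' := flipn x.
Let xn0 : xc x n != 0. Proof. by case: Mx => + _ _; apply; nlia. Qed.
Let xm0 : xc x n.-1 != 0. Proof. by case: Mx => + _ _; apply; nlia. Qed.
Let bm0 : bc x n.-1 != 0. Proof. by case: Mx => _ + _; apply; nlia. Qed.

Lemma flipn_xc k : (1 <= k <= n - 2)%N -> xc x' k = xc x k.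
Proof. by move=> hk; rewrite xc_mkpoint; side; rewrite !ifF; side. Qed.

Lemma flipn_bc k : (1 <= k <= n - 2)%N -> bc x' k = bc x k.
Proof. by move=> hk; rewrite bc_mkpoint; side; rewrite !ifF; side. Qed.

Lemma flipn_x_pred : xc x' n.-1 = xc x n.-1 * xc x n.
Proof. by rewrite xc_mkpoint; side; rewrite ifF ?eqxx; side. Qed.

Lemma flipn_x_n : xc x' n = (xc x n)^-1.
Proof. by rewrite xc_mkpoint; side; rewrite eqxx. Qed.

Lemma flipn_b_pred : bc x' n.-1 = bc x n.-1 * xc x n.
Proof. by rewrite bc_mkpoint; side; rewrite eqxx. Qed.

Lemma flipn_Xbar k : (1 <= k <= n.-1)%N -> Xbar x' k = Xbar x k.
Proof.
move=> hk; rewrite /Xbar; have [->|h] : k = n.-1 \/ (k <= n - 2)%N by nlia.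
  by rewrite flipn_x_pred flipn_b_pred; fld.
by rewrite flipn_xc ?flipn_bc; side.
Qed.

Lemma flipn_ratio k : (1 <= k <= n.-1)%N -> bc x' k / xc x' k = bc x k / xc x k.
Proof. by move=> hk; have := flipn_Xbar hk; rewrite /Xbar => /addrI. Qed.

Lemma flipn_Mdefined : Mdefined x'.
Proof.
case: (Mx) => h1 h2 h3; split=> k hk.
- have [->|[->|h]] : k = n \/ k = n.-1 \/ (k <= n - 2)%N by nlia.
  + by rewrite flipn_x_n invr_eq0.
  + by rewrite flipn_x_pred mulf_neq0.
  by rewrite flipn_xc ?h1; side.
- have [->|h] : k = n.-1 \/ (k <= n - 2)%N by nlia.
    by rewrite flipn_b_pred mulf_neq0.
  by rewrite flipn_bc ?h2; side.
by rewrite flipn_Xbar ?h3; side.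
Qed.

Lemma flipn_xprod j : (j <= n.-1)%N -> xprod x' j = xprod x j.
Proof. by move=> hj; apply: eq_big_nat => k hk; apply: flipn_xc; nlia. Qed.

Lemma flipn_bprod j : (j <= n - 2)%N -> bprod x' j = bprod x j.
Proof. by move=> hj; apply: eq_big_nat => k hk; apply: flipn_bc; nlia. Qed.

Lemma flipn_xprod_n : xprod x' n = xprod x n.+1.
Proof. by rewrite xprodS ?xprod_n ?flipn_xprod ?flipn_x_pred ?mulrA; side. Qed.

Lemma flipn_xprod_n1 : xprod x' n.+1 = xprod x n.
Proof. by rewrite xprodS ?flipn_xprod_n ?flipn_x_n ?xprodS; side; fld. Qed.

Lemma flipn_level : level x' = level x.
Proof.
rewrite !level_split // flipn_xprod ?flipn_bprod; side.
by rewrite flipn_x_pred flipn_x_n flipn_b_pred; fld.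
Qed.

#[local] Opaque crystal_e xc bc xi eps phi level Mentry Mcol1 xprod bprod flipn mkpoint.

Variable r : nat.
Hypothesis hr : (1 <= r <= 2 * n)%N.
Let sw := swp n n.+1.

Let swr : (r = n /\ sw r = n.+1) \/ (r = n.+1 /\ sw r = n) \/ (r <> n /\ r <> n.+1 /\ sw r = r).
Proof. by rewrite /sw /swp; case: eqP => ?; [left|case: eqP => ?; right; [left|right]]. Qed.

Let dsw s : s <> n -> s <> n.+1 -> delta F (sw r) s = delta F r s.
Proof. by move: swr => [[-> ->]|[[-> ->]|[_ [_ ->]]]] // h1 h2; dlt. Qed.

Let dsw_n : delta F (sw r) n = delta F r n.+1.
Proof. by move: swr => [[-> ->]|[[-> ->]|[h1 [h2 ->]]]] //; dlt. Qed.

Let dsw_n1 : delta F (sw r) n.+1 = delta F r n.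
Proof. by move: swr => [[-> ->]|[[-> ->]|[h1 [h2 ->]]]] //; dlt. Qed.

Lemma flipn_col1 : Mcol1 x' r = Mcol1 x (sw r).
Proof.
move: swr => [[-> ->]|[[-> ->]|[h1 [h2 ->]]]].
- by rewrite col1_n // col1_n1 // flipn_xprod_n1.
- by rewrite col1_n // col1_n1 // flipn_xprod_n.
have [h|[h|h]] : r = 1%N \/ (2 <= r <= n.-1)%N \/ (n.+2 <= r)%N by nlia.
- by rewrite h !col1_first flipn_xc ?flipn_bc; side.
- rewrite !col1_x ?flipn_xprod; side; congr (_ * (1 + _)).
  by have := flipn_ratio (k := r) ltac:(nlia) => /(congr1 GRing.inv); rewrite !invf_div.
have -> : r = (2 * n - (2 * n - r))%N by nlia.
by rewrite !col1_b ?flipn_bprod ?flipn_level; side.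
Qed.

Local Notation Q s := (Mentry x' z r s = Mentry x z (sw r) (sw s)).
Let sw_same s : s <> n -> s <> n.+1 -> sw s = s.
Proof. by rewrite /sw /swp => /eqP/negPf -> /eqP/negPf ->. Qed.

Let low s : (1 <= s <= n.-1)%N -> Mentry x' z r s = Mentry x z (sw r) s.
Proof.
elim: s => [|[|s] IH] hs; [by []|by rewrite !col1E // flipn_col1|].
have hs' : (1 <= s.+1 <= n - 2)%N by nlia.
rewrite (col_left hn x' z r hs') (col_left hn x z _ hs').
by rewrite IH ?flipn_level ?flipn_xc ?flipn_bc ?dsw; side.
Qed.

Let right j : (j <= n - 2)%N -> Mentry x' z r (2 * n - j) = Mentry x z (sw r) (2 * n - j).
Proof.
elim: j => [|[|j] IH] hj.
- by rewrite subn0 !col_right0 // flipn_level flipn_ratio ?low ?dsw ?dsw; side.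
- by rewrite !col_right1 // flipn_level flipn_Xbar ?flipn_ratio ?flipn_bc ?low ?dsw ?dsw; side.
rewrite !col_right; side.
rewrite flipn_level !flipn_Xbar ?flipn_ratio ?flipn_bc ?dsw ?dsw; side.
by have -> : (2 * n + 1 - j.+2 = 2 * n - j.+1)%N by [nlia]; rewrite IH; side.
Qed.

(** Exchanging n and n + 1 exchanges the two columns that branch off from column
    n - 1; all other recursion steps involve the coordinates with index n - 1
    only through quotients that do not change. *)
Lemma flipn_conj s : (1 <= s <= 2 * n)%N -> Q s.
Proof.
move=> hs; have [h|[h|[h|h]]] : (s <= n.-1)%N \/ s = n \/ s = n.+1 \/ (n.+2 <= s)%N by nlia.
- by rewrite (@sw_same s) ?low; side.
- have -> : sw s = n.+1 by rewrite /sw /swp h eqxx.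
  rewrite h col_n // col_n1 // low ?flipn_level ?flipn_x_pred ?flipn_b_pred ?dsw_n ?dsw; side.
  by [].
- have -> : sw s = n by rewrite /sw /swp h ifF ?eqxx; side.
  rewrite h col_n1 // col_n // low ?flipn_level ?flipn_x_pred ?flipn_b_pred ?flipn_x_n ?dsw_n1 ?dsw; side.
  by fld.
have -> : s = (2 * n - (2 * n - s))%N by nlia.
by rewrite (@sw_same (2 * n - (2 * n - s))) ?right; side.
Qed.

End FlipSpin.

Lemma flipnK (F : fieldType) (n : nat) (hn : (4 <= n)%N) (x : point F n) :
  xc x n != 0 -> flipn (flipn x) = x.
Proof.
move=> x0; apply: point_ext => // k hk.
  rewrite [LHS]xc_mkpoint; side.
  have [->|[->|h]] : k = n \/ k = n.-1 \/ (k <= n - 2)%N by nlia.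
  + by rewrite eqxx flipn_x_n // invrK.
  + by rewrite ifF ?eqxx; side; rewrite flipn_x_pred // flipn_x_n //; fld.
  by rewrite !ifF ?flipn_xc; side.
rewrite [LHS]bc_mkpoint; side.
have [->|h] : k = n.-1 \/ (k <= n - 2)%N by nlia.
  by rewrite eqxx flipn_b_pred // flipn_x_n //; fld.
by rewrite !ifF ?flipn_bc; side.
Qed.

(** * The Dynkin diagram symmetry exchanging 0 and 1 *)

Section FlipOne.
Variables (F : fieldType) (n : nat).
Hypothesis hn : (4 <= n)%N.
Variables (x : point F n) (z : F).
Hypothesis Mx : Mdefined x.
Let x' := flip1 x.
Let x0 : xc x 1 != 0. Proof. by case: Mx => + _ _; apply; nlia. Qed.
Let b0 : bc x 1 != 0. Proof. by case: Mx => _ + _; apply; nlia. Qed.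

Lemma flip1_x1 : xc x' 1 = bc x 1.
Proof. by rewrite xc_mkpoint; side. Qed.

Lemma flip1_b1 : bc x' 1 = xc x 1.
Proof. by rewrite bc_mkpoint; side. Qed.

Lemma flip1_xc k : (2 <= k <= n)%N -> xc x' k = xc x k.
Proof. by move=> hk; rewrite xc_mkpoint; side; rewrite !ifF; side. Qed.

Lemma flip1_bc k : (2 <= k <= n.-1)%N -> bc x' k = bc x k.
Proof. by move=> hk; rewrite bc_mkpoint; side; rewrite !ifF; side. Qed.

Lemma flip1_Xbar k : (2 <= k <= n.-1)%N -> Xbar x' k = Xbar x k.
Proof. by move=> hk; rewrite /Xbar flip1_xc ?flip1_bc; side. Qed.

Lemma flip1_Mdefined : Mdefined x'.
Proof.
case: (Mx) => h1 h2 h3; split=> k hk.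
- have [->|h] : k = 1%N \/ (2 <= k <= n)%N by nlia.
    by rewrite flip1_x1.
  by rewrite flip1_xc ?h1; side.
- have [->|h] : k = 1%N \/ (2 <= k <= n.-1)%N by nlia.
    by rewrite flip1_b1.
  by rewrite flip1_bc ?h2; side.
by rewrite flip1_Xbar ?h3; side.
Qed.

Lemma flip1K : flip1 x' = x.
Proof.
apply: point_ext => // k hk.
  rewrite [LHS]xc_mkpoint; side.
  have [->|h] : k = 1%N \/ (2 <= k)%N by nlia.
    by rewrite eqxx flip1_b1.
  by rewrite !ifF ?flip1_xc; side.
rewrite [LHS]bc_mkpoint; side.
have [->|h] : k = 1%N \/ (2 <= k)%N by nlia.
  by rewrite eqxx flip1_x1.
by rewrite !ifF ?flip1_bc; side.
Qed.

Lemma flip1_xprod j : (2 <= j <= n.+1)%N -> xprod x' j = bc x 1 / xc x 1 * xprod x j.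
Proof.
elim: j => [|[|[|j]] IH] // hj.
  by rewrite /xprod !big_nat1 flip1_x1; fld.
by rewrite xprodS // IH ?flip1_xc ?[xprod x j.+3]xprodS ?mulrA; side.
Qed.

Lemma flip1_bprod j : (1 <= j <= n.-1)%N -> bprod x' j = xc x 1 / bc x 1 * bprod x j.
Proof.
elim: j => [|[|j] IH] // hj.
  by rewrite /bprod !big_nat1 flip1_b1; fld.
by rewrite bprodS IH ?flip1_bc ?[bprod x j.+2]bprodS ?mulrA; side.
Qed.

Lemma flip1_level : level x' = level x.
Proof. by rewrite !levelE // flip1_xprod ?flip1_bprod; side; fld. Qed.

#[local] Opaque crystal_e xc bc xi eps phi level Mentry Mcol1 xprod bprod flip1 mkpoint.

Lemma flip1_col1 r : (2 <= r <= 2 * n - 1)%N -> Mcol1 x' r = bc x 1 / xc x 1 * Mcol1 x r.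
Proof.
move=> hr; have [h|[h|[h|h]]] : (r <= n.-1)%N \/ r = n \/ r = n.+1 \/ (n.+2 <= r)%N by nlia.
- by rewrite !col1_x ?flip1_xprod ?flip1_xc ?flip1_bc ?mulrA; side.
- by rewrite h !col1_n // flip1_xprod; side.
- by rewrite h !col1_n1 // flip1_xprod; side.
have -> : r = (2 * n - (2 * n - r))%N by nlia.
have v0 : bprod x (2 * n - r) != 0 by apply: bprod_neq0; side.
by rewrite !col1_b ?flip1_bprod ?flip1_level; side; fld.
Qed.

Lemma col1_last (y : point F n) : Mcol1 y (2 * n) = level y.
Proof.
have := @col1_b F n hn y 0 ltac:(nlia); rewrite subn0 => ->.
by rewrite (_ : bprod y 0 = 1) ?divr1 //; apply: big_geq.
Qed.

Hypothesis z0 : z != 0.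
Variable r : nat.
Hypothesis hr : (1 <= r <= 2 * n)%N.
Let sw := swp 1 (2 * n).
Local Notation wt := (wgt n z).

Let swr : (r = 1%N /\ sw r = (2 * n)%N /\ wt r = z) \/
  (r = (2 * n)%N /\ sw r = 1%N /\ wt r = z^-1) \/
  (2 <= r <= 2 * n - 1)%N /\ sw r = r /\ wt r = 1.
Proof.
have [h|[h|h]] : r = 1%N \/ r = (2 * n)%N \/ (2 <= r <= 2 * n - 1)%N by nlia.
- by left; rewrite /sw /swp /wgt h eqxx.
- by right; left; rewrite /sw /swp /wgt h eqxx !ifF; side.
by right; right; rewrite /sw /swp /wgt !ifF; side; split; [nlia|split].
Qed.

Let dsw s : (2 <= s <= 2 * n - 1)%N -> delta F (sw r) s = delta F r s.
Proof. by move: swr => [[-> [-> _]]|[[-> [-> _]]|[h1 [-> _]]]] // h2; dlt. Qed.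

Let dwt s : (2 <= s <= 2 * n - 1)%N -> wt r * delta F r s = delta F r s.
Proof. by move: swr => [[-> [_ ->]]|[[-> [_ ->]]|[h1 [_ ->]]]] h2; dlt. Qed.

Let col2 : Mentry x' z r 2 = wt r * Mentry x z (sw r) 2.
Proof.
have h1 : (1 <= 1 <= n - 2)%N by nlia.
rewrite (col_left hn x' z r h1) (col_left hn x z _ h1) !col1E // flip1_level flip1_x1 flip1_b1.
move: swr => [[-> [-> ->]]|[[-> [-> ->]]|[h2 [-> ->]]]].
- by rewrite !col1_first col1_last flip1_x1 flip1_b1; dlt; fld.
- by rewrite !col1_first col1_last flip1_level; dlt; fld.
by rewrite flip1_col1; side; dlt; fld.
Qed.

Let low s : (2 <= s <= n.-1)%N -> Mentry x' z r s = wt r * Mentry x z (sw r) s.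
Proof.
elim: s => [|[|[|s]] IH] hs; [by []|by []|exact: col2|].
have hs' : (1 <= s.+2 <= n - 2)%N by nlia.
rewrite (col_left hn x' z r hs') (col_left hn x z _ hs') IH ?flip1_level ?flip1_xc ?flip1_bc ?dsw; side.
have d1 := dwt (s := s.+2) ltac:(nlia); have d2 := dwt (s := s.+3) ltac:(nlia).
by rewrite -{1}d1 -{1}d2; ring.
Qed.

Let mid_n : Mentry x' z r n = wt r * Mentry x z (sw r) n.
Proof.
rewrite !col_n // low ?flip1_level ?flip1_xc ?flip1_bc ?dsw; side.
rewrite ?dsw; side.
have d1 := dwt (s := n.-1) ltac:(nlia); have d2 := dwt (s := n.+1) ltac:(nlia).
by rewrite -{1}d1 -{1}d2; ring.
Qed.

Let mid_n1 : Mentry x' z r n.+1 = wt r * Mentry x z (sw r) n.+1.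
Proof.
rewrite !col_n1 // low ?flip1_level ?(flip1_xc (k := n)) ?(flip1_xc (k := n.-1)) ?flip1_bc ?dsw; side.
rewrite ?dsw; side.
have d1 := dwt (s := n.-1) ltac:(nlia); have d2 := dwt (s := n) ltac:(nlia).
by rewrite -{1}d1 -{1}d2; ring.
Qed.

Let right0 : Mentry x' z r (2 * n) = wt r * Mentry x z (sw r) 1 * z.
Proof.
rewrite !col_right0 // !col1E // flip1_level flip1_x1 flip1_b1.
move: swr => [[-> [-> ->]]|[[-> [-> ->]]|[h1 [-> ->]]]].
- by rewrite !col1_first col1_last flip1_x1 flip1_b1; dlt; fld.
- by rewrite !col1_first col1_last flip1_level; dlt; fld.
by rewrite flip1_col1; side; dlt; fld.
Qed.

Let right0' : Mentry x' z r 1 = wt r * Mentry x z (sw r) (2 * n) / z.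
Proof.
rewrite !col_right0 // !col1E //.
move: swr => [[-> [-> ->]]|[[-> [-> ->]]|[h1 [-> ->]]]].
- by rewrite !col1_first col1_last flip1_x1 flip1_b1; dlt; fld.
- by rewrite !col1_first col1_last flip1_level; dlt; fld.
by rewrite flip1_col1; side; dlt; fld.
Qed.

Let right1 : Mentry x' z r (2 * n - 1) = wt r * Mentry x z (sw r) (2 * n - 1).
Proof.
rewrite !col_right1 // !col1E // flip1_level flip1_Xbar ?flip1_b1 ?flip1_xc ?flip1_bc; side.
move: (Xbar x 2) (bc x 2 / xc x 2) => V W.
move: swr => [[-> [-> ->]]|[[-> [-> ->]]|[h1 [-> ->]]]].
- by rewrite !col1_first col1_last flip1_x1 flip1_b1; dlt; fld.
- by rewrite !col1_first col1_last flip1_level; dlt; fld.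
by rewrite flip1_col1; side; dlt; fld.
Qed.

Let right j : (1 <= j <= n - 2)%N -> Mentry x' z r (2 * n - j) = wt r * Mentry x z (sw r) (2 * n - j).
Proof.
elim: j => [|[|j] IH] hj; [by []|exact: right1|].
rewrite !col_right; side.
rewrite flip1_level !flip1_Xbar ?flip1_bc ?flip1_xc ?dsw ?dsw; side.
have e : (2 * n + 1 - j.+2 = 2 * n - j.+1)%N by nlia.
rewrite e IH; side.
have d1 := dwt (s := (2 * n - j.+1)%N) ltac:(nlia); have d2 := dwt (s := (2 * n - j.+2)%N) ltac:(nlia).
by rewrite -{1}d1 -{1}d2; ring.
Qed.

(** Exchanging x_1 and xbar_1 exchanges the first column with the last one up to
    the factor z, because the relation between these columns is symmetric under
    this exchange; all recursion steps that do not start from column 1 are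
    unaffected. *)
Lemma flip1_conj s : (1 <= s <= 2 * n)%N ->
  Mentry x' z r s = wt r * Mentry x z (sw r) (sw s) / wt s.
Proof.
move=> hs; have sws : (2 <= s <= 2 * n - 1)%N -> sw s = s /\ wt s = 1.
  by move=> h; rewrite /sw /swp /wgt !ifF; side.
have [h|[h|h]] : s = 1%N \/ s = (2 * n)%N \/ (2 <= s <= 2 * n - 1)%N by nlia.
- by rewrite h /sw /swp [in wt 1]/wgt eqxx right0'.
- have -> : sw s = 1%N by rewrite /sw /swp h ifF ?eqxx; side.
  have -> : wt s = z^-1 by rewrite /wgt h ifF ?eqxx; side.
  by rewrite h right0 invrK.
have [-> ->] := sws h; rewrite divr1.
have [h1|[h1|[h1|h1]]] : (s <= n.-1)%N \/ s = n \/ s = n.+1 \/ (n.+2 <= s)%N by nlia.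
- by rewrite low; side.
- by rewrite h1 mid_n.
- by rewrite h1 mid_n1.
have -> : s = (2 * n - (2 * n - s))%N by nlia.
by rewrite right; side.
Qed.

End FlipOne.

Section PolyInZ.
Variables (F : fieldType) (n : nat) (x : point F n).

(** The matrix identities proved by conjugation with the weights z and 1/z hold
    for z <> 0 only; that both sides are polynomials in z extends them to z = 0.
    *)
Definition polyfun (f : F -> F) : Prop := exists p : {poly F}, forall z, f z = p.[z].

Lemma polyfun_const a : polyfun (fun _ => a).
Proof. by exists a%:P => z; rewrite hornerC. Qed.

Lemma polyfun_id : polyfun (fun z => z).
Proof. by exists 'X => z; rewrite hornerX. Qed.

Lemma polyfunD f g : polyfun f -> polyfun g -> polyfun (fun z => f z + g z).
Proof. by move=> [p Hp] [q Hq]; exists (p + q) => z; rewrite hornerD Hp Hq. Qed.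

Lemma polyfunM f g : polyfun f -> polyfun g -> polyfun (fun z => f z * g z).
Proof. by move=> [p Hp] [q Hq]; exists (p * q) => z; rewrite hornerM Hp Hq. Qed.

Lemma polyfun_sum (I : Type) (s : seq I) (f : I -> F -> F) :
  (forall i, polyfun (f i)) -> polyfun (fun z => \sum_(i <- s) f i z).
Proof.
move=> Hf; elim: s => [|i s [p Hp]]; first by exists 0 => z; rewrite big_nil horner0.
by have [q Hq] := Hf i; exists (q + p) => z; rewrite big_cons hornerD Hp Hq.
Qed.

Lemma polyfun_subr1 a : polyfun (fun z => a * z - 1).
Proof. exact: (polyfunD (polyfunM (polyfun_const _) polyfun_id) (polyfun_const (- 1))). Qed.

Lemma polyfun_1subr a : polyfun (fun z => 1 - a * z).
Proof.
have [p Hp] := polyfun_subr1 a; exists (- p) => z.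
by rewrite hornerN -Hp opprB.
Qed.

Lemma polyfun_Mentry r s : polyfun (fun z => Mentry x z r s).
Proof.
have left j : polyfun (fun z => Mleft x z r j).
  elim: j => [|[|j] IH]; [exact: polyfun_const|exact: polyfun_const|].
  apply: polyfunD; first exact: (polyfunM IH (polyfun_const _)).
  exact: (polyfunM (polyfun_subr1 _) (polyfun_const _)).
have right j : polyfun (fun z => Mright x z r j).
  elim: j => [|[|j] IH].
  - apply: polyfunD; first apply: polyfunD.
    + exact: (polyfunM (polyfunM polyfun_id (polyfun_const _)) (polyfun_const _)).
    + exact: (polyfunM (polyfun_const _) (polyfun_1subr _)).
    exact: (polyfunM (polyfunM (polyfun_const _) polyfun_id) (polyfun_subr1 _)).
  - apply: polyfunD; last exact: (polyfunM (polyfun_1subr _) (polyfun_const _)).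
    exact: (polyfunM (polyfunM (polyfunM polyfun_id (polyfun_const _)) (polyfun_const _)) (polyfun_const _)).
  apply: polyfunD; last exact: (polyfunM (polyfun_1subr _) (polyfun_const _)).
  exact: (polyfunM (polyfun_const _) IH).
rewrite /Mentry; case: (s <= n.-1)%N; first exact: left.
case: (s == n); last (case: (s == n.+1); last exact: right).
  apply: polyfunD; first exact: (polyfunM (left _) (polyfun_const _)).
  exact: (polyfunM (polyfun_subr1 _) (polyfun_const _)).
apply: polyfunD; first exact: (polyfunM (left _) (polyfun_const _)).
exact: (polyfunM (polyfun_subr1 _) (polyfun_const _)).
Qed.

End PolyInZ.

Lemma polyfun_ext0 (F : numFieldType) (f g : F -> F) : polyfun f -> polyfun g ->
  (forall z, z != 0 -> f z = g z) -> f 0 = g 0.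
Proof.
move=> [p Hp] [q Hq] H; rewrite Hp Hq; suff -> : p = q by [].
apply/eqP; rewrite -subr_eq0; apply/negPn/negP => d0.
(* If p <> q, then more nonzero elements than the degree of p - q are roots of p
   - q. *)
pose s : seq F := [seq i.+1%:R | i <- iota 0 (size (p - q))].
have := max_poly_roots d0 (rs := s).
rewrite size_map size_iota ltnn => K; have : false; last by [].
apply: K.
  apply/allP => _ /mapP[i _ ->]; rewrite /root hornerD hornerN -Hp -Hq H ?subrr //.
  by rewrite pnatr_eq0.
by rewrite map_inj_uniq ?iota_uniq // => i j /eqP; rewrite eqr_nat eqSS => /eqP.
Qed.

(** * Crystal operators preserve the defining relation of the tropical R *)

Definition map_pair (F : fieldType) (n : nat) (f : point F n -> point F n)
    (xy : point F n * point F n) := (f xy.1, f xy.2).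

Lemma R_related_flipn (F : fieldType) (n : nat) (hn : (4 <= n)%N) (u v : point F n * point F n) :
  R_related u v -> R_related (map_pair (@flipn F n) u) (map_pair (@flipn F n) v).
Proof.
case: u v => [x y] [x' y'] [[Mx My] [Mx' My'] eqM [l1 l2] l3].
split; rewrite /= ?flipn_level //; try by split; apply: flipn_Mdefined.
move=> z; have cj (p : point F n) : Mdefined p -> forall r s, (1 <= r <= 2 * n)%N -> (1 <= s <= 2 * n)%N ->
    Mentry (flipn p) z r s = 1 * Mentry p z (swp n n.+1 r) (swp n n.+1 s) / 1.
  by move=> Mp r s hr hs; rewrite flipn_conj // mul1r divr1.
have hp : (1 <= n <= 2 * n)%N by nlia.
have hq : (1 <= n.+1 <= 2 * n)%N by nlia.
exact: (swp_mul_eq hp hq (w := fun=> 1) (fun=> oner_neq0 _) (cj _ Mx) (cj _ My) (cj _ Mx') (cj _ My') (eqM z)).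
Qed.

(** For z <> 0 the symmetry conjugates both products by the same matrix.  The
    case z = 0 follows as the entries are polynomials in z. *)
Lemma R_related_flip1 (F : numFieldType) (n : nat) (hn : (4 <= n)%N) (u v : point F n * point F n) :
  R_related u v -> R_related (map_pair (@flip1 F n) u) (map_pair (@flip1 F n) v).
Proof.
case: u v => [x y] [x' y'] [[Mx My] [Mx' My'] eqM [l1 l2] l3].
split; rewrite /= ?flip1_level //; try by split; apply: flip1_Mdefined.
have main z : z != 0 -> Mmx (flip1 x) z *m Mmx (flip1 y) z = Mmx (flip1 x') z *m Mmx (flip1 y') z.
  move=> z0; have cj (p : point F n) : Mdefined p -> forall r s, (1 <= r <= 2 * n)%N -> (1 <= s <= 2 * n)%N ->
      Mentry (flip1 p) z r s = wgt n z r * Mentry p z (swp 1 (2 * n) r) (swp 1 (2 * n) s) / wgt n z s.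
    by move=> Mp r s hr hs; apply: flip1_conj.
  have hp : (1 <= 1 <= 2 * n)%N by nlia.
  have hq : (1 <= 2 * n <= 2 * n)%N by nlia.
  have w0 k : wgt n z k != 0.
    by rewrite /wgt; case: ifP => // _; case: ifP => _; rewrite ?invr_eq0 ?oner_neq0.
  exact: (swp_mul_eq hp hq w0 (cj _ Mx) (cj _ My) (cj _ Mx') (cj _ My') (eqM z)).
move=> z; have [->|] := eqVneq z 0; last exact: main.
apply/matrixP => r s.
have pf (p q : point F n) : polyfun (fun z => (Mmx p z *m Mmx q z) r s).
  have [P HP] : polyfun (fun z => \sum_(k < 2 * n) Mentry p z r.+1 k.+1 * Mentry q z k.+1 s.+1).
    by apply: polyfun_sum => k; apply: polyfunM; apply: polyfun_Mentry.
  by exists P => t; rewrite -HP mxE; apply: eq_bigr => k _; rewrite !mxE.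
by apply: (polyfun_ext0 (pf _ _) (pf _ _)) => t /main ->.
Qed.

Section Reduce.
Variables (F : fieldType) (n : nat).
Hypothesis hn : (4 <= n)%N.
Implicit Types (x y : point F n) (c : F).

Lemma eps_flip1 x : eps 1 (flip1 x) = eps 0 x.
Proof. by rewrite /eps /= ifT ?flip1_b1 ?flip1_xc ?flip1_bc; side. Qed.

Lemma phi_flip1 x : phi 1 (flip1 x) = phi 0 x.
Proof. by rewrite /phi /= ifT ?flip1_x1 ?flip1_xc ?flip1_bc; side. Qed.

Lemma eps_flipn x : xc x n != 0 -> eps n.-1 (flipn x) = eps n x.
Proof.
move=> x0; rewrite /eps ifF 1?ifF 1?ifT 1?ifF 1?ifF 1?ifF; side.
by rewrite flipn_x_n ?flipn_b_pred //; fld.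
Qed.

Lemma phi_flipn x : phi n.-1 (flipn x) = phi n x.
Proof.
rewrite /phi ifF 1?ifF 1?ifT 1?ifF 1?ifF 1?ifF; side.
by rewrite flipn_x_pred.
Qed.

(** The symmetry carries the node 1 to the node 0; xi_2 is invariant under it.
    *)
Lemma crystal_e_flip1 c x : flip1 (crystal_e 1 c (flip1 x)) = crystal_e 0 c x.
Proof.
have xiE : xi c (flip1 x) 2 = xi c x 2 by rewrite /xi flip1_xc ?flip1_bc; side.
have h1 : (1 <= n - 2)%N by nlia.
rewrite /crystal_e /= h1 {h1} xiE.
apply: point_ext => // k hk.
  rewrite ![in RHS]xc_mkpoint; side.
  have [->|h] : k = 1%N \/ (2 <= k)%N by nlia.
    by rewrite flip1_x1 // bc_mkpoint /= ?flip1_b1; side.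
  have [->|h'] : k = 2 \/ (3 <= k)%N by nlia.
    by rewrite flip1_xc ?xc_mkpoint /= ?flip1_xc; side.
  by rewrite flip1_xc ?xc_mkpoint; side; rewrite !ifF ?flip1_xc; side.
rewrite ![in RHS]bc_mkpoint; side.
have [->|h] : k = 1%N \/ (2 <= k)%N by nlia.
  by rewrite flip1_b1 // xc_mkpoint /= ?flip1_x1; side.
have [->|h'] : k = 2 \/ (3 <= k)%N by nlia.
  by rewrite flip1_bc ?bc_mkpoint /= ?flip1_bc; side.
by rewrite flip1_bc ?bc_mkpoint; side; rewrite !ifF ?flip1_bc; side.
Qed.

(** The symmetry carries the node n - 1 to the node n. *)
Lemma crystal_e_flipn c x : c != 0 -> xc x n != 0 ->
  flipn (crystal_e n.-1 c (flipn x)) = crystal_e n c x.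
Proof.
move=> c0 x0; rewrite /crystal_e ifF 1?ifF 1?ifT 1?ifF 1?ifF 1?ifF; side.
have e1 : (n == n.-1) = false by nlia.
have e2 : (n.-1 == n) = false by nlia.
apply: point_ext => // k hk.
  rewrite ![in RHS]xc_mkpoint; side.
  have [->|[->|h]] : k = n \/ k = n.-1 \/ (k <= n - 2)%N by nlia.
  - rewrite flipn_x_n // xc_mkpoint; side; rewrite e1 eqxx.
    by rewrite flipn_x_n // invfM !invrK.
  - rewrite flipn_x_pred // !xc_mkpoint; side; rewrite e1 e2 !eqxx.
    by fld.
  have k1 : (k == n) = false by nlia.
  have k2 : (k == n.-1) = false by nlia.
  by rewrite flipn_xc ?xc_mkpoint; side; rewrite ?k1 ?k2 ?flipn_xc; side.
rewrite ![in RHS]bc_mkpoint; side.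
have [->|h] : k = n.-1 \/ (k <= n - 2)%N by nlia.
  rewrite flipn_b_pred // bc_mkpoint ?xc_mkpoint; side; rewrite ?e1 ?eqxx.
  by rewrite flipn_b_pred //; fld.
have k2 : (k == n.-1) = false by nlia.
by rewrite flipn_bc ?bc_mkpoint; side; rewrite ?k2 ?flipn_bc; side.
Qed.

Lemma crystal_e2_flip1 c (u : point F n * point F n) :
  map_pair (@flip1 F n) (crystal_e2 1 c (map_pair (@flip1 F n) u)) = crystal_e2 0 c u.
Proof.
by case: u => x y; rewrite /map_pair /= !eps_flip1 !phi_flip1 !crystal_e_flip1.
Qed.

Lemma crystal_e2_flipn c (u : point F n * point F n) : c != 0 -> e2_ok n c u ->
  map_pair (@flipn F n) (crystal_e2 n.-1 c (map_pair (@flipn F n) u)) = crystal_e2 n c u.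
Proof.
case: u => x y c0 ok; have [a1 a2] := e2_scalars_neq0 c0 ok.
have [[Mx My] _ _ _ _] := ok.
have x0 : xc x n != 0 by case: Mx => + _ _; apply; nlia.
have y0 : xc y n != 0 by case: My => + _ _; apply; nlia.
by rewrite /map_pair /= !eps_flipn ?phi_flipn ?crystal_e_flipn.
Qed.

Lemma e2_ok_flip1 c (u : point F n * point F n) :
  e2_ok 0 c u -> e2_ok 1 c (map_pair (@flip1 F n) u).
Proof.
case: u => x y [[Mx My] s0 t0 okx oky].
split; rewrite /= ?eps_flip1 ?phi_flip1 //.
- by split; apply: flip1_Mdefined.
- by move=> /= _; rewrite /pivot /= flip1_xc ?flip1_bc; side; apply: okx.
by move=> /= _; rewrite /pivot /= flip1_xc ?flip1_bc; side; apply: oky.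
Qed.

Lemma e2_ok_flipn c (u : point F n * point F n) :
  e2_ok n c u -> e2_ok n.-1 c (map_pair (@flipn F n) u).
Proof.
case: u => x y [[Mx My] s0 t0 okx oky].
have y0 : xc y n != 0 by case: My => + _ _; apply; nlia.
split; rewrite /= ?eps_flipn ?phi_flipn //.
- by split; apply: flipn_Mdefined.
- by move=> h; exfalso; nlia.
by move=> h; exfalso; nlia.
Qed.

Lemma Mdefined2_flip1 (u : point F n * point F n) :
  Mdefined2 u -> Mdefined2 (map_pair (@flip1 F n) u).
Proof. by case: u => x y [Mx My]; split; apply: flip1_Mdefined. Qed.

Lemma Mdefined2_flipn (u : point F n * point F n) :
  Mdefined2 u -> Mdefined2 (map_pair (@flipn F n) u).
Proof. by case: u => x y [Mx My]; split; apply: flipn_Mdefined. Qed.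

Lemma map_flip1K (u : point F n * point F n) :
  map_pair (@flip1 F n) (map_pair (@flip1 F n) u) = u.
Proof. by case: u => x y; rewrite /map_pair /= !flip1K. Qed.

End Reduce.

Lemma flipn_Mdefined2_inv (F : fieldType) (n : nat) (hn : (4 <= n)%N) (w : point F n * point F n) :
  Mdefined2 (map_pair (@flipn F n) w) -> Mdefined2 w.
Proof.
case: w => p q Mw; have := Mdefined2_flipn hn Mw; case: Mw => -[/(_ n) h1 _ _] [/(_ n) h2 _ _].
move: h1 h2; rewrite /map_pair /= !flipn_x_n // !invr_eq0 => h1 h2.
by rewrite !flipnK // ?h1 ?h2 //; nlia.
Qed.

Section Intertwine.
#[local] Opaque crystal_e2 flip1 flipn map_pair Mdefined2 R_related e2_ok.

(** The nodes 0 and n follow from 1 and n - 1 by transport along the two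
    symmetries, which preserve the relation. *)
Lemma R_related_crystal_e2 (F : numFieldType) (n : nat) (hn : (4 <= n)%N) (i : nat) (hi : (i <= n)%N)
    (c : F) (c0 : c != 0) (u v : point F n * point F n) :
  e2_ok i c u -> e2_ok i c v -> Mdefined2 (crystal_e2 i c u) -> Mdefined2 (crystal_e2 i c v) ->
  R_related u v -> R_related (crystal_e2 i c u) (crystal_e2 i c v).
Proof.
move=> ou ov Mu Mv uv.
have [e|[e|h]] : i = 0%N \/ i = n \/ (1 <= i <= n.-1)%N by nlia.
- subst i; have h1 : (1 <= 1 <= n.-1)%N by nlia.
  rewrite -(crystal_e2_flip1 hn c u) in Mu *; rewrite -(crystal_e2_flip1 hn c v) in Mv *.
  have Mu' := Mdefined2_flip1 hn Mu; have Mv' := Mdefined2_flip1 hn Mv.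
  rewrite (map_flip1K hn) in Mu'; rewrite (map_flip1K hn) in Mv'.
  exact: (R_related_flip1 hn (R_related_e2 hn h1 c0 (e2_ok_flip1 hn ou) (e2_ok_flip1 hn ov)
            Mu' Mv' (R_related_flip1 hn uv))).
- rewrite {i hi}e in ou ov Mu Mv *; have h1 : (1 <= n.-1 <= n.-1)%N by nlia.
  rewrite -(crystal_e2_flipn hn c0 ou) in Mu *; rewrite -(crystal_e2_flipn hn c0 ov) in Mv *.
  exact: (R_related_flipn hn (R_related_e2 hn h1 c0 (e2_ok_flipn hn ou) (e2_ok_flipn hn ov)
            (flipn_Mdefined2_inv hn Mu) (flipn_Mdefined2_inv hn Mv) (R_related_flipn hn uv))).
exact: R_related_e2.
Qed.

End Intertwine.

(** * Inverses of crystal operators *)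

Section Inverse.
Variables (F : fieldType) (n : nat).
Hypothesis hn : (4 <= n)%N.
Implicit Types (x y : point F n) (c t : F).

(** The facts about a single factor which yield that e_i^(1/c) inverts e_i^c on
    pairs: e_i^t divides eps_i by t and multiplies phi_i by t. *)
Definition e_inverse (i : nat) t x : Prop :=
  [/\ eps i (crystal_e i t x) = t^-1 * eps i x, phi i (crystal_e i t x) = t * phi i x,
      xi_ok i t^-1 (crystal_e i t x) & crystal_e i t^-1 (crystal_e i t x) = x].

Lemma e_inverse_bulk i t x : (1 <= i <= n - 2)%N -> t != 0 -> Mdefined x -> xi_ok i t x ->
  e_inverse i t x.
Proof.
move=> hi t0 Mx ok.
have [s0 t1] : xc x i.+1 + bc x i.+1 != 0 /\ xc x i.+1 + t * bc x i.+1 != 0.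
  by have := ok ltac:(nlia); rewrite /pivot ifF; side.
have [x0 x1] : xc x i != 0 /\ xc x i.+1 != 0 by case: Mx => h _ _; split; apply: h; nlia.
have [b0 b1] : bc x i != 0 /\ bc x i.+1 != 0 by case: Mx => _ h _; split; apply: h; nlia.
have e1 := xc_i hn (c := t) (x := x) hi erefl; have e2 := bc_i hn (c := t) (x := x) hi erefl.
have e3 := xc_i1 hn (c := t) (x := x) hi erefl; have e4 := bc_i1 hn (c := t) (x := x) hi erefl.
rewrite /e_inverse; set x' := crystal_e i t x in e1 e2 e3 e4 *.
have xi0 : xi t x i.+1 != 0 by rewrite /xi mulf_neq0 ?invr_eq0.
have f1 : xc x' i.+1 + bc x' i.+1 != 0.
  have -> : xc x' i.+1 + bc x' i.+1 = xi t x i.+1 / t * (xc x i.+1 + t * bc x i.+1).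
    by rewrite e3 e4; fld.
  by rewrite !mulf_neq0 ?invr_eq0.
have f2 : xc x' i.+1 + t^-1 * bc x' i.+1 != 0.
  have -> : xc x' i.+1 + t^-1 * bc x' i.+1 = xi t x i.+1 / t * (xc x i.+1 + bc x i.+1).
    by rewrite e3 e4; fld.
  by rewrite !mulf_neq0 ?invr_eq0.
have xiV : xi t^-1 x' i.+1 = (xi t x i.+1)^-1.
  have s1 : bc x i.+1 + xc x i.+1 != 0 by rewrite addrC.
  rewrite {1}/xi e3 e4 [in RHS]/xi; move: xi0; rewrite /xi.
  set q := (_ + _) / _ => q0.
  have -> : q^-1 = (xc x i.+1 + bc x i.+1) / (xc x i.+1 + t * bc x i.+1) by rewrite /q invf_div.
  by fld; rewrite -mulrA [_ * t]mulrC -mulrDr mulf_neq0.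
have xiE : xi t x i.+1 = (xc x i.+1 + t * bc x i.+1) / (xc x i.+1 + bc x i.+1) by [].
split.
- rewrite /eps ifF 1?ifT 1?ifF 1?ifT; side.
  rewrite e2 e3 e4 xiE;  fld.
- rewrite /phi ifF 1?ifT 1?ifF 1?ifT; side.
  by rewrite e1 e3 e4 xiE; fld.
- by move=> _; rewrite /pivot ifF; side.
have tV0 : t^-1 != 0 by rewrite invr_eq0.
apply: point_ext => // k hk.
  have [->|[->|[h1 h2]]] : k = i \/ k = i.+1 \/ k <> i /\ k <> i.+1 by nlia.
  - by rewrite (xc_i hn hi erefl) xiV e1; fld.
  - by rewrite (xc_i1 hn hi erefl) xiV e3; fld.
  by rewrite !(xc_same hn hi erefl).
have [->|[->|[h1 h2]]] : k = i \/ k = i.+1 \/ k <> i /\ k <> i.+1 by nlia.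
- by rewrite (bc_i hn hi erefl) xiV e2; fld.
- by rewrite (bc_i1 hn hi erefl) xiV e4; fld.
by rewrite !(bc_same hn hi erefl).
Qed.

Lemma e_inverse_spin i t x : i.+1 = n -> t != 0 -> Mdefined x -> e_inverse i t x.
Proof.
move=> ei t0 Mx; have en : n.-1 = i by nlia.
have e1 := spin_x_i hn (c := t) (x := x) ei erefl; have e2 := spin_x_n hn (c := t) (x := x) ei erefl.
have e3 := spin_bc hn (c := t) (x := x) ei erefl.
have tV0 : t^-1 != 0 by rewrite invr_eq0.
split.
- rewrite /eps ifF 1?ifF 1?ifT 1?ifF 1?ifF 1?ifT; side.
  by rewrite en e2 e3 ?mulrA; side.
- by rewrite /phi ifF 1?ifF 1?ifT 1?ifF 1?ifF 1?ifT; side; rewrite en e1.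
- by move=> h; exfalso; nlia.
apply: point_ext => // k hk.
  have [->|[->|h]] : k = i \/ k = n \/ (1 <= k < i)%N by nlia.
  - by rewrite (spin_x_i hn ei erefl) e1 mulKf.
  - by rewrite (spin_x_n hn ei erefl) e2 invrK mulVKf.
  by rewrite !(spin_xc hn ei erefl).
by rewrite !(spin_bc hn ei erefl) //; nlia.
Qed.

Lemma xi_ok_flip1 t x : xi_ok 1 t (flip1 x) <-> xi_ok 0 t x.
Proof.
rewrite /xi_ok /pivot /= flip1_xc ?flip1_bc; side.
by split=> H h; apply: H; nlia.
Qed.

Lemma e_inverse_all i t x : (i <= n)%N -> t != 0 -> Mdefined x -> xi_ok i t x -> e_inverse i t x.
Proof.
move=> hi t0 Mx ok.
have [e|[h|[e|e]]] : i = 0%N \/ (1 <= i <= n - 2)%N \/ i.+1 = n \/ i = n by nlia.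
- subst i; have h1 : (1 <= 1 <= n - 2)%N by nlia.
  have [E1 E2 E3 E4] := e_inverse_bulk h1 t0 (flip1_Mdefined hn Mx) (iffRL (xi_ok_flip1 _ _) ok).
  split; rewrite -!(crystal_e_flip1 hn) ?flip1K // -?eps_flip1 -?phi_flip1 ?flip1K //.
  - by apply/xi_ok_flip1; rewrite flip1K.
  by rewrite E4 flip1K.
- exact: e_inverse_bulk.
- exact: e_inverse_spin.
subst i; have x0 : xc x n != 0 by case: Mx => + _ _; apply; nlia.
have en : n.-1.+1 = n by nlia.
have [E1 E2 E3 E4] := e_inverse_spin en t0 (flipn_Mdefined hn Mx).
have tV0 : t^-1 != 0 by rewrite invr_eq0.
have z0 : xc (crystal_e n.-1 t (flipn x)) n != 0.
  by rewrite (spin_x_n hn en erefl) mulf_neq0 // flipn_x_n // invr_eq0.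
have y0 : xc (flipn (crystal_e n.-1 t (flipn x))) n != 0 by rewrite flipn_x_n // invr_eq0.
split.
- by rewrite -!(crystal_e_flipn hn t0 x0) -!(eps_flipn hn) // flipnK.
- by rewrite -!(crystal_e_flipn hn t0 x0) -!(phi_flipn hn) flipnK.
- by move=> h; exfalso; nlia.
by rewrite -!(crystal_e_flipn hn t0 x0) -(crystal_e_flipn hn tV0 y0) flipnK // E4 flipnK.
Qed.

(** With eps_i(y) divided by c2 and phi_i(x) multiplied by c1, the scalars that
    belong to 1/c at the image are 1/c1 and 1/c2. *)
Lemma crystal_e2_inverse i c (u : point F n * point F n) : (i <= n)%N -> c != 0 ->
  e2_ok i c u -> Mdefined2 (crystal_e2 i c u) ->
  e2_ok i c^-1 (crystal_e2 i c u) /\ crystal_e2 i c^-1 (crystal_e2 i c u) = u.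
Proof.
case: u => x y hi c0 ok; have [a1 a2] := e2_scalars_neq0 c0 ok.
have d0 := e2_denominator_neq0 c0 ok.
case: ok => [[Mx My] s0 t0 okx oky] [Mx' My'].
have [X1 X2 X3 X4] := e_inverse_all hi a1 Mx okx.
have [Y1 Y2 Y3 Y4] := e_inverse_all hi a2 My oky.
rewrite /crystal_e2 in Mx' My' *; rewrite /= in Mx' My'.
move: a1 a2 Mx' My' X1 X2 X3 X4 Y1 Y2 Y3 Y4.
set c1 := (c * phi i x + eps i y) / _; set c2 := _ / (phi i x + c^-1 * eps i y).
move=> a1 a2 Mx' My' X1 X2 X3 X4 Y1 Y2 Y3 Y4.
have r0 : phi i x * c + eps i y != 0 by rewrite mulrC.
have S : c1 * phi i x + c2^-1 * eps i y =
    (c * phi i x + eps i y) * (c * phi i x + eps i y) / (c * (phi i x + eps i y)).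
  by rewrite /c1 /c2; fld.
have S0 : c1 * phi i x + c2^-1 * eps i y != 0 by rewrite S !mulf_neq0 ?invr_eq0 ?mulf_neq0.
have S' : c^-1 * (c1 * phi i x) + c2^-1 * eps i y = (c * phi i x + eps i y) / c.
  by rewrite /c1 /c2; fld.
have S0' : c^-1 * (c1 * phi i x) + c2^-1 * eps i y != 0 by rewrite S' mulf_neq0 ?invr_eq0.
have C1 : (c^-1 * (c1 * phi i x) + c2^-1 * eps i y) / (c1 * phi i x + c2^-1 * eps i y) = c1^-1.
  by rewrite S S' /c1; fld.
have C2 : (c1 * phi i x + c2^-1 * eps i y) / (c1 * phi i x + (c^-1)^-1 * (c2^-1 * eps i y)) = c2^-1.
  have -> : c1 * phi i x + (c^-1)^-1 * (c2^-1 * eps i y) = c * (c^-1 * (c1 * phi i x) + c2^-1 * eps i y) by fld.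
  by rewrite S S' /c2; fld.
rewrite /e2_ok X2 Y1 C1 C2 X4 Y4; by split.
Qed.

End Inverse.

(** * Regularity of the crystal operators at points over any field *)

(** The condition that Xbar_i stays nonzero under e_i^t; for i = 0, 1, n - 1, n
    it is not a denominator of M(x, z). *)
Definition xbar_ok (F : fieldType) (n i : nat) (t : F) (x : point F n) : Prop :=
  (2 <= i <= n - 2)%N -> t * xc x i + bc x i != 0.

(** Strengthens [e2_ok] so that M is also defined at the image under e_i^c. *)
Definition e2_fine (F : fieldType) (n i : nat) (c : F) (xy : point F n * point F n) : Prop :=
  let: (x, y) := xy in
  let c1 := (c * phi i x + eps i y) / (phi i x + eps i y) in
  let c2 := (phi i x + eps i y) / (phi i x + c^-1 * eps i y) in
  [/\ e2_ok i c xy, xbar_ok i c1 x & xbar_ok i c2 y].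

Section Defined.
Variables (F : fieldType) (n : nat).
Hypothesis hn : (4 <= n)%N.

Lemma Mdefined_crystal_e i (t : F) (x : point F n) : (i <= n)%N -> t != 0 ->
  Mdefined x -> xi_ok i t x -> xbar_ok i t x -> Mdefined (crystal_e i t x).
Proof.
move=> hi t0 Mx ok Xok; have [hx hb hX] := Mx.
have tV0 : t^-1 != 0 by rewrite invr_eq0.
rewrite /crystal_e; case: ifP => i0; last case: ifP => i1; last case: ifP => i2.
- have {}i0 : i = 0%N by apply/eqP.
  have [s0 t1] : xc x 2 + bc x 2 != 0 /\ xc x 2 + t * bc x 2 != 0.
    by have := ok; rewrite /xi_ok /pivot i0 /=; apply; nlia.
  have xi0 : xi t x 2 != 0 by rewrite /xi mulf_neq0 ?invr_eq0.
  have xiV0 : (xi t x 2)^-1 != 0 by rewrite invr_eq0.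
  move: (xi t x 2) xi0 xiV0 => q q0 qV0.
  have [x2 b2] : xc x 2 != 0 /\ bc x 2 != 0 by split; [apply: hx|apply: hb]; nlia.
  split=> k hk.
  + rewrite xc_mkpoint; side.
    by case: ifP => _; last case: ifP => _; rewrite ?mulf_neq0 ?hx ?hb; side.
  + rewrite bc_mkpoint; side.
    by case: ifP => _; last case: ifP => _; rewrite ?mulf_neq0 ?hx ?hb; side.
  rewrite /Xbar xc_mkpoint ?bc_mkpoint; side.
  have [->|h] : k = 2 \/ (3 <= k)%N by nlia.
    rewrite /=; have -> : 1 + q * bc x 2 / (t^-1 * q * xc x 2) = (xc x 2 + t * bc x 2) / xc x 2 by fld.
    by rewrite mulf_neq0 ?invr_eq0.
  by rewrite !ifF; side; apply: hX.
- have {}i0 : i <> 0%N by move/eqP: i0.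
  have [s0 t1] : xc x i.+1 + bc x i.+1 != 0 /\ xc x i.+1 + t * bc x i.+1 != 0.
    by have := ok i1; rewrite /pivot ifF; side.
  have xi0 : xi t x i.+1 != 0 by rewrite /xi mulf_neq0 ?invr_eq0.
  have xiV0 : (xi t x i.+1)^-1 != 0 by rewrite invr_eq0.
  move: (xi t x i.+1) xi0 xiV0 => q q0 qV0.
  have [x1 b1] : xc x i.+1 != 0 /\ bc x i.+1 != 0 by split; [apply: hx|apply: hb]; nlia.
  have [x0 b0] : xc x i != 0 /\ bc x i != 0 by split; [apply: hx|apply: hb]; nlia.
  split=> k hk.
  + rewrite xc_mkpoint; side.
    by case: ifP => _; last case: ifP => _; rewrite ?mulf_neq0 ?hx ?hb; side.
  + rewrite bc_mkpoint; side.
    by case: ifP => _; last case: ifP => _; rewrite ?mulf_neq0 ?hx ?hb; side.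
  rewrite /Xbar xc_mkpoint ?bc_mkpoint; side.
  have [ek|[ek|[h1 h2]]] : k = i \/ k = i.+1 \/ k <> i /\ k <> i.+1 by nlia.
  + rewrite ek eqxx; have u0 := Xok ltac:(nlia).
    have -> : 1 + q^-1 * bc x i / (t / q * xc x i) = (t * xc x i + bc x i) / (t * xc x i) by fld.
    by rewrite mulf_neq0 ?invr_eq0 ?mulf_neq0.
  + have e1 : (i.+1 == i) = false by nlia.
    rewrite ek e1 eqxx.
    have -> : 1 + q * bc x i.+1 / (t^-1 * q * xc x i.+1) = (xc x i.+1 + t * bc x i.+1) / xc x i.+1 by fld.
    by rewrite mulf_neq0 ?invr_eq0.
  by rewrite !ifF; side; apply: hX.
- split=> k hk.
  + rewrite xc_mkpoint; side.
    by case: ifP => _; last case: ifP => _; rewrite ?mulf_neq0 ?hx ?hb; side.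
  + by rewrite bc_mkpoint; side; apply: hb.
  rewrite /Xbar xc_mkpoint ?bc_mkpoint; side.
  by rewrite !ifF; side; apply: hX.
split=> k hk.
+ rewrite xc_mkpoint; side.
  by case: ifP => _; rewrite ?mulf_neq0 ?hx ?hb; side.
+ rewrite bc_mkpoint; side.
  by case: ifP => _; rewrite ?mulf_neq0 ?hx ?hb; side.
rewrite /Xbar xc_mkpoint ?bc_mkpoint; side.
by rewrite !ifF; side; apply: hX.
Qed.

Lemma Mdefined2_crystal_e2 i c (u : point F n * point F n) : (i <= n)%N -> c != 0 ->
  e2_fine i c u -> Mdefined2 (crystal_e2 i c u).
Proof.
case: u => x y hi c0 [ok o1 o2]; have [a1 a2] := e2_scalars_neq0 c0 ok.
by case: ok => [[Mx My] _ _ okx oky]; split; apply: Mdefined_crystal_e.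
Qed.

Lemma join_unjoin (u : (dimBB n).-tuple F) : join (unjoin u) = u.
Proof.
apply: eq_from_tnth => j; rewrite /join /unjoin /=.
have := splitK j; case: (split j) => k <- /=.
  by rewrite tnth_lshift tnth_mktuple.
by rewrite tnth_rshift tnth_mktuple.
Qed.

Lemma unjoin_join (xy : point F n * point F n) : unjoin (join xy) = xy.
Proof.
case: xy => x y; rewrite /unjoin /join; congr pair; apply: eq_from_tnth => k;
  by rewrite tnth_mktuple ?tnth_lshift ?tnth_rshift.
Qed.

End Defined.

Section PointValue.
Variables (R : fieldType) (n : nat).
Hypothesis hn : (4 <= n)%N.
Variables (L : fieldType) (h : {rmorphism R -> L}) (u : (dimBB n).-tuple L).
Local Notation fv f a := (fun_value h f u a).
Local Notation K := (funfield R (dimBB n)).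

(** P is a point with coordinates in the function field, p its value at u;
    missing coordinates are 0 on both sides. *)
Definition point_value (P : point K n) (p : point L n) : Prop :=
  forall k, fv (nth 0 P k) (nth 0 p k).

Lemma generic_point_value :
  point_value (unjoin (generic_point R (dimBB n))).1 (unjoin u).1 /\
  point_value (unjoin (generic_point R (dimBB n))).2 (unjoin u).2.
Proof.
split=> k; have [hk|hk] := ltnP k (dimB n); try by
  rewrite !nth_default ?size_tuple //; apply: fun_value0.
  rewrite -!(tnth_nth _ _ (Ordinal hk)) !tnth_mktuple; exact: fun_value_coord.
rewrite -!(tnth_nth _ _ (Ordinal hk)) !tnth_mktuple; exact: fun_value_coord.
Qed.

Variables (P : point K n) (p : point L n).
Hypothesis Pp : point_value P p.

Lemma xc_value k : fv (xc P k) (xc p k).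
Proof. exact: Pp. Qed.

Lemma bc_value k : fv (bc P k) (bc p k).
Proof. exact: Pp. Qed.

Lemma mkpoint_value f g f' g' : (forall k, fv (f k) (f' k)) -> (forall k, fv (g k) (g' k)) ->
  point_value (mkpoint n f g) (mkpoint n f' g').
Proof.
move=> Hf Hg k; have [hk|hk] := ltnP k (dimB n); last first.
  by rewrite !nth_default ?size_tuple //; apply: fun_value0.
by rewrite -!(tnth_nth _ _ (Ordinal hk)) !tnth_mktuple /=; case: ifP.
Qed.

Hypothesis Mp : Mdefined p.

Lemma div_value f g a b : b != 0 -> fv f a -> fv g b -> fv (f / g) (a / b).
Proof. by move=> b0 Hf Hg; apply: fun_valueM => //; apply: fun_valueV. Qed.

Local Ltac fvtac := repeat first
  [ exact: xc_value | exact: bc_value | exact: fun_value1 | assumption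
  | apply: fun_valueM | apply: fun_valueD | (apply: fun_valueV; first by
      [assumption | rewrite invr_eq0 | rewrite !mulf_neq0 ?invr_eq0
       | case: Mp => ? ? _; match goal with H : forall _, _ |- _ => apply: H; nlia end ]) ].

Lemma phi_value i : (i <= n)%N -> fv (phi i P) (phi i p).
Proof.
by move=> hi; rewrite /phi; case: ifP => h0; last case: ifP => h1; last case: ifP => h2; fvtac.
Qed.

Lemma eps_value i : (i <= n)%N -> fv (eps i P) (eps i p).
Proof.
by move=> hi; rewrite /eps; case: ifP => h0; last case: ifP => h1; last case: ifP => h2; fvtac.
Qed.

Lemma crystal_e_value i T t : t != 0 -> fv T t -> xi_ok i t p ->
  point_value (crystal_e i T P) (crystal_e i t p).
Proof.
move=> t0 Tt ok.
have xi_value j : xc p j + bc p j != 0 -> fv (xi T P j) (xi t p j).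
  by move=> s0; rewrite /xi; fvtac.
rewrite /crystal_e; case: ifP => i0; last case: ifP => i1; last case: ifP => i2.
- have [s0 t1] : xc p 2 + bc p 2 != 0 /\ xc p 2 + t * bc p 2 != 0.
    by have := ok; rewrite /xi_ok /pivot i0; apply; move/eqP: i0; nlia.
  have xi0 : xi t p 2 != 0 by rewrite /xi mulf_neq0 ?invr_eq0.
  have Hxi := xi_value _ s0.
  move: (xi T P _) (xi t p _) Hxi xi0 => Q q Qq q0.
  by apply: mkpoint_value => k; (case: ifP => _; last case: ifP => _); fvtac.
- have [s0 t1] : xc p i.+1 + bc p i.+1 != 0 /\ xc p i.+1 + t * bc p i.+1 != 0.
    by have := ok i1; rewrite /pivot i0.
  have xi0 : xi t p i.+1 != 0 by rewrite /xi mulf_neq0 ?invr_eq0.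
  have Hxi := xi_value _ s0.
  move: (xi T P _) (xi t p _) Hxi xi0 => Q q Qq q0.
  by apply: mkpoint_value => k; (case: ifP => _; last case: ifP => _); fvtac.
- apply: mkpoint_value => k; last exact: bc_value.
  by case: ifP => _; last case: ifP => _; fvtac.
by apply: mkpoint_value => k; case: ifP => _; fvtac.
Qed.

End PointValue.

Lemma join_value (R : fieldType) (n : nat) (L : fieldType) (h : {rmorphism R -> L})
    (u : (dimBB n).-tuple L) (PQ : point (funfield R (dimBB n)) n * point (funfield R (dimBB n)) n) pq :
  point_value h u PQ.1 pq.1 -> point_value h u PQ.2 pq.2 ->
  rat_value h (join PQ) u (join pq).
Proof.
move=> H1 H2 j; rewrite /join -(splitK j); case: (split j) => k /=.
  by rewrite !tnth_lshift !(tnth_nth 0).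
by rewrite !tnth_rshift !(tnth_nth 0).
Qed.

(** The rational map e_i^c is the formula at the generic point; its value at u
    is the same formula at u as soon as the denominators are nonzero there.  The
    field L is arbitrary: real points and points over a function field both
    occur. *)
Lemma rat_e_value (R : fieldType) (n : nat) (hn : (4 <= n)%N) (i : nat) (hi : (i <= n)%N) (c : R)
    (L : fieldType) (h : {rmorphism R -> L}) (u : (dimBB n).-tuple L) : c != 0 ->
  e2_ok i (h c) (unjoin u) ->
  rat_value h (rat_e n i c) u (join (crystal_e2 i (h c) (unjoin u))).
Proof.
move=> c0; have [V1 V2] := generic_point_value h u; rewrite /rat_e.
case: (unjoin u) (unjoin (generic_point R (dimBB n))) V1 V2 => [x y] [X Y] /= V1 V2 ok.
have hc0 : h c != 0 by rewrite fmorph_eq0.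
have [a1 a2] := e2_scalars_neq0 hc0 ok; have d0 := e2_denominator_neq0 hc0 ok.
case: ok => [[Mx My] s0 t0 okx oky].
have Hphi := phi_value hn V1 Mx hi; have Heps := eps_value hn V2 My hi.
have Hc := fun_value_const h u c.
apply: join_value => /=; apply: crystal_e_value => //.
  by apply: div_value => //; apply: fun_valueD => //; apply: fun_valueM.
apply: div_value => //; apply: fun_valueD => //; apply: fun_valueM => //.
exact: fun_valueV.
Qed.

(** * Conditions that hold generically over every field *)

(** A single nonzero polynomial forces the condition at the points of all
    extensions L of R, in particular at real points and at the generic point
    over the function field. *)
Definition generic_cond (R : fieldType) (m : nat)
    (P : forall (L : fieldType) (h : {rmorphism R -> L}), m.-tuple L -> Prop) : Prop :=
  exists2 q : {mpoly R[m]}, q != 0 &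
    forall (L : fieldType) (h : {rmorphism R -> L}) (u : m.-tuple L), mmap h (tnth u) q != 0 -> P L h u.

(** A quantity given by the same formula over all fields: its value at u is the
    value at u of the rational function that the formula gives at the generic
    point. *)
Definition natural (R : fieldType) (m : nat)
    (a : forall (L : fieldType) (h : {rmorphism R -> L}), m.-tuple L -> L) : Prop :=
  forall (L : fieldType) (h : {rmorphism R -> L}) (u : m.-tuple L),
    fun_value h (a _ (@const R m) (generic_point R m)) u (a L h u).

Section Generic.
Variables (R : fieldType) (m : nat).

Lemma generic_cond_and (P Q : forall (L : fieldType) (h : {rmorphism R -> L}), m.-tuple L -> Prop) :
  generic_cond P -> generic_cond Q -> generic_cond (fun L h u => P L h u /\ Q L h u).
Proof.
move=> [p p0 HP] [q q0 HQ]; exists (p * q); first exact: mulf_neq0.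
by move=> L h u; rewrite rmorphM mulf_eq0 negb_or => /andP[/HP ? /HQ ?].
Qed.

Lemma generic_cond_sub (P Q : forall (L : fieldType) (h : {rmorphism R -> L}), m.-tuple L -> Prop) :
  (forall L h u, P L h u -> Q L h u) -> generic_cond P -> generic_cond Q.
Proof. by move=> PQ [p p0 HP]; exists p => // L h u /HP /PQ. Qed.

Lemma generic_cond_forall (P : nat -> forall (L : fieldType) (h : {rmorphism R -> L}), m.-tuple L -> Prop) K :
  (forall k, (k < K)%N -> generic_cond (P k)) ->
  generic_cond (fun L h u => forall k, (k < K)%N -> P k L h u).
Proof.
elim: K => [|K IH] H; first by exists 1; [exact: oner_neq0|].
have := generic_cond_and (IH (fun k hk => H k (ltnW hk))) (H K (ltnSn K)).
apply: generic_cond_sub => L h u [H1 H2] k; rewrite ltnS leq_eqVlt => /predU1P[->//|]; exact: H1.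
Qed.

(** Nonvanishing at one real point suffices, as the rational function is then
    nonzero and its numerator can serve as the polynomial.  The subtle point is
    that the numerator of one presentation controls the value computed from
    another. *)
Lemma natural_generic (a : forall (L : fieldType) (h : {rmorphism R -> L}), m.-tuple L -> L) (u0 : m.-tuple R) :
  natural a -> a R idfun u0 != 0 -> generic_cond (fun L h u => a L h u != 0).
Proof.
move=> na a0; have f0 := fun_value_neq0 (na R idfun u0) a0.
have [p [q [q0 e]]] := frac_repr (a _ (@const R m) (generic_point R m)).
exists p => [|L h u pu].
  by apply: contraNneq f0 => p0; rewrite e p0 tofrac0 mul0r.
have [p' [q' [e' q0' ->]]] := na L h u.
have nq' : q' != 0 by apply: contraNneq q0' => ->; rewrite rmorph0.
move: e'; rewrite e => /eqP; rewrite eqr_div ?tofrac_eq0 // -!tofracM tofrac_eq => /eqP eq.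
have := congr1 (mmap h (tnth u)) eq; rewrite !rmorphM /= => em.
rewrite mulf_neq0 ?invr_eq0 //; apply: contraNneq pu => p'0.
by move/eqP: em; rewrite p'0 mul0r mulf_eq0 (negPf q0') orbF.
Qed.

Lemma generic_cond_generically (P : forall (L : fieldType) (h : {rmorphism R -> L}), m.-tuple L -> Prop) :
  generic_cond P -> generically (P R idfun).
Proof. by move=> [q q0 H]; exists q => // u qu; apply: H. Qed.

Lemma generic_cond_generic_point (P : forall (L : fieldType) (h : {rmorphism R -> L}), m.-tuple L -> Prop) :
  generic_cond P -> P _ (@const R m) (generic_point R m).
Proof.
by move=> [q q0 H]; apply: H; rewrite mmap_generic_point tofrac_eq0.
Qed.

Local Notation fam := (forall (L : fieldType) (h : {rmorphism R -> L}), m.-tuple L -> L).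

Lemma naturalD (a b : fam) : natural a -> natural b -> @natural R m (fun L h u => a L h u + b L h u).
Proof. by move=> na nb L h u; apply: fun_valueD. Qed.

Lemma naturalM (a b : fam) : natural a -> natural b -> @natural R m (fun L h u => a L h u * b L h u).
Proof. by move=> na nb L h u; apply: fun_valueM. Qed.

Lemma natural_const c : @natural R m (fun L h u => h c).
Proof. by move=> L h u; apply: fun_value_const. Qed.

End Generic.

Section Coordinates.
Variables (R : fieldType) (n : nat).
Hypothesis hn : (4 <= n)%N.

Lemma natural_x1 k : @natural R (dimBB n) (fun L h u => xc (unjoin u).1 k).
Proof. by move=> L h u; apply: xc_value; case: (generic_point_value h u). Qed.

Lemma natural_x2 k : @natural R (dimBB n) (fun L h u => xc (unjoin u).2 k).
Proof. by move=> L h u; apply: xc_value; case: (generic_point_value h u). Qed.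

Lemma natural_b1 k : @natural R (dimBB n) (fun L h u => bc (unjoin u).1 k).
Proof. by move=> L h u; apply: bc_value; case: (generic_point_value h u). Qed.

Lemma natural_b2 k : @natural R (dimBB n) (fun L h u => bc (unjoin u).2 k).
Proof. by move=> L h u; apply: bc_value; case: (generic_point_value h u). Qed.

End Coordinates.

Section GenericFine.
Variables (R : realType) (n : nat).
Hypothesis hn : (4 <= n)%N.

Local Ltac natural_tac := repeat first
  [ exact: natural_x1 | exact: natural_x2 | exact: natural_b1 | exact: natural_b2 | exact: natural_const
  | apply: naturalD | apply: naturalM ].

Let ones : (dimBB n).-tuple R := join (mkpoint n (fun=> 1) (fun=> 1), mkpoint n (fun=> 1) (fun=> 1)).

Lemma generic_Mdefined2 :
  @generic_cond R (dimBB n) (fun L h u => Mdefined2 (unjoin u)).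
Proof.
have gx1 k : (k < n)%N -> @generic_cond R (dimBB n) (fun L h u => xc (unjoin u).1 k.+1 != 0).
  move=> hk; apply: (natural_generic (u0 := ones)); first by natural_tac.
  by rewrite unjoin_join xc_mkpoint ?oner_neq0.
have gx2 k : (k < n)%N -> @generic_cond R (dimBB n) (fun L h u => xc (unjoin u).2 k.+1 != 0).
  move=> hk; apply: (natural_generic (u0 := ones)); first by natural_tac.
  by rewrite unjoin_join xc_mkpoint ?oner_neq0.
have gb1 k : (k < n.-1)%N -> @generic_cond R (dimBB n) (fun L h u =>
    bc (unjoin u).1 k.+1 != 0 /\ xc (unjoin u).1 k.+1 + bc (unjoin u).1 k.+1 != 0).
  move=> hk; apply: generic_cond_and; apply: (natural_generic (u0 := ones)); try by natural_tac.
    by rewrite unjoin_join bc_mkpoint ?oner_neq0 //; nlia.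
  by rewrite unjoin_join bc_mkpoint ?xc_mkpoint ?(pnatr_eq0 R 2) //; nlia.
have gb2 k : (k < n.-1)%N -> @generic_cond R (dimBB n) (fun L h u =>
    bc (unjoin u).2 k.+1 != 0 /\ xc (unjoin u).2 k.+1 + bc (unjoin u).2 k.+1 != 0).
  move=> hk; apply: generic_cond_and; apply: (natural_generic (u0 := ones)); try by natural_tac.
    by rewrite unjoin_join bc_mkpoint ?oner_neq0 //; nlia.
  by rewrite unjoin_join bc_mkpoint ?xc_mkpoint ?(pnatr_eq0 R 2) //; nlia.
have := generic_cond_and (generic_cond_and (generic_cond_forall gx1) (generic_cond_forall gx2))
  (generic_cond_and (generic_cond_forall gb1) (generic_cond_forall gb2)).
apply: generic_cond_sub => L h u [[h1 h2] [h3 h4]].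
have Md (x : point L n) : (forall k, (k < n)%N -> xc x k.+1 != 0) ->
  (forall k, (k < n.-1)%N -> bc x k.+1 != 0 /\ xc x k.+1 + bc x k.+1 != 0) -> Mdefined x.
  move=> H1 H2; split=> k hk.
  - by have := H1 k.-1 ltac:(nlia); rewrite prednK //; nlia.
  - by have [] := H2 k.-1 ltac:(nlia); rewrite prednK //; nlia.
  have [] := H2 k.-1 ltac:(nlia); rewrite prednK; side => b0 s0.
  have := H1 k.-1 ltac:(nlia); rewrite prednK; side => x0.
  have -> : Xbar x k = (xc x k + bc x k) / xc x k by rewrite /Xbar; fld.
  by rewrite mulf_neq0 ?invr_eq0.
by split; apply: Md.
Qed.

Local Notation fam := (forall (L : fieldType) (h : {rmorphism R -> L}), (dimBB n).-tuple L -> L).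
Local Notation nonzero a := (@generic_cond R (dimBB n) (fun L h u => a L h u != 0)).

Lemma generic_e2_fine_spin (i : nat) (c : R) : (n.-1 <= i <= n)%N -> c != 0 ->
  @generic_cond R (dimBB n) (fun L h u => e2_fine i (h c) (unjoin u)).
Proof.
move=> hi c0.
pose f : fam := fun L h u => if i == n.-1 then xc (unjoin u).1 n.-1
                             else xc (unjoin u).1 n.-1 * xc (unjoin u).1 n.
pose e : fam := fun L h u => if i == n.-1 then xc (unjoin u).2 n * bc (unjoin u).2 n.-1
                             else bc (unjoin u).2 n.-1.
have nf : natural f by rewrite /f; case: (i == n.-1); natural_tac.
have ne : natural e by rewrite /e; case: (i == n.-1); natural_tac.
(* Here x_(n-1) = 0, hence phi_i(x) = 0 while eps_i(y) = 1, and the value of c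
   does not matter. *)
pose u0 : (dimBB n).-tuple R :=
  join (mkpoint n (fun k => if k == n.-1 then 0 else 1) (fun=> 1), mkpoint n (fun=> 1) (fun=> 1)).
have f0 : f R idfun u0 = 0.
  by rewrite /f unjoin_join /= xc_mkpoint ?eqxx ?mul0r ?if_same; side.
have e0 : e R idfun u0 = 1.
  by rewrite /e unjoin_join /= xc_mkpoint ?bc_mkpoint ?mulr1 ?if_same; side.
pose P1 : fam := fun L h u => f L h u + e L h u.
pose P2 : fam := fun L h u => h c * f L h u + e L h u.
have g1 : nonzero P1.
  apply: (natural_generic (a := P1) (u0 := u0)); first exact: naturalD.
  by rewrite /P1 f0 e0 add0r oner_neq0.
have g2 : nonzero P2.
  apply: (natural_generic (a := P2) (u0 := u0)).
    by apply: naturalD => //; apply: naturalM => //; apply: natural_const.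
  by rewrite /P2 f0 e0 mulr0 add0r oner_neq0.
apply: generic_cond_sub (generic_cond_and generic_Mdefined2 (generic_cond_and g1 g2)) => L h u.
rewrite /P1 /P2 /f /e; case: (unjoin u) => x y /= [[Mx My] [k1 k2]].
have i0 : (i == 0%N) = false by nlia.
have i1 : (i <= n - 2)%N = false by nlia.
split.
- by split=> //; rewrite /phi /eps ?i0 ?i1 //; rewrite /xi_ok i1.
- by move=> h2; exfalso; nlia.
by move=> h2; exfalso; nlia.
Qed.

(** With denominators cleared, phi_i(x) + eps_i(y) and c phi_i(x) + eps_i(y)
    become polynomials P1 and P2, c1 becomes P2 / P1 and c2 becomes c P1 / P2,
    and every condition is the nonvanishing of a polynomial.  Whatever c <> 0
    is, they are all nonzero at the point u0, where phi_i(x) = 0: there P1 = P2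
    and c1 = 1, c2 = c.  That some coordinates of u0 vanish is harmless: the
    condition that no coordinate vanishes is a separate one,
    [generic_Mdefined2], and a product of nonzero polynomials is nonzero. *)
Lemma generic_e2_fine_bulk (i : nat) (c : R) : (i <= n - 2)%N -> c != 0 ->
  @generic_cond R (dimBB n) (fun L h u => e2_fine i (h c) (unjoin u)).
Proof.
move=> hi c0; set j := pivot i.
have [hj ji] : (2 <= j <= n.-1)%N /\ j <> i.
  have [e|e] : i = 0%N \/ i <> 0%N by nlia.
    by rewrite /j /pivot e /=; split; nlia.
  by rewrite /j /pivot ifF; side; split; nlia.
pose A : fam := fun L h u => if i == 0%N then bc (unjoin u).1 1 else xc (unjoin u).1 i.
pose A' : fam := fun L h u => if i == 0%N then xc (unjoin u).2 1 else bc (unjoin u).2 i.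
pose X : fam := fun L h u => xc (unjoin u).1 j.
pose B : fam := fun L h u => bc (unjoin u).1 j.
pose X' : fam := fun L h u => xc (unjoin u).2 j.
pose B' : fam := fun L h u => bc (unjoin u).2 j.
pose Xi : fam := fun L h u => xc (unjoin u).1 i.
pose Bi : fam := fun L h u => bc (unjoin u).1 i.
pose Xi' : fam := fun L h u => xc (unjoin u).2 i.
pose Bi' : fam := fun L h u => bc (unjoin u).2 i.
have nA : natural A by rewrite /A; case: (i == 0%N); natural_tac.
have nA' : natural A' by rewrite /A'; case: (i == 0%N); natural_tac.
have nX : natural X by natural_tac.
have nB : natural B by natural_tac.
have nX' : natural X' by natural_tac.
have nB' : natural B' by natural_tac.
have nXi : natural Xi by natural_tac.
have nBi : natural Bi by natural_tac.
have nXi' : natural Xi' by natural_tac.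
have nBi' : natural Bi' by natural_tac.
pose C : fam := fun L h u => h c.
have nC : natural C by exact: natural_const.
pose P1 : fam := fun L h u => A L h u * (B L h u + X L h u) * B' L h u + A' L h u * (X' L h u + B' L h u) * X L h u.
pose P2 : fam := fun L h u => C L h u * (A L h u * (B L h u + X L h u) * B' L h u) + A' L h u * (X' L h u + B' L h u) * X L h u.
have nP1 : natural P1 by rewrite /P1; apply: naturalD; do !apply: naturalM => //; apply: naturalD.
have nP2 : natural P2 by rewrite /P2; apply: naturalD; do !apply: naturalM => //; apply: naturalD.
(* The zeros make phi_i(x) and the coordinates x_j, x_i of the second factor
   vanish; all other coordinates are 1. *)
pose u0 : (dimBB n).-tuple R :=
  join (mkpoint n (fun k => if k == i then 0 else 1) (fun k => if (i == 0%N) && (k == 1%N) then 0 else 1),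
        mkpoint n (fun k => if (k == i) || (k == j) then 0 else 1) (fun=> 1)).
have eA : A R idfun u0 = 0.
  have [e|e] : i = 0%N \/ i <> 0%N by nlia.
    by rewrite /A unjoin_join /= bc_mkpoint; side; rewrite e.
  have i0 : (i == 0%N) = false by nlia.
  by rewrite /A unjoin_join /= i0 xc_mkpoint ?eqxx; side.
have eA' : A' R idfun u0 = 1.
  have [e|e] : i = 0%N \/ i <> 0%N by nlia.
    by rewrite /A' unjoin_join /= xc_mkpoint; side; rewrite /j /pivot e.
  have i0 : (i == 0%N) = false by nlia.
  by rewrite /A' unjoin_join /= i0 bc_mkpoint; side.
have eX : X R idfun u0 = 1 by rewrite /X unjoin_join /= xc_mkpoint; side; rewrite ifF; side.
have eB : B R idfun u0 = 1.
  rewrite /B unjoin_join /= bc_mkpoint; side.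
  by have -> : (j == 1%N) = false by [nlia]; rewrite andbF.
have eX' : X' R idfun u0 = 0 by rewrite /X' unjoin_join /= xc_mkpoint ?eqxx ?orbT; side.
have eB' : B' R idfun u0 = 1 by rewrite /B' unjoin_join /= bc_mkpoint; side.
have eC : C R idfun u0 = c by [].
have eP1 : P1 R idfun u0 = 1 by rewrite /P1 eA eA' eX eB eX' eB'; ring.
have eP2 : P2 R idfun u0 = 1 by rewrite /P2 eA eA' eX eB eX' eB'; ring.
have g1 : nonzero P1 by apply: (natural_generic nP1 (u0 := u0)); rewrite eP1 oner_neq0.
have g2 : nonzero P2 by apply: (natural_generic nP2 (u0 := u0)); rewrite eP2 oner_neq0.
(* D3 and D4 are the numerators of x_j + c1 xbar_j and of its counterpart, with
   c2, for the second factor. *)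
pose D3 : fam := fun L h u => X L h u * P1 L h u + B L h u * P2 L h u.
have g3 : nonzero D3.
  apply: (natural_generic (a := D3) (u0 := u0)).
    by apply: naturalD; apply: naturalM.
  by rewrite /D3 eX eP1 eB eP2 !mulr1 (pnatr_eq0 R 2).
pose D4 : fam := fun L h u => X' L h u * P2 L h u + C L h u * (B' L h u * P1 L h u).
have g4 : nonzero D4.
  apply: (natural_generic (a := D4) (u0 := u0)).
    by apply: naturalD; do !apply: naturalM.
  by rewrite /D4 eX' eP1 eB' eP2 eC mul0r !mulr1 add0r.
have g5 : @generic_cond R (dimBB n) (fun L h u => (2 <= i)%N -> P2 L h u * Xi L h u + P1 L h u * Bi L h u != 0).
  have [i2|i2] := leqP 2 i; last by exists 1; [exact: oner_neq0|].
  apply: generic_cond_sub (natural_generic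
    (a := fun L h u => P2 L h u * Xi L h u + P1 L h u * Bi L h u) (u0 := u0) _ _) => //.
    by apply: naturalD; do !apply: naturalM.
  rewrite eP1 eP2 /Xi /Bi unjoin_join /= xc_mkpoint ?bc_mkpoint ?eqxx; side.
  have -> : (i == 0%N) = false by nlia.
  by rewrite mulr0 mulr1 add0r oner_neq0.
have g6 : @generic_cond R (dimBB n) (fun L h u => (2 <= i)%N ->
    C L h u * (P1 L h u * Xi' L h u) + P2 L h u * Bi' L h u != 0).
  have [i2|i2] := leqP 2 i; last by exists 1; [exact: oner_neq0|].
  apply: generic_cond_sub (natural_generic
    (a := fun L h u => C L h u * (P1 L h u * Xi' L h u) + P2 L h u * Bi' L h u) (u0 := u0) _ _) => //.
    by apply: naturalD; do !apply: naturalM.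
  rewrite eP1 eP2 /Xi' /Bi' unjoin_join /= xc_mkpoint ?bc_mkpoint ?eqxx; side.
  by rewrite /= !mulr0 mulr1 add0r oner_neq0.
pose D7 : fam := fun L h u => X L h u + B L h u.
have g7 : nonzero D7.
  apply: (natural_generic (a := D7) (u0 := u0)); first exact: naturalD.
  by rewrite /D7 eX eB (pnatr_eq0 R 2).
pose D8 : fam := fun L h u => X' L h u + B' L h u.
have g8 : nonzero D8.
  apply: (natural_generic (a := D8) (u0 := u0)); first exact: naturalD.
  by rewrite /D8 eX' eB' add0r oner_neq0.
apply: generic_cond_sub (generic_cond_and (generic_cond_and generic_Mdefined2 (generic_cond_and g1 g2))
  (generic_cond_and (generic_cond_and g3 g4) (generic_cond_and (generic_cond_and g5 g6) (generic_cond_and g7 g8))))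
  => L h u.
rewrite /D3 /D4 /D7 /D8 /P1 /P2 /A /A' /X /B /X' /B' /Xi /Bi /Xi' /Bi' /C; clear -hn hi c0 hj ji.
case: (unjoin u) => x y /=.
set A := if _ then bc x 1 else _; set A' := if _ then xc y 1 else _.
move=> [[[Mx My] [k1 k2]] [[k3 k4] [[k5 k6] [k7 k8]]]].
have hc0 : h c != 0 by rewrite fmorph_eq0.
have [x0 b0] : xc x j != 0 /\ bc y j != 0 by case: Mx My => hx _ _ [_ hb _]; split; [apply: hx|apply: hb]; nlia.
have phiE : phi i x = A * (bc x j / xc x j + 1).
  by rewrite /phi /A /j /pivot hi; case: ifP.
have epsE : eps i y = A' * (xc y j / bc y j + 1).
  by rewrite /eps /A' /j /pivot hi; case: ifP.
set P1 := A * (bc x j + xc x j) * bc y j + _ in k1 k3 k4 k5 k6.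
set P2 := h c * (A * _ * _) + _ in k2 k3 k4 k5 k6.
have s1 : phi i x + eps i y = P1 / (xc x j * bc y j) by rewrite phiE epsE /P1; fld.
have s2 : h c * phi i x + eps i y = P2 / (xc x j * bc y j) by rewrite phiE epsE /P2; fld.
have s3 : phi i x + (h c)^-1 * eps i y = P2 / (h c * (xc x j * bc y j)).
  by rewrite phiE epsE /P2; fld.
have c1E : (h c * phi i x + eps i y) / (phi i x + eps i y) = P2 / P1 by rewrite s1 s2; fld.
have c2E : (phi i x + eps i y) / (phi i x + (h c)^-1 * eps i y) = h c * P1 / P2 by rewrite s1 s3; fld.
have s0 : phi i x + eps i y != 0 by rewrite s1 !mulf_neq0 ?invr_eq0 ?mulf_neq0.
have t0 : h c * phi i x + eps i y != 0 by rewrite s2 !mulf_neq0 ?invr_eq0 ?mulf_neq0.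
rewrite /e2_fine /e2_ok c1E c2E; split.
- split=> // _; split=> //.
    have -> : xc x j + P2 / P1 * bc x j = (xc x j * P1 + bc x j * P2) / P1 by fld.
    by rewrite mulf_neq0 ?invr_eq0.
  have -> : xc y j + h c * P1 / P2 * bc y j = (xc y j * P2 + h c * (bc y j * P1)) / P2 by fld.
  by rewrite mulf_neq0 ?invr_eq0.
- move=> h2; have -> : P2 / P1 * xc x i + bc x i = (P2 * xc x i + P1 * bc x i) / P1 by fld.
  by rewrite mulf_neq0 ?invr_eq0 // k5 //; nlia.
move=> h2; have -> : h c * P1 / P2 * xc y i + bc y i = (h c * (P1 * xc y i) + P2 * bc y i) / P2 by fld.
by rewrite mulf_neq0 ?invr_eq0 // k6 //; nlia.
Qed.

Lemma generic_e2_fine (i : nat) (c : R) : (i <= n)%N -> c != 0 ->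
  @generic_cond R (dimBB n) (fun L h u => e2_fine i (h c) (unjoin u)).
Proof.
move=> hi c0; have [h|h] := leqP i (n - 2); first exact: generic_e2_fine_bulk.
by apply: generic_e2_fine_spin => //; nlia.
Qed.

(** The generic point is the value of e_i^c at the point e_i^(1/c)(generic
    point) over the function field, so no nonzero polynomial vanishes along
    e_i^c. *)
Lemma rat_e_dominant (i : nat) (c : R) : (i <= n)%N -> c != 0 -> dominant (rat_e n i c).
Proof.
move=> hi c0; have cV0 : c^-1 != 0 by rewrite invr_eq0.
have fine := generic_cond_generic_point (generic_e2_fine hi cV0).
pose k : {rmorphism R -> funfield R (dimBB n)} := @const R (dimBB n); have kV0 : k c^-1 != 0 by rewrite fmorph_eq0.
have ok : e2_ok i (k c^-1) (unjoin (generic_point R (dimBB n))).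
  by move: fine; case: (unjoin _) => x y [].
have [ok' inv] := crystal_e2_inverse hn hi kV0 ok (Mdefined2_crystal_e2 hn hi kV0 fine).
have kV : (k c^-1)^-1 = k c by rewrite fmorphV invrK.
rewrite kV in ok' inv.
pose v := join (crystal_e2 i (k c^-1) (unjoin (generic_point R (dimBB n)))).
have := rat_e_value hn hi (h := k) (u := v) c0; rewrite unjoin_join inv join_unjoin => /(_ ok') val q q0.
apply: (fun_value_neq0 (fun_value_mmap (h := k) q val)).
by rewrite mmap_generic_point tofrac_eq0.
Qed.

End GenericFine.

Theorem proposition4p6 (R : realType) (n : nat) (hn : (4 <= n)%N)
    (T : ratmap R (dimBB n) (dimBB n)) (hT : is_tropical_R T)
    (i : nat) (hi : (i <= n)%N) (c : R) (hc : c != 0) :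
  same_comp (rat_e n i c) T T (rat_e n i c).
Proof.
have [/birational_dominant domT genT] := hT.
have domE := rat_e_dominant hn hi hc.
have [h1 H1] := dominant_comp (rat_e n i c) domT.
have [h2 H2] := dominant_comp T domE.
suff e : h1 = h2 by exists h1; split=> //; rewrite e.
have fine := generic_cond_generically (generic_e2_fine hn hi hc).
have all := generically_and (generically_and fine genT)
  (generically_and (generically_pullback domT fine) (generically_pullback domE genT)).
apply: ratmap_eq; apply: generically_sub all => u [[fu [v [Tuv [Ruv _]]]] [fT eT]].
have {fT} fv := fT v Tuv.
have ok w : e2_fine i (idfun c) (unjoin w) -> e2_ok i c (unjoin (n := n) w).
  by case: (unjoin w) => x y [].
have Eu := rat_e_value hn hi (h := idfun) hc (ok u fu).
have Ev := rat_e_value hn hi (h := idfun) hc (ok v fv).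
have [w [Tw [Rw uniq_w]]] := eT _ Eu.
have Mu := Mdefined2_crystal_e2 hn hi hc fu; have Mv := Mdefined2_crystal_e2 hn hi hc fv.
have := uniq_w (crystal_e2 i c (unjoin v)); rewrite unjoin_join => /(_ _) wE.
exists (join (crystal_e2 i c (unjoin v))); split; first exact: is_comp_value H1 Tuv Ev.
rewrite -wE; first by rewrite join_unjoin; apply: is_comp_value H2 Eu Tw.
exact: (R_related_crystal_e2 hn hi hc (ok u fu) (ok v fv) Mu Mv Ruv).
Qed.
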